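(* Weak $\Delta$-embedding $\subset_\Delta$ is a partial order relation in the class of von Neumann algebras, if we identify those von Neumann algebras that are weakly Morita equivalent in the sense of Rieffel. That is, on von Neumann algebras $\subset_\Delta$ is reflexive and transitive, and if $A, B$ are von Neumann algebras with $A\subset_\Delta B$ and $B\subset_\Delta A$, then $A$ and $B$ are weakly Morita equivalent in the sense of Rieffel (equivalently, $A\sim_\Delta B$).
   Context: $[S]^{-w^*}$ is the $w^*$-closure of the linear span of $S$. A TRO is a subspace $M\subseteq B(H,K)$ with $m_1m_2^*m_3\in M$ for all $m_i\in M$. $w^*$-closed algebras $A\subseteq B(H)$, $B\subseteq B(K)$ are weakly TRO-equivalent, $A\sim_{TRO}B$, if there is a TRO $M\subseteq B(H,K)$ with $A=[M^*BM]^{-w^*}$ and $B=[MAM^*]^{-w^*}$. For unital $w^*$-closed algebras $A\subseteq B(H)$, $B\subseteq B(K)$, $B\subset_{TRO}A$ means that there is a projection $p\in A$ with $B\sim_{TRO}pAp$, where $pAp$ is identified with $pA|_{p(H)}\subseteq B(p(H))$. For unital dual operator algebras $A,B$ (in particular von Neumann algebras): $A\sim_\Delta B$ means that there exist $w^*$-continuous completely isometric homomorphisms $\alpha:A\to\alpha(A)$, $\beta:B\to\beta(B)$ onto concretely acting algebras with $\alpha(A)\sim_{TRO}\beta(B)$; and $B\subset_\Delta A$ means that there exist such $\alpha,\beta$ with $\beta(B)\subset_{TRO}\alpha(A)$. For von Neumann algebras it is known that the following are equivalent: $A,B$ are weakly Morita equivalent in the sense of Rieffel; $A\sim_\Delta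 B$; there exist faithful normal $*$-representations $\alpha,\beta$ of $A,B$ with $\alpha(A)'$ and $\beta(B)'$ $*$-isomorphic; there exists a cardinal $I$ such that $M_I(A)=A\bar\otimes B(\ell^2(I))$ and $M_I(B)=B\bar\otimes B(\ell^2(I))$ are $*$-isomorphic. *)

(* Defs.v *)
From HB Require Import structures.
From mathcomp Require Import all_boot all_order all_algebra.
From mathcomp Require Import complex.
From mathcomp Require Import all_classical all_reals all_analysis.

Set Implicit Arguments.
Unset Strict Implicit.
Unset Printing Implicit Defensive.

Import Order.TTheory GRing.Theory Num.Theory.
Import numFieldNormedType.Exports.

Local Open Scope classical_set_scope.
Local Open Scope ring_scope.

(* Complex Hilbert spaces; the inner product is linear in its first variable. *)
HB.mixin Record isHilbert (R : realType) H & CompleteNormedModule R[i] H := {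
  inner : H -> H -> R[i] ;
  inner_is_linear : forall (c : R[i]) (x y z : H),
    inner (c *: x + y) z = c * inner x z + inner y z ;
  inner_conj : forall x y : H, inner y x = (inner x y)^* ;
  inner_norm : forall x : H, inner x x = `|x| ^+ 2
}.

#[short(type="hilbertType")]
HB.structure Definition Hilbert (R : realType) :=
  {H of CompleteNormedModule R[i] H & isHilbert R H}.

(* Operators are plain functions; B(H, K) is the set [bounded_op]. *)
Section Operators.
Variable R : realType.
Implicit Types H K L : hilbertType R.

Definition bounded_op H K : set (H -> K) :=
  [set T | linear T /\ exists c : R[i], forall x, `|T x| <= c * `|x|].

(* [adjoint T S] says S = T^*; for bounded T such an S exists, is unique and
   is bounded (Riesz). *)
Definition adjoint H K (T : H -> K) (S : K -> H) : Prop :=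
  forall x y, inner (T x) y = inner x (S y).

Definition positive_op H (T : H -> H) : Prop := forall x, 0 <= inner (T x) x.

Definition adjset H K (M : set (H -> K)) : set (K -> H) :=
  [set S | exists2 T, M T & adjoint T S].

Definition mulset H K L (M : set (K -> L)) (N : set (H -> K)) : set (H -> L) :=
  [set S \o T | S in M & T in N].

Definition subspace_op H K (M : set (H -> K)) : Prop :=
  M 0 /\ forall (c : R[i]) S T, M S -> M T -> M (c *: S + T).

End Operators.

(* The w^*-topology of B(H, K) is induced by its predual, i.e. by the functionals
   T |-> \sum_n <T x_n, y_n> with (x_n), (y_n) square summable. It is set up on
   all functions H -> K, and only ever used relatively to [bounded_op]. *)
Section WeakStar.
Variable R : realType.
Implicit Types H K : hilbertType R.

Definition square_summable H (x : nat -> H) : Prop :=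
  cvgn (series (fun n => (`|x n| ^+ 2 : R[i]^o))).

Definition predual_index H K : Type :=
  {xy : (nat -> H) * (nat -> K) |
    square_summable xy.1 /\ square_summable xy.2}.

Definition predual_eval H K (T : H -> K) (w : predual_index H K) : R[i]^o :=
  limn (series (fun n => (inner (T ((sval w).1 n)) ((sval w).2 n) : R[i]^o))).

Definition wstar H K : topologicalType :=
  initial_topology (@predual_eval H K : _ -> {ptws predual_index H K -> R[i]^o}).

Definition wclosure H K (S : set (H -> K)) : set (H -> K) :=
  @bounded_op R H K `&` closure (S : set (wstar H K)).

(* [S]^{-w*} *)
Definition wspan H K (S : set (H -> K)) : set (H -> K) :=
  wclosure (smallest (@subspace_op R H K) S).

Definition wcontinuous_on H (A : set (H -> H))
    (K K' : hilbertType R) (f : (H -> H) -> (K -> K')) : Prop :=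
  {within (A : set (wstar H H)), continuous (f : wstar H H -> wstar K K')}.

End WeakStar.

(* The Hilbert space p(H). *)
Section ProjectionRange.
Variable R : realType.

Record projection (H : hilbertType R) := Projection {
  proj_op :> H -> H ;
  proj_bounded : @bounded_op R H H proj_op ;
  proj_idem : proj_op \o proj_op = proj_op ;
  proj_selfadjoint : adjoint proj_op proj_op
}.

Variables (H : hilbertType R) (p : projection H).

Record prange : Type := PRange {
  prange_val :> H ;
  prange_valP : prange_val \in [pred x : H | `[< p x = x >]]
}.

HB.instance Definition _ := [isSub of prange for prange_val].
HB.instance Definition _ := [Choice of prange by <:].

Lemma prange_submod : GRing.submod_closed [pred x : H | `[< p x = x >]].
Proof.
have [lp _] := proj_bounded p.
have p0 : p 0 = 0.
  by have := lp (-1) 0 0; rewrite scaler0 addr0 scaleN1r addNr.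
split => [|c x y]; first exact/asboolP.
by move=> /asboolP px /asboolP py; apply/asboolP; rewrite lp px py.
Qed.

HB.instance Definition _ :=
  GRing.SubChoice_isSubLmodule.Build R[i] H _ prange prange_submod.

Lemma prange_norm0 (x : prange) : `|val x| = 0 -> x = 0.
Proof. by move/normr0_eq0 => x0; apply/val_inj; rewrite x0 raddf0. Qed.

Lemma prange_normD (x y : prange) : `|val (x + y)| <= `|val x| + `|val y|.
Proof. by rewrite raddfD ler_normD. Qed.

Lemma prange_normZ (c : R[i]) (x : prange) : `|val (c *: x)| = `|c| * `|val x|.
Proof. by rewrite linearZ normrZ. Qed.

HB.instance Definition _ := Lmodule_isNormed.Build R[i] prange
  prange_normD prange_normZ prange_norm0.

Lemma prange_complete (F : set_system prange) :
  ProperFilter F -> cauchy F -> cvg F.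
Proof.
move=> FF /cauchyP F_cauchy.
have GF : ProperFilter (val @ F) := fmap_proper_filter _ FF.
have /cauchy_cvg/cvg_ex[x /= Gx] : cauchy (val @ F).
  apply/cauchyP => e e0; have [z Fz] := F_cauchy e e0; exists (val z).
  apply: (@filterS _ F _ (ball z e)) Fz => y; rewrite -!ball_normE /=.
  by rewrite [`|z - y|]/(`|val (z - y)|) raddfB.
have [lp [c pc]] := proj_bounded p.
have c1 : 0 < `|c| + 1 by rewrite ltr_wpDl.
have Gpx : val @ F --> p x.
  apply/cvgrPdist_lt => e e0.
  have /cvgrPdist_lt/(_ (e / (`|c| + 1))) := Gx.
  rewrite divr_gt0// => /(_ isT); apply: filterS => y xy.
  have -> : val y = p (val y) by have /asboolP -> := prange_valP y.
  have -> : p x - p (val y) = p (x - val y).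
    by rewrite addrC -scaleN1r -lp scaleN1r addrC.
  apply: (@le_lt_trans _ _ ((`|c| + 1) * `|x - val y|)); last first.
    by rewrite mulrC -ltr_pdivlMr.
  have pxy := pc (x - val y); apply: (le_trans pxy).
  have c0 : 0 <= c * `|x - val y| := le_trans (normr_ge0 _) pxy.
  rewrite -[leLHS]ger0_norm// normrM normr_id ler_wpM2r//.
  by rewrite lerDl.
have px : p x = x by exact: (cvg_unique (@norm_hausdorff _ H) Gpx Gx).
have xP : x \in [pred x : H | `[< p x = x >]] by exact/asboolP.
apply/cvg_ex; exists (PRange xP).
apply/cvgrPdist_lt => e e0; have /cvgrPdist_lt/(_ e e0) := Gx.
apply: filterS => y; rewrite [`|PRange xP - y|]/(`|val (PRange xP - y)|).
by rewrite raddfB.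
Qed.

HB.instance Definition _ := Uniform_isComplete.Build prange prange_complete.

Lemma prange_inner_linear (c : R[i]) (x y z : prange) :
  inner (val (c *: x + y)) (val z) =
  c * inner (val x) (val z) + inner (val y) (val z).
Proof. by rewrite linearP inner_is_linear. Qed.

Lemma prange_inner_conj (x y : prange) :
  inner (val y) (val x) = (inner (val x) (val y))^*.
Proof. exact: inner_conj. Qed.

Lemma prange_inner_norm (x : prange) : inner (val x) (val x) = `|x| ^+ 2.
Proof. exact: inner_norm. Qed.

HB.instance Definition _ := isHilbert.Build R prange
  prange_inner_linear prange_inner_conj prange_inner_norm.

End ProjectionRange.

Section Algebras.
Variable R : realType.
Implicit Types H K : hilbertType R.

Definition wstar_closed_algebra H (A : set (H -> H)) : Prop :=
  [/\ subspace_op A,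
      forall a b, A a -> A b -> A (a \o b),
      A `<=` @bounded_op R H H &
      wclosure A `<=` A].

Definition unital_dual_algebra H (A : set (H -> H)) : Prop :=
  wstar_closed_algebra A /\ A idfun.

Definition von_neumann_algebra H (A : set (H -> H)) : Prop :=
  unital_dual_algebra A /\ adjset A `<=` A.

Definition TRO H K (M : set (H -> K)) : Prop :=
  [/\ subspace_op M,
      M `<=` @bounded_op R H K &
      mulset M (mulset (adjset M) M) `<=` M].

Definition TRO_equiv H K (A : set (H -> H)) (B : set (K -> K)) : Prop :=
  exists M : set (H -> K),
    [/\ TRO M,
        A = wspan (mulset (adjset M) (mulset B M)) &
        B = wspan (mulset M (mulset A (adjset M)))].

(* p A p, identified with p A |_{p(H)} acting on p(H) *)
Definition corner H (p : projection H) (A : set (H -> H)) :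
    set (prange p -> prange p) :=
  [set T | exists2 a, A a & forall x : prange p, val (T x) = p (a (val x))].

Arguments corner {H} p A.

(* B \subset_TRO A *)
Definition TRO_embeds K H (B : set (K -> K)) (A : set (H -> H)) : Prop :=
  [/\ unital_dual_algebra B, unital_dual_algebra A &
      exists2 p : projection H, A p & TRO_equiv B (corner p A)].

Definition hnorm H (x : H) : R := complex.Re `|x|.

(* The norm of the operator H^n -> K^n defined by an n x n matrix of operators. *)
Definition mx_opnorm H K n (a : 'M[H -> K]_n) : R :=
  sup [set Num.sqrt (\sum_(i < n) hnorm (\sum_(j < n) a i j (x j)) ^+ 2) |
        x in [set x : 'I_n -> H | \sum_(j < n) hnorm (x j) ^+ 2 <= 1]].

Definition completely_isometric_on H H' K K' (A : set (H -> H'))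
    (f : (H -> H') -> (K -> K')) : Prop :=
  forall n (a : 'M[H -> H']_n), (forall i j, A (a i j)) ->
    mx_opnorm (map_mx f a) = mx_opnorm a.

(* A w^*-continuous completely isometric homomorphism from A into B(K); only the
   values of f on A matter. *)
Definition wstar_ci_hom H K (A : set (H -> H)) (f : (H -> H) -> (K -> K)) : Prop :=
  [/\ forall a, A a -> @bounded_op R K K (f a),
      forall (c : R[i]) a b, A a -> A b -> f (c *: a + b) = c *: f a + f b,
      forall a b, A a -> A b -> f (a \o b) = f a \o f b,
      completely_isometric_on A f &
      wcontinuous_on A f].

(* A ~_Delta B *)
Definition delta_equiv H K (A : set (H -> H)) (B : set (K -> K)) : Prop :=
  exists (H' K' : hilbertType R)
         (alpha : (H -> H) -> (H' -> H')) (beta : (K -> K) -> (K' -> K')),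
    [/\ wstar_ci_hom A alpha, wstar_ci_hom B beta &
        TRO_equiv (alpha @` A) (beta @` B)].

(* B \subset_Delta A *)
Definition delta_embeds K H (B : set (K -> K)) (A : set (H -> H)) : Prop :=
  exists (H' K' : hilbertType R)
         (alpha : (H -> H) -> (H' -> H')) (beta : (K -> K) -> (K' -> K')),
    [/\ wstar_ci_hom A alpha, wstar_ci_hom B beta &
        TRO_embeds (beta @` B) (alpha @` A)].

End Algebras.

Arguments corner {R H} p A.

Record vnAlgebra (R : realType) := VnAlgebra {
  vn_space : hilbertType R ;
  vn_set :> set (vn_space -> vn_space) ;
  vn_axiom : von_neumann_algebra vn_set
}.

Arguments vn_set {R} v.

(* Rieffel's equivalence bimodules for W^*-algebras (J. Pure Appl. Algebra 5,
   1974): a unital A-B-bimodule with compatible A- and B-valued inner products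
   with w^*-dense spans, each algebra acting by bounded adjointable operators
   for the inner product of the other one, and normally. The A-valued product
   is linear in its first variable, the B-valued one in its second. *)
Section Rieffel.
Variable R : realType.

Definition op_bound (H : hilbertType R) (a : H -> H) (c : R[i]) : Prop :=
  0 <= c /\ forall h, `|a h| <= c * `|h|.

Record equivalence_bimodule (H K : hilbertType R)
    (A : set (H -> H)) (B : set (K -> K)) (X : lmodType R[i])
    (la : (H -> H) -> X -> X) (rb : X -> (K -> K) -> X)
    (ipA : X -> X -> H -> H) (ipB : X -> X -> K -> K) : Prop := {
  la_linear : forall a, A a -> linear (la a) ;
  la_linear_op : forall (c : R[i]) a a' x, A a -> A a' ->
    la (c *: a + a') x = c *: la a x + la a' x ;
  la_comp : forall a a' x, A a -> A a' -> la (a \o a') x = la a (la a' x) ;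
  la_id : forall x, la idfun x = x ;
  rb_linear : forall b, B b -> linear (rb^~ b) ;
  rb_linear_op : forall (c : R[i]) b b' x, B b -> B b' ->
    rb x (c *: b + b') = c *: rb x b + rb x b' ;
  rb_comp : forall b b' x, B b -> B b' -> rb x (b \o b') = rb (rb x b) b' ;
  rb_id : forall x, rb x idfun = x ;
  la_rb : forall a b x, A a -> B b -> la a (rb x b) = rb (la a x) b ;

  ipA_mem : forall x y, A (ipA x y) ;
  ipA_linear : forall y, linear (ipA^~ y) ;
  ipA_module : forall a x y, A a -> ipA (la a x) y = a \o ipA x y ;
  ipA_conj : forall x y, adjoint (ipA x y) (ipA y x) ;
  ipA_ge0 : forall x, positive_op (ipA x x) ;
  ipA_eq0 : forall x, ipA x x = 0 -> x = 0 ;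
  ipA_dense : wspan [set T | exists x y, T = ipA x y] = A ;

  ipB_mem : forall x y, B (ipB x y) ;
  ipB_linear : forall x, linear (ipB x) ;
  ipB_module : forall b x y, B b -> ipB x (rb y b) = ipB x y \o b ;
  ipB_conj : forall x y, adjoint (ipB x y) (ipB y x) ;
  ipB_ge0 : forall x, positive_op (ipB x x) ;
  ipB_eq0 : forall x, ipB x x = 0 -> x = 0 ;
  ipB_dense : wspan [set T | exists x y, T = ipB x y] = B ;

  ip_compat : forall x y z, la (ipA x y) z = rb x (ipB y z) ;

  la_adjoint : forall a a' x y, A a -> adjoint a a' ->
    ipB (la a x) y = ipB x (la a' y) ;
  la_bounded : forall a c x, A a -> op_bound a c ->
    positive_op (c ^+ 2 *: ipB x x - ipB (la a x) (la a x)) ;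
  la_normal : forall x y, wcontinuous_on A (fun a => ipB x (la a y)) ;

  rb_adjoint : forall b b' x y, B b -> adjoint b b' ->
    ipA (rb x b) y = ipA x (rb y b') ;
  rb_bounded : forall b c x, B b -> op_bound b c ->
    positive_op (c ^+ 2 *: ipA x x - ipA (rb x b) (rb x b)) ;
  rb_normal : forall x y, wcontinuous_on B (fun b => ipA (rb x b) y)
}.

Definition weakly_Morita_equiv (H K : hilbertType R)
    (A : set (H -> H)) (B : set (K -> K)) : Prop :=
  exists (X : lmodType R[i]) (la : (H -> H) -> X -> X) (rb : X -> (K -> K) -> X)
         (ipA : X -> X -> H -> H) (ipB : X -> X -> K -> K),
    equivalence_bimodule A B la rb ipA ipB.

End Rieffel.

(* Main.v *)
(* A Delta-embedding of A into B amounts to faithful normal representations tau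
   of A on F and sigma of B on E together with a bimodule X of operators E -> F
   such that x y^* lies in tau A and x^* y in sigma B for x, y in X, and X E is
   total in F. Any two faithful normal representations embed isometrically into
   amplifications of each other, so that sigma can be replaced by any other such
   representation of B (at the price of changing tau), and bimodules compose:
   this is transitivity.

   Antisymmetry is a Cantor-Bernstein argument. Bimodules X for A in B and Y for
   B in A define order-reversing maps S |-> {b | S X b = 0} and T |-> {a | T Y a = 0}
   between ideals of A and of B; a fixed point of their composite provides central
   projections s in A and t in B such that X cut by s and 1 - t, and Y^* cut by
   1 - s and t, are total on both sides. Their direct sum is an equivalence
   bimodule between A and B, from which both the TRO-equivalence and Rieffel's
   bimodule are read off. *)

From HB Require Import structures.
From mathcomp Require Import all_boot all_order all_algebra.
From mathcomp Require Import finmap complex ring lra.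
From mathcomp Require Import all_classical all_reals all_analysis.
Require Import Defs.

Set Implicit Arguments.
Unset Strict Implicit.
Unset Printing Implicit Defensive.
Import Order.TTheory GRing.Theory Num.Theory.
Import numFieldNormedType.Exports.
Local Open Scope classical_set_scope.
Local Open Scope ring_scope.

(** Normality is never handled through limits. By the square summable description of the predual, a
    normal functional is a vector functional of the countable amplification [famp], and a
    representation counts as normal when each [|rho a xi|] is bounded by some [|famp a X|]
    ([dominated]). Closures and continuity become statements about orthogonal projections and Riesz
    vectors, without functional calculus or spectral theory. Two steps carry the weight. A bound
    must be sharpened to an equality of norms before it yields an isometry: a Radon-Nikodym
    argument, with a series in place of a square root. And a faithful normal representation must
    have a normal inverse: the bicommutant theorem puts the projection where domination fails into
    the algebra. The homomorphisms of the definitions are only assumed completely isometric; that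
    they respect adjoints is derived from contractivity of a unital map. Bimodules are mere linear
    spaces, so composing and adding them needs no completion; weak-star density is recovered at the
    end from the fact that an ideal with zero annihilator is dense. *)

Section ComplexModulus.
Variable R : realType.
Implicit Types c d : R[i].

Definition cabs c : R := complex.Re `|c|.

Lemma cabsE c : `|c| = (cabs c)%:C%C.
Proof. by rewrite /cabs RRe_real// ger0_real. Qed.

Lemma cabs_ge0 c : 0 <= cabs c.
Proof. by rewrite -ler0c -cabsE. Qed.

Lemma cabsM c d : cabs (c * d) = cabs c * cabs d.
Proof. by apply: complexI; rewrite rmorphM/= -!cabsE normrM. Qed.

Lemma cabsD c d : cabs (c + d) <= cabs c + cabs d.
Proof. by rewrite -lecR rmorphD/= -!cabsE ler_normD. Qed.

Lemma cabsN c : cabs (- c) = cabs c.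
Proof. by apply: complexI; rewrite -!cabsE normrN. Qed.

Lemma cabs1 : cabs 1 = 1.
Proof. by apply: complexI; rewrite -!cabsE normr1. Qed.

Lemma cabs_eq0 c : cabs c = 0 -> c = 0.
Proof. by move=> c0; apply/normr0_eq0; rewrite cabsE c0. Qed.

Lemma cabs_conj c : cabs c^* = cabs c.
Proof. by apply: complexI; rewrite -!cabsE norm_conjC. Qed.

Lemma cabs_real (r : R) : cabs r%:C%C = `|r|.
Proof.
by apply: complexI; rewrite -cabsE normc_def/= expr0n addr0 sqrtr_sqr.
Qed.

Lemma sqr_cabs c : (cabs c ^+ 2)%:C%C = c * c^*.
Proof. by rewrite rmorphXn/= -cabsE normCK. Qed.

Lemma sqr_cabsE c : cabs c ^+ 2 = complex.Re c ^+ 2 + complex.Im c ^+ 2.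
Proof. by apply: complexI; rewrite rmorphXn/= -cabsE -add_Re2_Im2. Qed.

Lemma Re_le_cabs c : complex.Re c <= cabs c.
Proof.
rewrite (le_trans (ler_norm _))// -(ler_pXn2r (n:=2)) ?nnegrE ?cabs_ge0//.
by rewrite sqr_cabsE real_normK ?num_real// lerDl sqr_ge0.
Qed.

Lemma ReD c d : complex.Re (c + d) = complex.Re c + complex.Re d.
Proof. by case: c; case: d. Qed.

Lemma ReN c : complex.Re (- c) = - complex.Re c.
Proof. by case: c. Qed.

End ComplexModulus.

(** * Hilbert space geometry: projections, Riesz vectors, adjoints *)

Section HilbertBasics.
Variable R : realType.
Implicit Types H K L : hilbertType R.

Lemma hnormE H (x : H) : `|x| = (hnorm x)%:C%C.
Proof. by rewrite /hnorm RRe_real// ger0_real. Qed.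

Lemma hnorm_ge0 H (x : H) : 0 <= hnorm x.
Proof. by rewrite -ler0c -hnormE. Qed.

Lemma hnorm0 H : hnorm (0 : H) = 0.
Proof. by apply: complexI; rewrite -hnormE normr0. Qed.

Lemma hnorm_eq0 H (x : H) : hnorm x = 0 -> x = 0.
Proof. by move=> x0; apply/normr0_eq0; rewrite hnormE x0. Qed.

Lemma hnormD H (x y : H) : hnorm (x + y) <= hnorm x + hnorm y.
Proof. by rewrite -lecR rmorphD/= -!hnormE ler_normD. Qed.

Lemma hnormN H (x : H) : hnorm (- x) = hnorm x.
Proof. by apply: complexI; rewrite -!hnormE normrN. Qed.

Lemma hnormB H (x y : H) : hnorm (x - y) = hnorm (y - x).
Proof. by rewrite -opprB hnormN. Qed.

Lemma hnormZ H c (x : H) : hnorm (c *: x) = cabs c * hnorm x.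
Proof. by apply: complexI; rewrite rmorphM/= -!hnormE -cabsE normrZ. Qed.

Lemma hnormZr H (r : R) (x : H) : hnorm (r%:C%C *: x) = `|r| * hnorm x.
Proof. by rewrite hnormZ cabs_real. Qed.

Lemma innerDl H (x y z : H) : inner (x + y) z = inner x z + inner y z.
Proof. by rewrite -[x]scale1r inner_is_linear mul1r scale1r. Qed.

Lemma inner0l H (z : H) : inner 0 z = 0.
Proof. by apply: (addrI (inner 0 z)); rewrite -innerDl !addr0. Qed.

Lemma innerZl H c (x z : H) : inner (c *: x) z = c * inner x z.
Proof. by rewrite -[c *: x]addr0 inner_is_linear inner0l addr0. Qed.

Lemma innerNl H (x z : H) : inner (- x) z = - inner x z.
Proof. by rewrite -scaleN1r innerZl mulN1r. Qed.

Lemma innerBl H (x y z : H) : inner (x - y) z = inner x z - inner y z.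
Proof. by rewrite innerDl innerNl. Qed.

Lemma innerDr H (x y z : H) : inner z (x + y) = inner z x + inner z y.
Proof. by rewrite inner_conj innerDl rmorphD/= -!inner_conj. Qed.

Lemma innerZr H c (x z : H) : inner z (c *: x) = c^* * inner z x.
Proof. by rewrite inner_conj innerZl rmorphM/= -!inner_conj. Qed.

Lemma inner0r H (z : H) : inner z 0 = 0.
Proof. by rewrite inner_conj inner0l rmorph0. Qed.

Lemma innerNr H (x z : H) : inner z (- x) = - inner z x.
Proof. by rewrite inner_conj innerNl rmorphN/= -!inner_conj. Qed.

Lemma innerBr H (x y z : H) : inner z (x - y) = inner z x - inner z y.
Proof. by rewrite innerDr innerNr. Qed.

Lemma innerxx H (x : H) : inner x x = (hnorm x ^+ 2)%:C%C.
Proof. by rewrite inner_norm hnormE rmorphXn. Qed.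

Lemma innerxx_eq0 H (x : H) : inner x x = 0 -> x = 0.
Proof.
rewrite innerxx => /complexI/eqP; rewrite expf_eq0 => /andP[_ /eqP].
exact: hnorm_eq0.
Qed.

Lemma inner_extl H (x y : H) : (forall z, inner x z = inner y z) -> x = y.
Proof.
by move=> xy; apply/eqP; rewrite -subr_eq0; apply/eqP/innerxx_eq0;
  rewrite innerBl xy subrr.
Qed.

Lemma inner_extr H (x y : H) : (forall z, inner z x = inner z y) -> x = y.
Proof. by move=> xy; apply: inner_extl => z; rewrite inner_conj xy -inner_conj. Qed.

Lemma inner_sym0 H (x y : H) : inner x y = 0 -> inner y x = 0.
Proof. by move=> xy; rewrite inner_conj xy rmorph0. Qed.

Lemma hnorm_sqD H (x y : H) :
  hnorm (x + y) ^+ 2 = hnorm x ^+ 2 + hnorm y ^+ 2 + 2 * complex.Re (inner x y).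
Proof.
have := innerxx (x + y); rewrite innerDl !innerDr !innerxx.
rewrite (inner_conj x y); case: (inner x y) => a b /(congr1 (@complex.Re _))/= <-.
by ring.
Qed.

Lemma hnorm_sqB H (x y : H) :
  hnorm (x - y) ^+ 2 = hnorm x ^+ 2 + hnorm y ^+ 2 - 2 * complex.Re (inner x y).
Proof. by rewrite hnorm_sqD innerNr hnormN ReN mulrN. Qed.

Lemma parallelogram H (x y : H) :
  hnorm (x + y) ^+ 2 + hnorm (x - y) ^+ 2 = 2 * hnorm x ^+ 2 + 2 * hnorm y ^+ 2.
Proof. by rewrite hnorm_sqB hnorm_sqD; ring. Qed.

Lemma hnorm_sqD_orth H (x y : H) : inner x y = 0 ->
  hnorm (x + y) ^+ 2 = hnorm x ^+ 2 + hnorm y ^+ 2.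
Proof. by move=> xy; rewrite hnorm_sqD xy/= mulr0 addr0. Qed.

(** Evaluating at [t = - r s^*] makes the linear term [- 2 r |s|^2], and the minimum is at
    [r = q^-1]. This inequality is the source of Cauchy-Schwarz both for inner products and for
    positive functionals, and of orthogonality from minimality. *)
Lemma discriminant_le (p q : R) (s : R[i]) : 0 <= q ->
  (forall t : R[i], 0 <= p + 2 * complex.Re (t * s) + cabs t ^+ 2 * q) ->
  cabs s ^+ 2 <= p * q.
Proof.
move=> q_ge0 pos.
have key (r : R) : 0 <= p - 2 * r * cabs s ^+ 2 + r ^+ 2 * cabs s ^+ 2 * q.
  have := pos (- (r%:C%C * s^*)).
  rewrite cabsN cabsM cabs_conj cabs_real exprMn real_normK ?num_real//.
  have -> : - (r%:C%C * s^*) * s = (- (r * cabs s ^+ 2))%:C%C.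
    by rewrite rmorphN rmorphM/= sqr_cabs; ring.
  by rewrite /=; lra.
have [q0|q0] := eqVneq q 0.
  have [->|s0] := eqVneq (cabs s) 0; first by rewrite q0 mulr0 expr0n/=.
  have c0 : 0 < cabs s ^+ 2 by rewrite exprn_even_gt0.
  (* Without quadratic term the expression is affine in [r]; this [r] gives it the value [-1]. *)
  have := key ((p + 1) / (2 * cabs s ^+ 2)); rewrite q0 mulr0 addr0.
  have -> : 2 * ((p + 1) / (2 * cabs s ^+ 2)) * cabs s ^+ 2 = p + 1.
    by field; rewrite s0.
  lra.
have {}q0 : 0 < q by rewrite lt_neqAle eq_sym q0.
have := key q^-1.
have -> : p - 2 / q * cabs s ^+ 2 + q^-1 ^+ 2 * cabs s ^+ 2 * q =
  (p * q - cabs s ^+ 2) / q by field; rewrite gt_eqF.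
by rewrite pmulr_lge0 ?invr_gt0// subr_ge0.
Qed.

Lemma cauchy_schwarz H (x y : H) : cabs (inner x y) <= hnorm x * hnorm y.
Proof.
rewrite -(ler_pXn2r (n:=2)) ?nnegrE ?cabs_ge0 ?mulr_ge0 ?hnorm_ge0// exprMn.
apply: discriminant_le => [|t]; first exact: sqr_ge0.
have := sqr_ge0 (hnorm (x + t^* *: y)).
by rewrite hnorm_sqD hnormZ cabs_conj innerZr conjCK exprMn; lra.
Qed.

End HilbertBasics.

Section Projections.
Variable R : realType.
Implicit Types H K L : hilbertType R.

Definition adherent H (S : set H) (x : H) : Prop :=
  forall e : R, 0 < e -> exists2 s, S s & hnorm (x - s) < e.

(** At [U := H -> K] this is convertible to [subspace_op], so [span] below serves vectors and
    operators alike, and the domain in [riesz] may be an operator algebra. *)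
Definition linear_set (U : lmodType R[i]) (S : set U) : Prop :=
  S 0 /\ forall (c : R[i]) x y, S x -> S y -> S (c *: x + y).

Lemma linear_setD (U : lmodType R[i]) (S : set U) x y :
  linear_set S -> S x -> S y -> S (x + y).
Proof. by move=> [_ lS] Sx Sy; rewrite -[x]scale1r; exact: lS. Qed.

Lemma linear_setZ (U : lmodType R[i]) (S : set U) c x :
  linear_set S -> S x -> S (c *: x).
Proof. by move=> [S0 lS] Sx; rewrite -[_ *: _]addr0; exact: lS. Qed.

Lemma linear_setB (U : lmodType R[i]) (S : set U) x y :
  linear_set S -> S x -> S y -> S (x - y).
Proof. by move=> [_ lS] Sx Sy; rewrite addrC -scaleN1r; exact: lS. Qed.

Lemma adherent_sub H (S : set H) x : S x -> adherent S x.
Proof. by move=> Sx e e0; exists x => //; rewrite subrr hnorm0. Qed.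

Lemma hnorm_le_trans H (x y z : H) :
  hnorm (x - z) <= hnorm (x - y) + hnorm (y - z).
Proof. by have := hnormD (x - y) (y - z); rewrite subrKA. Qed.

Lemma adherent_idem H (S : set H) x : adherent (adherent S) x -> adherent S x.
Proof.
move=> Sx e e0; have e2 : 0 < e / 2 by rewrite divr_gt0.
have [y Sy xy] := Sx _ e2; have [s Ss ys] := Sy _ e2.
by exists s => //; rewrite (le_lt_trans (hnorm_le_trans x y s))// [e]splitr ltrD.
Qed.

Lemma adherent_mono H (S T : set H) x : S `<=` T -> adherent S x -> adherent T x.
Proof. by move=> ST Sx e /Sx[s /ST Ts xs]; exists s. Qed.

Lemma adherent_linear H (S : set H) : linear_set S -> linear_set (adherent S).
Proof.
move=> lS; split=> [|c x y Sx Sy e e0]; first by apply: adherent_sub; case: lS.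
have c1 : 0 < cabs c + 1 by rewrite ltr_wpDl ?cabs_ge0.
have [s Ss xs] := Sx (e / 2 / (cabs c + 1)) ltac:(by rewrite !divr_gt0).
have [t St yt] := Sy (e / 2) ltac:(by rewrite divr_gt0).
exists (c *: s + t); first by case: lS => _; exact.
have -> : c *: x + y - (c *: s + t) = c *: (x - s) + (y - t).
  by rewrite scalerBr opprD addrACA.
rewrite (le_lt_trans (hnormD _ _))// [e]splitr ler_ltD// hnormZ.
rewrite (@le_trans _ _ ((cabs c + 1) * hnorm (x - s)))//.
  by rewrite ler_wpM2r ?hnorm_ge0// lerDl.
by rewrite mulrC -ler_pdivlMr// ltW.
Qed.

Lemma inner_adherent0 H (S : set H) x y :
  (forall s, S s -> inner s y = 0) -> adherent S x -> inner x y = 0.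
Proof.
move=> Sy Sx; apply/cabs_eq0/eqP; rewrite eq_le cabs_ge0 andbT.
apply/ler_addgt0Pl => e e0; rewrite addr0.
have y1 : 0 < hnorm y + 1 by rewrite ltr_wpDl ?hnorm_ge0.
have [s /Sy sy xs] := Sx (e / (hnorm y + 1)) ltac:(by rewrite divr_gt0).
rewrite -[inner x y]subr0 -sy -innerBl (le_trans (cauchy_schwarz _ _))//.
rewrite (@le_trans _ _ (hnorm (x - s) * (hnorm y + 1)))//.
  by rewrite ler_wpM2l ?hnorm_ge0// lerDl.
by rewrite -ler_pdivlMr// ltW.
Qed.

Lemma hnorm_adherent_le H (S : set H) x (c : R) :
  (forall s, S s -> hnorm s <= c) -> adherent S x -> hnorm x <= c.
Proof.
move=> Sc Sx; apply/ler_addgt0Pl => e e0; have [s /Sc sc xs] := Sx e e0.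
by rewrite -[x](subrK s) (le_trans (hnormD _ _))// lerD// ltW.
Qed.

Lemma hilbert_complete H (u : nat -> H) :
  (forall e : R, 0 < e -> exists N, forall m n, (N <= m)%N -> (N <= n)%N ->
    hnorm (u m - u n) < e) ->
  exists l, forall e : R, 0 < e -> exists N, forall n, (N <= n)%N ->
    hnorm (l - u n) < e.
Proof.
move=> cu.
have realE (e : R[i]) : 0 < e -> 0 < complex.Re e /\ e = (complex.Re e)%:C%C.
  case: e => a b; rewrite ltcE/= => /andP[/eqP -> ?]; split=> //.
have : cauchy (u @ \oo).
  apply/cauchyP => e /realE[e0 ->].
  have [N uN] := cu _ e0; exists (u N).
  exists N => // n /= Nn; rewrite -ball_normE/= hnormE ltcR.
  exact: uN.
move=> /cauchy_cvg/cvg_ex[l /= ul]; exists l => e e0.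
have eC : 0 < e%:C%C :> R[i] by rewrite ltcE/= eqxx.
have /cvgrPdist_lt/(_ _ eC)[N _ uN] := ul.
by exists N => n Nn; have := uN _ Nn; rewrite /= hnormE ltcR.
Qed.

Lemma natSinv_lt (e : R) : 0 < e -> exists N : nat, N.+1%:R^-1 < e.
Proof.
move=> e0; have [N _ /(_ _ (leqnn N))] := near_infty_natSinv_lt (PosNum e0).
by exists N.
Qed.

(** A minimising sequence is Cauchy by the parallelogram identity. [S] is not assumed closed, hence
    [e] is only adherent to it. *)
Theorem orthogonal_decomposition H (S : set H) : linear_set S ->
  forall h, exists2 e, adherent S e & forall s, S s -> inner s (h - e) = 0.
Proof.
move=> lS h; pose D := [set hnorm (h - s) ^+ 2 | s in S].
have D0 : D !=set0 by exists (hnorm (h - 0) ^+ 2), 0 => //; case: lS.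
have lD : lbound D 0 by move=> _ [s _ <-]; exact: sqr_ge0.
have infD : has_inf D by split=> //; exists 0.
pose d := inf D.
have dS s : S s -> d <= hnorm (h - s) ^+ 2.
  by move=> Ss; apply: ge_inf; [exists 0|exists s].
have ex n : exists s, S s /\ hnorm (h - s) ^+ 2 < d + n.+1%:R^-1.
  have n0 : 0 < n.+1%:R^-1 :> R by rewrite invr_gt0.
  have [_ [s Ss <-] ds] := inf_adherent n0 infD.
  by exists s.
have /choice[u uP] := ex.
have uu m n : hnorm (u m - u n) ^+ 2 <= 2 * (m.+1%:R^-1 + n.+1%:R^-1).
  have := parallelogram (h - u m) (h - u n).
  have -> : h - u m - (h - u n) = u n - u m by rewrite opprB addrC subrKA.
  (* The midpoint of [u m] and [u n] is in [S], so its squared distance to [h] is at least [d]; this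
     bounds the first term of the parallelogram identity from below. *)
  have -> : h - u m + (h - u n) = 2%:C%C *: (h - (2^-1)%:C%C *: (u m + u n)).
    rewrite scalerBr scalerA -rmorphM/= divff// scale1r.
    by rewrite addrACA -opprD -mulr2n -scaler_nat rmorph_nat.
  rewrite hnormZr exprMn ger0_norm// (hnormB (u n)).
  have A0 := dS ((2^-1)%:C%C *: (u m + u n)) ltac:(by
    apply: linear_setZ => //; apply: linear_setD => //; case: (uP m); case: (uP n)) => A3.
  have [_] := uP m; have [_] := uP n; move: A0 A3.
  by move: (m.+1%:R^-1) (n.+1%:R^-1) => a b; lra.
have [e|l ul] := @hilbert_complete _ u.
  move=> e0; have [N N4] : exists N : nat, N.+1%:R^-1 < e ^+ 2 / 4 :> R.
    by apply: natSinv_lt; rewrite divr_gt0// exprn_gt0.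
  exists N => m n Nm Nn; rewrite -(ltr_pXn2r (n:=2)) ?nnegrE ?hnorm_ge0 ?(ltW e0)//.
  have hm k : (N <= k)%N -> k.+1%:R^-1 <= N.+1%:R^-1 :> R.
    by move=> Nk; rewrite lef_pV2 ?posrE// ler_nat.
  have := uu m n; have := hm _ Nm; have := hm _ Nn; move: N4.
  by move: (m.+1%:R^-1) (n.+1%:R^-1) (N.+1%:R^-1) => a b c; lra.
have Sl : adherent S l.
  by move=> e e0; have [N uN] := ul e e0; exists (u N); [case: (uP N)|exact: uN].
exists l => //.
have d0 : 0 <= d by apply: lb_le_inf.
have ld : hnorm (h - l) <= Num.sqrt d.
  apply/ler_addgt0Pl => e e0; have e2 : 0 < e / 2 by rewrite divr_gt0.
  have [N uN] := ul _ e2; have [M M4] := natSinv_lt (exprn_gt0 2 e2).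
  have [_ /ltW uM] := uP (maxn M N).
  have le1 := hnorm_le_trans h (u (maxn M N)) l.
  have : hnorm (l - u (maxn M N)) <= e / 2 by rewrite ltW// uN// leq_maxr.
  rewrite hnormB => le2.
  suff : hnorm (h - u (maxn M N)) <= Num.sqrt d + e / 2 by lra.
  rewrite -(ler_pXn2r (n:=2)) ?nnegrE ?hnorm_ge0 ?addr_ge0 ?sqrtr_ge0 ?(ltW e2)//.
  rewrite (le_trans uM)// sqrrD sqr_sqrtr//.
  have hm : (maxn M N).+1%:R^-1 <= M.+1%:R^-1 :> R.
    by rewrite lef_pV2 ?posrE// ler_nat ltnS leq_maxl.
  have : 0 <= Num.sqrt d * (e / 2) by rewrite mulr_ge0 ?sqrtr_ge0 ?(ltW e2).
  move: hm M4; move: (_.+1%:R^-1) (M.+1%:R^-1) => a b; rewrite mulr2n; lra.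
move=> s Ss; apply: inner_sym0.
have lmin t : hnorm (h - l) ^+ 2 <= hnorm (h - l + t *: s) ^+ 2.
  rewrite ler_pXn2r ?nnegrE ?hnorm_ge0// (le_trans ld)//.
  apply/ler_addgt0Pl => e e0.
  have : adherent S (l - t *: s).
    by apply: linear_setB (adherent_linear lS) Sl _; apply: adherent_sub; apply: linear_setZ.
  move=> /(_ _ e0)[z Sz lz].
  have -> : h - l + t *: s = h - (l - t *: s) by rewrite opprB addrA addrAC.
  rewrite (@le_trans _ _ (hnorm (h - z)))//.
    rewrite -(ler_pXn2r (n:=2)) ?nnegrE ?hnorm_ge0 ?sqrtr_ge0//.
    by rewrite sqr_sqrtr// dS.
  by rewrite (le_trans (hnorm_le_trans _ (l - t *: s) _))// addrC lerD// ltW.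
(* Minimality along all complex multiples of [s] is the discriminant inequality with constant term
   [0], which kills the inner product. *)
apply/cabs_eq0/eqP; rewrite -sqrf_eq0 eq_le sqr_ge0 andbT.
rewrite -[leRHS](mul0r (hnorm s ^+ 2)); apply: discriminant_le => [|t].
  exact: sqr_ge0.
have := lmin t^*; rewrite [leRHS]hnorm_sqD hnormZ cabs_conj innerZr conjCK exprMn; lra.
Qed.

(** As [y] is itself a limit of test vectors, testing near [y] gives almost [|y|^2] on the left and
    [c |y|] on the right. *)
Lemma hnorm_adherent_dual H (S : set H) (y : H) (c : R) :
  (forall s, S s -> cabs (inner s y) <= c * hnorm s) -> adherent S y -> 0 <= c ->
  hnorm y <= c.
Proof.
move=> sy Sy c0.
have [->//|y0] := eqVneq (hnorm y) 0.
have {}y0 : 0 < hnorm y by rewrite lt_neqAle eq_sym y0 hnorm_ge0.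
rewrite -(ler_pM2r y0); apply/ler_addgt0Pr => d d0.
have y1 : 0 < hnorm y + c + 1 by lra.
have [s Ss ys] := Sy (d / (hnorm y + c + 1)) ltac:(by rewrite divr_gt0).
have ysd : (hnorm y + c + 1) * hnorm (y - s) <= d by rewrite mulrC -ler_pdivlMr// ltW.
have ys0 := hnorm_ge0 (y - s).
have h1 : hnorm y * hnorm y <= cabs (inner s y) + hnorm (y - s) * hnorm y.
  rewrite (le_trans _ (lerD (lexx _) (cauchy_schwarz (y - s) y)))//.
  rewrite (le_trans _ (cabsD _ _))// -innerDl addrC subrK innerxx cabs_real.
  by rewrite -expr2 ger0_norm// sqr_ge0.
have h2 := sy _ Ss.
have h3 : hnorm s <= hnorm y + hnorm (y - s).
  have := hnormD (s - y) y; rewrite subrK addrC hnormB => /le_trans; exact.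
have h4 : c * hnorm s <= c * (hnorm y + hnorm (y - s)) by rewrite ler_wpM2l.
nra.
Qed.

(** Stated on the domain of a linear map [u], because in most uses [D] is an operator algebra and
    [u a] is the image of a fixed vector; the bound by [|u a|] lets [f] factor through [u] without
    forming a quotient. The vector is a multiple of the component [g] of some [u a0], with
    [f a0 = 1], orthogonal to the image of the kernel of [f]. *)
Theorem riesz (U : lmodType R[i]) (D : set U) H (u : U -> H) (f : U -> R[i])
    (c : R) :
  linear_set D ->
  (forall k a b, D a -> D b -> u (k *: a + b) = k *: u a + u b) ->
  (forall k a b, D a -> D b -> f (k *: a + b) = k * f a + f b) ->
  (forall a, D a -> cabs (f a) <= c * hnorm (u a)) ->
  exists y, [/\ adherent (u @` D) y, forall a, D a -> f a = inner (u a) y &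
                 0 <= c -> hnorm y <= c].
Proof.
move=> lD lu lf fc.
have u0 : u 0 = 0.
  have := lu (-1) 0 0 (proj1 lD) (proj1 lD).
  by rewrite scaler0 addr0 scaleN1r addNr.
have f0 : f 0 = 0.
  have := lf (-1) 0 0 (proj1 lD) (proj1 lD).
  by rewrite scaler0 addr0 mulN1r addNr.
have lim : linear_set (u @` D).
  split; first by exists 0 => //; case: lD.
  move=> k _ _ [a Da <-] [b Db <-]; exists (k *: a + b); last exact: lu.
  by case: lD => _; exact.
have [f_0|] := pselect (forall a, D a -> f a = 0).
  exists 0; split=> [|a Da|]; last by rewrite hnorm0.
    by apply: adherent_sub; case: lim.
  by rewrite inner0r f_0.
move=> /existsNP[a1 /not_implyP[Da1 /eqP fa1]].
pose a0 := (f a1)^-1 *: a1.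
have Da0 : D a0 by exact: linear_setZ.
have fa0 : f a0 = 1.
  by rewrite /a0 -[X in f X]addr0 lf// ?f0 ?addr0 ?mulVf//; case: lD.
pose N := u @` [set a | D a /\ f a = 0].
have lN : linear_set N.
  split; first by exists 0 => //; split=> //; case: lD.
  move=> k _ _ [a [Da fa] <-] [b [Db fb] <-]; exists (k *: a + b); last exact: lu.
  by split; [case: lD => _; exact|rewrite lf// fa fb mulr0 addr0].
have [e Ne eorth] := orthogonal_decomposition lN (u a0).
pose g := u a0 - e.
have ND : N `<=` u @` D by move=> _ [a [Da _] <-]; exists a.
(* The bound keeps [u a0] at distance at least [c^-1] from the image of the kernel; this is why [g]
   is nonzero although that image need not be closed. *)
have cg1 : 1 <= c * hnorm g.
  have [c0|c0] := leP 0 c; last first.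
    have := fc _ Da0; rewrite fa0 cabs1 => h1.
    have : c * hnorm (u a0) <= 0 by rewrite mulr_le0_ge0 ?hnorm_ge0// ltW.
    lra.
  apply/ler_addgt0Pr => d d0; have c1 : 0 < c + 1 by lra.
  have [_ [a [Da fa] <-] ed] := Ne (d / (c + 1)) ltac:(by rewrite divr_gt0).
  have h1 : 1 <= c * hnorm (u a0 - u a).
    have Db : D (a0 - a) by exact: linear_setB.
    have bE : a0 - a = (-1) *: a + a0 by rewrite scaleN1r addrC.
    have := fc _ Db; rewrite bE lu// lf// fa mulr0 add0r fa0 cabs1.
    by rewrite scaleN1r addrC.
  have h2 := hnorm_le_trans (u a0) e (u a).
  have h3 : c * hnorm (e - u a) <= d.
    rewrite (@le_trans _ _ ((c + 1) * hnorm (e - u a)))//.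
      by rewrite ler_wpM2r ?hnorm_ge0// lerDl.
    by rewrite mulrC -ler_pdivlMr// ltW.
  have h4 : c * hnorm (u a0 - u a) <= c * (hnorm g + hnorm (e - u a)).
    by rewrite ler_wpM2l.
  lra.
have g0 : hnorm g != 0.
  by apply/eqP => g0; move: cg1; rewrite g0 mulr0 ler10.
have ug a : D a -> inner (u a) g = f a * (hnorm g ^+ 2)%:C%C.
  move=> Da; have : inner (u (- f a *: a0 + a)) g = 0.
    apply: eorth; exists (- f a *: a0 + a) => //; split.
      by case: lD => _; exact.
    by rewrite lf// fa0 mulr1 addNr.
  rewrite lu// innerDl innerZl mulNr => /eqP; rewrite addrC subr_eq0 => /eqP ->.
  rewrite -[u a0](subrK e) innerDl -/g innerxx.
  by rewrite (inner_adherent0 eorth Ne) addr0.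
exists ((hnorm g ^- 2)%:C%C *: g).
have uy a : D a -> f a = inner (u a) ((hnorm g ^- 2)%:C%C *: g).
  move=> Da; rewrite innerZr ug// conj_Creal ?complex_real// mulrCA -rmorphM/=.
  by rewrite mulVf ?expf_neq0// mulr1.
have Sy : adherent (u @` D) ((hnorm g ^- 2)%:C%C *: g).
  have lA := adherent_linear lim.
  apply: (linear_setZ _ lA); apply: (linear_setB lA).
    by apply: adherent_sub; exists a0.
  exact: adherent_mono Ne.
split=> // c0; set y := _ *: g in uy Sy *.
by apply: hnorm_adherent_dual Sy c0 => _ [a Da <-]; rewrite -uy// fc.
Qed.

End Projections.

Section Operators.
Variable R : realType.
Implicit Types H K L : hilbertType R.

Lemma bounded_opP H K (T : H -> K) : bounded_op T <->
  (forall (k : R[i]) x y, T (k *: x + y) = k *: T x + T y) /\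
  exists2 c : R, 0 <= c & forall x, hnorm (T x) <= c * hnorm x.
Proof.
split=> [[lT [c Tc]]|[lT [c c0 Tc]]]; last first.
  split=> //; exists c%:C%C => x.
  by rewrite !hnormE -rmorphM lecR.
split=> //; exists (cabs c) => [|x]; first exact: cabs_ge0.
rewrite -lecR rmorphM/= -!hnormE -cabsE (le_trans (Tc x))//.
have c0 : 0 <= c * `|x| := le_trans (normr_ge0 _) (Tc x).
by rewrite -[leLHS]ger0_norm// normrM normr_id.
Qed.

Lemma bopP H K (T : H -> K) : bounded_op T ->
  forall (k : R[i]) x y, T (k *: x + y) = k *: T x + T y.
Proof. by move=> /bounded_opP[]. Qed.

Lemma bop0 H K (T : H -> K) : bounded_op T -> T 0 = 0.
Proof.
move=> bT; have := bopP bT (-1) 0 0.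
by rewrite scaler0 addr0 scaleN1r addNr.
Qed.

Lemma bopD H K (T : H -> K) : bounded_op T -> forall x y, T (x + y) = T x + T y.
Proof. by move=> bT x y; rewrite -[x]scale1r bopP// !scale1r. Qed.

Lemma bopZ H K (T : H -> K) : bounded_op T -> forall k x, T (k *: x) = k *: T x.
Proof. by move=> bT k x; rewrite -[k *: x]addr0 bopP// bop0// addr0. Qed.

Lemma bopN H K (T : H -> K) : bounded_op T -> forall x, T (- x) = - T x.
Proof. by move=> bT x; rewrite -scaleN1r bopZ// scaleN1r. Qed.

Lemma bopB H K (T : H -> K) : bounded_op T -> forall x y, T (x - y) = T x - T y.
Proof. by move=> bT x y; rewrite bopD// bopN. Qed.

Lemma bop_bound H K (T : H -> K) : bounded_op T ->
  exists2 c : R, 0 <= c & forall x, hnorm (T x) <= c * hnorm x.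
Proof. by move=> /bounded_opP[]. Qed.

Lemma bop_comp H K L (S : K -> L) (T : H -> K) :
  bounded_op S -> bounded_op T -> bounded_op (S \o T).
Proof.
move=> bS bT; apply/bounded_opP; split => [k x y|].
  by rewrite /= !bopP.
have [c c0 Sc] := bop_bound bS; have [d d0 Td] := bop_bound bT.
exists (c * d) => [|x]; first exact: mulr_ge0.
by rewrite (le_trans (Sc _))// -mulrA ler_wpM2l.
Qed.

Lemma bop_lin H K (c : R[i]) (S T : H -> K) :
  bounded_op S -> bounded_op T -> bounded_op (c *: S + T).
Proof.
move=> bS bT; apply/bounded_opP; split => [k x y|].
  rewrite -[LHS]/(c *: S (k *: x + y) + T (k *: x + y)).
  rewrite -[in RHS]/(k *: (c *: S x + T x) + (c *: S y + T y)).
  by rewrite (bopP bS) (bopP bT) !scalerDr !scalerA [c * k]mulrC addrACA.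
have [a a0 Sa] := bop_bound bS; have [d d0 Td] := bop_bound bT.
exists (cabs c * a + d) => [|x]; first by rewrite addr_ge0// mulr_ge0 ?cabs_ge0.
rewrite (le_trans (hnormD _ _))// mulrDl lerD//.
by rewrite hnormZ -mulrA ler_wpM2l ?cabs_ge0.
Qed.

Lemma bop_cst0 H K : bounded_op (0 : H -> K).
Proof.
apply/bounded_opP; split=> [k x y|]; first by rewrite scaler0 addr0.
by exists 0 => // x; rewrite hnorm0 mul0r.
Qed.

Lemma bop_linear_set H K : linear_set (@bounded_op R H K).
Proof. by split=> [|c S T]; [exact: bop_cst0|exact: bop_lin]. Qed.

Lemma bop_id H : bounded_op (idfun : H -> H).
Proof.
by apply/bounded_opP; split=> //; exists 1 => // x; rewrite mul1r.
Qed.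

Lemma adjoint_exists H K (T : H -> K) : bounded_op T ->
  exists S, adjoint T S /\ bounded_op S.
Proof.
move=> bT; have [c c0 Tc] := bop_bound bT.
have /choice[S SP] (y : K) : exists z, (forall x, inner (T x) y = inner x z) /\
    hnorm z <= c * hnorm y.
  have [] := @riesz _ H setT H id (fun x => inner (T x) y) (c * hnorm y).
  - by [].
  - by [].
  - by move=> k a b _ _; rewrite bopP// inner_is_linear.
  - move=> a _; rewrite (le_trans (cauchy_schwarz _ _))// mulrAC.
    by rewrite ler_wpM2r ?hnorm_ge0.
  move=> z [_ zP zc]; exists z; split=> [x|]; first exact: zP.
  by rewrite zc// mulr_ge0 ?hnorm_ge0.
exists S; split=> [x y|]; first by have [->] := SP y.
apply/bounded_opP; split=> [k x y|]; last first.
  by exists c => // y; have [_] := SP y.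
apply: inner_extr => z; rewrite innerDr innerZr.
have [<- _] := SP (k *: x + y); have [<- _] := SP x; have [<- _] := SP y.
by rewrite innerDr innerZr.
Qed.

(** A total function, with value [0] on maps that have no bounded adjoint. *)
Definition adj H K (T : H -> K) : K -> H :=
  xget (0 : K -> H) [set S | adjoint T S /\ bounded_op S].

Lemma adj_spec H K (T : H -> K) :
  bounded_op T -> adjoint T (adj T) /\ bounded_op (adj T).
Proof. by move=> /adjoint_exists[S]; rewrite /adj; case: xgetP => [? -> //|/(_ S)]. Qed.

Lemma adjP H K (T : H -> K) : bounded_op T ->
  forall x y, inner (T x) y = inner x (adj T y).
Proof. by move=> /adj_spec[+ _]; apply. Qed.

Lemma adjPr H K (T : H -> K) : bounded_op T ->
  forall x y, inner y (T x) = inner (adj T y) x.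
Proof. by move=> bT x y; rewrite inner_conj adjP// -inner_conj. Qed.

Lemma bop_adj H K (T : H -> K) : bounded_op T -> bounded_op (adj T).
Proof. by move=> /adj_spec[]. Qed.

Lemma adj_uniq H K (T : H -> K) S : bounded_op T -> adjoint T S -> S = adj T.
Proof.
by move=> bT TS; apply/funext => y; apply: inner_extr => x; rewrite -TS adjP.
Qed.

Lemma adjoint_sym H K (T : H -> K) S : adjoint T S -> adjoint S T.
Proof. by move=> TS x y; rewrite inner_conj -TS -inner_conj. Qed.

Lemma adjK H K (T : H -> K) : bounded_op T -> adj (adj T) = T.
Proof.
move=> bT; apply/esym/adj_uniq; first exact: bop_adj.
by apply: adjoint_sym; case: (adj_spec bT).
Qed.

Lemma adj_comp H K L (S : K -> L) (T : H -> K) :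
  bounded_op S -> bounded_op T -> adj (S \o T) = adj T \o adj S.
Proof.
move=> bS bT; apply/esym/adj_uniq; first exact: bop_comp.
by move=> x y; rewrite /= !adjP.
Qed.

Lemma adj_lin H K (c : R[i]) (S T : H -> K) : bounded_op S -> bounded_op T ->
  adj (c *: S + T) = c^* *: adj S + adj T.
Proof.
move=> bS bT; apply/esym/adj_uniq; first exact: bop_lin.
move=> x y; rewrite -[in LHS]/(c *: S x + T x).
rewrite -[(_ + adj T) y]/(c^* *: adj S y + adj T y).
by rewrite innerDl innerZl innerDr innerZr conjCK !adjP.
Qed.

Lemma adj_id H : adj (idfun : H -> H) = idfun.
Proof. by apply/esym/adj_uniq => //; exact: bop_id. Qed.

Lemma adj0 H K : adj (0 : H -> K) = 0.
Proof.
by apply/esym/adj_uniq => [|x y]; [exact: bop_cst0|rewrite inner0l inner0r].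
Qed.

Lemma bop_adherent H K (T : H -> K) (S : set H) x : bounded_op T ->
  adherent S x -> adherent (T @` S) (T x).
Proof.
move=> bT Sx e e0; have [c c0 Tc] := bop_bound bT.
have c1 : 0 < c + 1 by lra.
have [s Ss xs] := Sx (e / (c + 1)) ltac:(by rewrite divr_gt0).
exists (T s); first by exists s.
rewrite -bopB// (le_lt_trans (Tc _))// (@le_lt_trans _ _ ((c + 1) * hnorm (x - s)))//.
  by rewrite ler_wpM2r ?hnorm_ge0// lerDl.
by rewrite mulrC -ltr_pdivlMr.
Qed.

Lemma bop_adherent_eq0 H K (T : H -> K) (S : set H) x : bounded_op T ->
  (forall s, S s -> T s = 0) -> adherent S x -> T x = 0.
Proof.
move=> bT TS Sx; apply: innerxx_eq0; rewrite adjP//.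
by apply: inner_adherent0 Sx => s /TS; rewrite -adjP// => ->; rewrite inner0l.
Qed.

Lemma bop_adherent_eq H K (S T : H -> K) (G : set H) x :
  bounded_op S -> bounded_op T ->
  (forall s, G s -> S s = T s) -> adherent G x -> S x = T x.
Proof.
move=> bS bT ST Gx; apply/eqP; rewrite -subr_eq0; apply/eqP.
have bST := bop_lin (-1) bT bS.
rewrite addrC -scaleN1r; apply: (bop_adherent_eq0 bST _ Gx) => s /ST sE.
by rewrite -[LHS]/(-1 *: T s + S s) sE scaleN1r addNr.
Qed.

Lemma hnorm_eq_inner H K (x : H) (y : K) :
  inner x x = inner y y -> hnorm x = hnorm y.
Proof.
rewrite !innerxx => /complexI/eqP.
by rewrite eqrXn2 ?hnorm_ge0// => /eqP.
Qed.

End Operators.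

Section Span.
Variable R : realType.

Definition span (U : lmodType R[i]) (G : set U) : set U :=
  smallest (@linear_set R U) G.

Lemma span_linear (U : lmodType R[i]) (G : set U) : linear_set (span G).
Proof.
split=> [A [[A0 _] _]//|c x y Gx Gy A [lA GA]].
by case: (lA) => _; apply; [exact: Gx|exact: Gy].
Qed.

Lemma sub_span (U : lmodType R[i]) (G : set U) : G `<=` span G.
Proof. by move=> x Gx A [_]; exact. Qed.

Lemma span_sub (U : lmodType R[i]) (G S : set U) :
  linear_set S -> G `<=` S -> span G `<=` S.
Proof. by move=> lS GS x; apply. Qed.

Implicit Types H K L : hilbertType R.

Lemma linear_set_eq0 H K (T : H -> K) : bounded_op T ->
  linear_set [set x | T x = 0].
Proof.
move=> bT; split=> [|c x y /= x0 y0]; first exact: bop0.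
by rewrite /= bopP// x0 y0 scaler0 addr0.
Qed.

Lemma linear_set_orth H (y : H) : linear_set [set x | inner x y = 0].
Proof.
split=> [|c x z /= x0 z0]; first exact: inner0l.
by rewrite /= inner_is_linear x0 z0 mulr0 addr0.
Qed.

Lemma inner_span0 H (G : set H) x y :
  (forall s, G s -> inner s y = 0) -> adherent (span G) x -> inner x y = 0.
Proof.
move=> Gy; apply: inner_adherent0.
exact: span_sub (linear_set_orth y) _.
Qed.

Lemma bop_span_eq H K (S T : H -> K) (G : set H) x :
  bounded_op S -> bounded_op T ->
  (forall s, G s -> S s = T s) -> adherent (span G) x -> S x = T x.
Proof.
move=> bS bT ST; apply: bop_adherent_eq => //; apply: span_sub => //.
split=> [|c s t /= sE tE]; first by rewrite /= !bop0.
by rewrite /= !bopP// sE tE.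
Qed.

Lemma bop_span H K (T : H -> K) (G : set H) (G' : set K) x : bounded_op T ->
  (forall g, G g -> adherent (span G') (T g)) ->
  adherent (span G) x -> adherent (span G') (T x).
Proof.
move=> bT GG' /(bop_adherent bT) Tx; apply: adherent_idem.
apply: adherent_mono Tx => _ [s Gs <-].
have lA := adherent_linear (span_linear G').
suff : span G `<=` [set x | adherent (span G') (T x)] by apply.
apply: span_sub => //; split=> [|c y z /= Ty Tz].
  by rewrite /= bop0//; case: lA.
by rewrite /= bopP//; case: lA => _; apply.
Qed.

(** [G] is any generating set, not a subspace: ranges are later described by generators such as
    [x k], and equalities on a range are checked on these. *)
Definition prfun H (G : set H) (h : H) : H :=
  xget 0 [set e | adherent (span G) e /\ forall s, G s -> inner s (h - e) = 0].

Lemma prfunP H (G : set H) h : adherent (span G) (prfun G h) /\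
  forall s, G s -> inner s (h - prfun G h) = 0.
Proof.
have [e Ge eh] := orthogonal_decomposition (span_linear G) h.
rewrite /prfun; case: xgetP => [? -> //|/(_ e)]; case; split=> // s Gs.
by apply: eh; exact: sub_span.
Qed.

Lemma prfun_uniq H (G : set H) h e : adherent (span G) e ->
  (forall s, G s -> inner s (h - e) = 0) -> prfun G h = e.
Proof.
move=> Ge eh; have [Gp ph] := prfunP G h.
apply/eqP; rewrite -subr_eq0; apply/eqP/innerxx_eq0.
apply: (@inner_span0 _ G).
  move=> s Gs; have -> : prfun G h - e = (h - e) - (h - prfun G h).
    by rewrite opprB [RHS]addrC subrKA.
  by rewrite innerBr eh// ph// subr0.
exact: linear_setB (adherent_linear (span_linear G)) Gp Ge.
Qed.

Lemma prfun_linear H (G : set H) (k : R[i]) x y :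
  prfun G (k *: x + y) = k *: prfun G x + prfun G y.
Proof.
have [Gx xo] := prfunP G x; have [Gy yo] := prfunP G y.
apply: prfun_uniq => [|s Gs].
  by case: (adherent_linear (span_linear G)) => _; apply.
have -> : k *: x + y - (k *: prfun G x + prfun G y) =
    k *: (x - prfun G x) + (y - prfun G y).
  by rewrite scalerBr opprD addrACA.
by rewrite innerDr innerZr xo// yo// mulr0 addr0.
Qed.

Lemma prfun_orth H (G : set H) x h : inner (prfun G x) (h - prfun G h) = 0.
Proof.
have [Gx _] := prfunP G x; have [_ ho] := prfunP G h.
exact: inner_span0 ho Gx.
Qed.

Lemma prfun_bounded H (G : set H) : bounded_op (prfun G).
Proof.
apply/bounded_opP; split=> [|]; first exact: prfun_linear.
exists 1 => // x; rewrite mul1r -(ler_pXn2r (n:=2)) ?nnegrE ?hnorm_ge0//.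
rewrite -[in leRHS](subrK (prfun G x) x) addrC.
by rewrite hnorm_sqD_orth ?prfun_orth// lerDl sqr_ge0.
Qed.

Lemma prfun_id H (G : set H) h : adherent (span G) h -> prfun G h = h.
Proof. by move=> Gh; apply: prfun_uniq => // s _; rewrite subrr inner0r. Qed.

Lemma prfun_idem H (G : set H) : prfun G \o prfun G = prfun G.
Proof. by apply/funext => h; apply: prfun_id; case: (prfunP G h). Qed.

Lemma prfun_selfadjoint H (G : set H) : adjoint (prfun G) (prfun G).
Proof.
move=> x y; rewrite -[in LHS](subrK (prfun G y) y) innerDr prfun_orth add0r.
by rewrite -[in RHS](subrK (prfun G x) x) innerDl (inner_sym0 (prfun_orth _ _ _)) add0r.
Qed.

Definition prj H (G : set H) : projection H :=
  Projection (prfun_bounded G) (prfun_idem G) (@prfun_selfadjoint H G).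

Lemma prj_span H (G : set H) h : adherent (span G) (prj G h).
Proof. by case: (prfunP G h). Qed.

Lemma prj_orth H (G : set H) h g : G g -> inner g (h - prj G h) = 0.
Proof. by case: (prfunP G h) => _; apply. Qed.

Lemma prj_id H (G : set H) h : adherent (span G) h -> prj G h = h.
Proof. exact: prfun_id. Qed.

Lemma prj_gen H (G : set H) g : G g -> prj G g = g.
Proof. by move=> Gg; apply: prj_id; apply: adherent_sub; exact: sub_span. Qed.

Lemma prj_eq0 H (G : set H) h : (forall g, G g -> inner g h = 0) -> prj G h = 0.
Proof.
move=> Gh; apply: prfun_uniq => [|s Gs]; last by rewrite subr0 Gh.
by case: (adherent_linear (span_linear G)).
Qed.

Section Projection.
Variables (H : hilbertType R) (p : projection H).

Lemma proj_inner x y : inner (p x) y = inner x (p y).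
Proof. exact: (@proj_selfadjoint _ _ p). Qed.

Lemma projK x : p (p x) = p x.
Proof. by have := @proj_idem _ _ p => /(congr1 (@^~ x)). Qed.

Lemma adj_proj : adj p = p :> (H -> H).
Proof. by apply/esym/adj_uniq; [exact: proj_bounded|exact: proj_selfadjoint]. Qed.

(** A range invariant under [T] and under its adjoint reduces [T]: carry [p] across the inner
    product, use the second invariance, and carry it back. *)
Lemma proj_commute (T : H -> H) : bounded_op T ->
  (forall h, p (T (p h)) = T (p h)) -> (forall h, p (adj T (p h)) = adj T (p h)) ->
  forall h, p (T h) = T (p h).
Proof.
move=> bT pT pT' h; have bp := @proj_bounded _ _ p.
apply: inner_extl => z; rewrite proj_inner (adjP bT) -pT' -proj_inner.
by rewrite -(adjP bT) -proj_inner pT.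
Qed.

Definition pincl (x : prange p) : H := val x.

(** The adjoint of [pincl]: [pincl \o pcut] is [p] and [pcut \o pincl] is the identity. Operators
    between ranges of projections are written with this pair. *)
Definition pcut (h : H) : prange p.
Proof.
by apply: (@PRange R H p (p h)); apply/asboolP; exact: projK.
Defined.

Lemma pinclK x : pcut (pincl x) = x.
Proof. by apply: val_inj => /=; have /asboolP := prange_valP x. Qed.

Lemma pcutK h : pincl (pcut h) = p h. Proof. by []. Qed.

Lemma proj_pincl x : p (pincl x) = pincl x.
Proof. by rewrite -pcutK pinclK. Qed.

Lemma pincl_inner x y : inner (pincl x) (pincl y) = inner x y.
Proof. by []. Qed.

Lemma pincl_hnorm x : hnorm (pincl x) = hnorm x.
Proof. by []. Qed.

Lemma bop_pincl : bounded_op pincl.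
Proof.
by apply/bounded_opP; split=> //; exists 1 => // x; rewrite mul1r.
Qed.

Lemma pincl_cut x h : inner (pincl x) h = inner x (pcut h).
Proof. by rewrite -[RHS]pincl_inner pcutK -proj_inner proj_pincl. Qed.

Lemma adj_pincl : adj pincl = pcut.
Proof. by apply/esym/adj_uniq => [|x y]; [exact: bop_pincl|exact: pincl_cut]. Qed.

Lemma bop_pcut : bounded_op pcut.
Proof. by rewrite -adj_pincl; apply/bop_adj/bop_pincl. Qed.

Lemma adj_pcut : adj pcut = pincl.
Proof. by rewrite -adj_pincl adjK//; exact: bop_pincl. Qed.

End Projection.

End Span.

(** * Unconditional sums and Hilbert sums of families of spaces *)

Section RealSums.
Variables (R : realType) (J : choiceType).
Implicit Types q p : J -> R.

Definition nnsum q : \bar R := \esum_(j in [set: J]) (q j)%:E.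

Definition absum q : Prop := (nnsum (fun j => `|q j|)%R < +oo)%E.

(* Meaningful only when [absum q], as [fine] sends infinite sums to [0]. *)
Definition rsum q : R :=
  fine (nnsum (fun j => Num.max (q j) 0)) -
  fine (nnsum (fun j => Num.max (- q j) 0)).

Lemma nnsum_ge0 q : (forall j, 0 <= q j) -> (0 <= nnsum q)%E.
Proof. by move=> q0; apply: esum_ge0 => j _; rewrite lee_fin. Qed.

Lemma le_nnsum p q : (forall j, p j <= q j) -> (nnsum p <= nnsum q)%E.
Proof. by move=> pq; apply: le_esum => j _; rewrite lee_fin. Qed.

Lemma eq_nnsum p q : p =1 q -> nnsum p = nnsum q.
Proof. by move=> /funext ->. Qed.

Lemma nnsumD p q : (forall j, 0 <= p j) -> (forall j, 0 <= q j) ->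
  nnsum (fun j => p j + q j) = (nnsum p + nnsum q)%E.
Proof.
move=> p0 q0; rewrite -esumD => [|j _|j _]; rewrite ?lee_fin//.
Qed.

Lemma nnsumZ (r : R) q : 0 <= r -> (forall j, 0 <= q j) ->
  nnsum (fun j => r * q j) = (r%:E * nnsum q)%E.
Proof.
move=> r0 q0; rewrite /nnsum /esum -ereal_supZl//; last first.
  by apply/set0P; exists (\sum_(x \in set0) (q x)%:E)%E, set0 => //; exact: fsets_set0.
congr ereal_sup; rewrite image_comp; apply: eq_imagel => A [finA _] /=.
by rewrite ge0_mule_fsumr// => j; rewrite lee_fin.
Qed.

Lemma nnsum_ub q j : (forall j, 0 <= q j) -> ((q j)%:E <= nnsum q)%E.
Proof.
move=> q0; apply: esum_ge; exists [set j]; first by split.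
by rewrite fsbig_set1.
Qed.

Lemma absum_le p q : (forall j, `|p j| <= q j) -> absum q -> absum p.
Proof.
move=> pq; apply: le_lt_trans; apply: le_nnsum => j.
exact: le_trans (pq j) (ler_norm _).
Qed.

Lemma absumD p q : absum p -> absum q -> absum (fun j => p j + q j).
Proof.
move=> sp sq; apply: (@le_lt_trans _ _ (nnsum (fun j => `|p j| + `|q j|))).
  by apply: le_nnsum => j; exact: ler_normD.
by rewrite nnsumD// lte_add_pinfty.
Qed.

Lemma absumZ (r : R) q : absum q -> absum (fun j => r * q j).
Proof.
move=> sq; rewrite /absum.
under eq_fun do rewrite normrM.
by rewrite nnsumZ// lte_mul_pinfty// lee_fin.
Qed.

Lemma absumN q : absum q -> absum (fun j => - q j).
Proof. by rewrite /absum; under eq_fun do rewrite -normrN. Qed.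

Lemma absum_pos q : absum q -> absum (fun j => Num.max (q j) 0).
Proof.
apply: le_lt_trans; apply: le_nnsum => j.
by case: (leP (q j) 0) => h; rewrite ?normr0.
Qed.

Lemma absum_fin q : (forall j, 0 <= q j) -> absum q -> nnsum q \is a fin_num.
Proof.
move=> q0; rewrite /absum (eq_nnsum (q := q)) => [|j]; last by rewrite ger0_norm.
by move=> qoo; rewrite ge0_fin_numE// nnsum_ge0.
Qed.

(** A signed sum may be computed from any splitting into nonnegative summable parts: compare it with
    the canonical splitting after moving negative parts across. Additivity and homogeneity
    follow. *)
Lemma rsum_sub p q : (forall j, 0 <= p j) -> (forall j, 0 <= q j) ->
  absum p -> absum q ->
  rsum (fun j => p j - q j) = fine (nnsum p) - fine (nnsum q).
Proof.
move=> p0 q0 sp sq.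
have spq : absum (fun j => p j - q j) by apply: absumD => //; exact: absumN.
have sqp : absum (fun j => q j - p j) by apply: absumD => //; exact: absumN.
have h : nnsum (fun j => Num.max (p j - q j) 0 + q j) =
         nnsum (fun j => Num.max (- (p j - q j)) 0 + p j).
  by apply: eq_nnsum => j; rewrite opprB; case: (leP (p j - q j) 0);
    case: (leP (q j - p j) 0); lra.
have m0 f j : 0 <= Num.max (f j) 0 :> R by rewrite le_max lexx orbT.
move: h; rewrite !nnsumD//; move/(congr1 fine); rewrite !fineD ?absum_fin//.
- by rewrite /rsum; move: (fine _) (fine _) (fine _) (fine _) => *; lra.
- by under eq_fun do rewrite opprB; exact: absum_pos.
- exact: absum_pos.
Qed.

Lemma rsumE q : (forall j, 0 <= q j) -> rsum q = fine (nnsum q).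
Proof.
move=> q0; rewrite /rsum (eq_nnsum (q := q)) => [|j]; last by rewrite max_l.
rewrite [X in _ - fine X](_ : _ = 0%E) ?subr0//.
by rewrite /nnsum esum1// => j _; rewrite max_r// oppr_le0.
Qed.

Let pos q j := Num.max (q j) 0.
Let neg q j := Num.max (- q j) 0.
Let pos0 q j : 0 <= pos q j. Proof. by rewrite le_max lexx orbT. Qed.
Let neg0 q j : 0 <= neg q j. Proof. by rewrite le_max lexx orbT. Qed.
Let posneg q j : q j = pos q j - neg q j.
Proof. by rewrite /pos /neg; case: leP => h; case: leP => h'; lra. Qed.
Let spos q : absum q -> absum (pos q). Proof. exact: absum_pos. Qed.
Let sneg q : absum q -> absum (neg q).
Proof. by move=> /absumN; exact: absum_pos. Qed.

Lemma rsumD p q : absum p -> absum q ->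
  rsum (fun j => p j + q j) = rsum p + rsum q.
Proof.
move=> sp sq.
have -> : (fun j => p j + q j) =
    (fun j => (pos p j + pos q j) - (neg p j + neg q j)).
  by apply/funext => j; rewrite (posneg p) (posneg q) addrACA opprD.
rewrite rsum_sub//; [|by move=> j; rewrite addr_ge0|by move=> j; rewrite addr_ge0
  |by apply: absumD; exact: spos|by apply: absumD; exact: sneg].
rewrite !nnsumD// !fineD ?absum_fin//; [|exact: sneg|exact: sneg|exact: spos|exact: spos].
by rewrite /rsum /pos /neg; move: (fine _) (fine _) (fine _) (fine _) => *; lra.
Qed.

Lemma rsumN q : rsum (fun j => - q j) = - rsum q.
Proof.
rewrite /rsum opprB.
by have -> : (fun j => Num.max (- - q j) 0) = (fun j => Num.max (q j) 0)
  by apply/funext => j; rewrite opprK.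
Qed.

Lemma rsumZ (r : R) q : absum q -> rsum (fun j => r * q j) = r * rsum q.
Proof.
wlog r0 : r / 0 <= r => [hw|] sq.
  have [/hw->//|r0] := leP 0 r.
  have := hw (- r); rewrite oppr_ge0 (ltW r0) => /(_ isT sq).
  by under eq_fun do rewrite mulNr; rewrite rsumN mulNr => /oppr_inj.
have -> : (fun j => r * q j) = (fun j => r * pos q j - r * neg q j).
  by apply/funext => j; rewrite -mulrBr -posneg.
rewrite rsum_sub; [|by move=> j; rewrite mulr_ge0|by move=> j; rewrite mulr_ge0
  |by apply/absumZ/spos|by apply/absumZ/sneg].
rewrite !nnsumZ// !fineM ?absum_fin//; [|exact: sneg|exact: spos].
by rewrite -mulrBr.
Qed.

Lemma rsum_ge0 q : (forall j, 0 <= q j) -> 0 <= rsum q.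
Proof. by move=> q0; rewrite rsumE// fine_ge0// nnsum_ge0. Qed.

Lemma le_rsum p q : absum p -> absum q -> (forall j, p j <= q j) ->
  rsum p <= rsum q.
Proof.
move=> sp sq pq; rewrite -subr_ge0 -rsumN -rsumD//; last exact: absumN.
by apply: rsum_ge0 => j; rewrite subr_ge0.
Qed.

Lemma rsum_ub q j : (forall j, 0 <= q j) -> absum q -> q j <= rsum q.
Proof.
move=> q0 sq; rewrite rsumE// -lee_fin fineK ?absum_fin//.
exact: nnsum_ub.
Qed.

Lemma rsum0 : rsum (fun=> 0) = 0.
Proof. by rewrite rsumE// /nnsum esum1. Qed.

Lemma absum0 : absum (fun=> 0).
Proof. by rewrite /absum /nnsum esum1// => j _; rewrite normr0. Qed.

Lemma rsum_le_fin q (c : R) : (forall j, 0 <= q j) ->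
  (forall s : seq J, uniq s -> \sum_(j <- s) q j <= c) -> absum q /\ rsum q <= c.
Proof.
move=> q0 qc.
have h : (nnsum q <= c%:E)%E.
  apply: ge_ereal_sup => _ [F [finF _] <-].
  rewrite fsbig_finite//= sumEFin lee_fin; apply: qc; exact: fset_uniq.
have qoo : absum q.
  rewrite /absum (eq_nnsum (q := q)) => [|j]; last by rewrite ger0_norm.
  exact: le_lt_trans h (ltry _).
by split=> //; rewrite rsumE// -lee_fin fineK// absum_fin.
Qed.

Lemma sum_le_rsum q (s : seq J) : (forall j, 0 <= q j) -> absum q -> uniq s ->
  \sum_(j <- s) q j <= rsum q.
Proof.
move=> q0 sq us; rewrite rsumE// -lee_fin fineK ?absum_fin// -sumEFin.
apply: esum_ge; exists [set` s]; first by split=> //; exact: finite_seq.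
by rewrite -fsbig_seq.
Qed.

End RealSums.

Section SequentialCompleteness.
Variables (R : realType) (V : normedModType R[i]).

(** Choose balls of radius [n.+1%:R^-1] belonging to the filter; any two of them meet, so their
    centres form a Cauchy sequence, whose limit is a limit of the filter. *)
Lemma cauchy_filter_cvg (F : set_system V) :
  (forall u : nat -> V,
    (forall e : R, 0 < e -> exists N, forall m n, (N <= m)%N -> (N <= n)%N ->
      `|u m - u n| < e%:C%C) ->
    exists l, forall e : R, 0 < e -> exists N, forall n, (N <= n)%N ->
      `|l - u n| < e%:C%C) ->
  ProperFilter F -> cauchy F -> cvg F.
Proof.
move=> seqc FF /cauchyP Fc.
have realE (e : R[i]) : 0 < e -> 0 < complex.Re e /\ e = (complex.Re e)%:C%C.
  by case: e => a b; rewrite ltcE/= => /andP[/eqP -> ?].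
have Cgt0 (e : R) : 0 < e -> 0 < e%:C%C :> R[i] by rewrite ltcE/= eqxx.
have /choice[z zF] (n : nat) : exists z, F (ball z (n.+1%:R^-1 : R)%:C%C).
  by apply: Fc; rewrite Cgt0// invr_gt0.
have hm k N : (N <= k)%N -> k.+1%:R^-1 <= N.+1%:R^-1 :> R.
  by move=> Nk; rewrite lef_pV2 ?posrE// ler_nat.
have [l lz] : exists l, forall e : R, 0 < e -> exists N, forall n, (N <= n)%N ->
    `|l - z n| < e%:C%C.
  apply: seqc => e e0; have [N N2] := natSinv_lt (divr_gt0 e0 (ltr0n R 2)).
  exists N => m n Nm Nn.
  have [y []] := filter_ex (filterI (zF m) (zF n)).
  rewrite -!ball_normE/= => my ny.
  have -> : z m - z n = (z m - y) - (z n - y) by rewrite opprB subrKA.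
  rewrite (le_lt_trans (ler_normB _ _))// (lt_le_trans (ltrD my ny))//.
  rewrite -rmorphD lecR; have := hm _ _ Nm; have := hm _ _ Nn; move: N2.
  by move: (m.+1%:R^-1) (n.+1%:R^-1) (N.+1%:R^-1) => a b c; lra.
apply/cvg_ex; exists l; apply/cvgrPdist_lt => e /realE[e0 ->].
have e2 : 0 < complex.Re e / 2 by rewrite divr_gt0.
have [N1 N1P] := lz _ e2; have [N2 N2P] := natSinv_lt e2.
pose n := maxn N1 N2.
apply: filterS (zF n) => y; rewrite -ball_normE/= => ny.
have -> : l - y = (l - z n) + (z n - y) by rewrite subrKA.
rewrite (le_lt_trans (ler_normD _ _))// (lt_le_trans (ltrD (N1P n _) ny)) ?leq_maxl//.
rewrite -rmorphD lecR; have := hm n N2 (leq_maxr _ _); move: N2P.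
by move: (n.+1%:R^-1) (N2.+1%:R^-1) => a b; lra.
Qed.

End SequentialCompleteness.

Section Ell2.
Variables (R : realType) (J : choiceType) (H : J -> hilbertType R).

(** The spaces may vary with the index, so that constant families give amplifications and families
    over [bool] give direct sums. The index set is of any size: it will be the set of vectors of a
    Hilbert space. *)
Record ell2 : Type := Ell2 {
  coord :> forall j, H j ;
  coordP : absum (fun j => hnorm (coord j) ^+ 2)
}.

HB.instance Definition _ := gen_eqMixin ell2.
HB.instance Definition _ := gen_choiceMixin ell2.

Lemma ell2_ext (f g : ell2) : (forall j, f j = g j) -> f = g.
Proof.
case: f g => f fP [g gP] /= fg.
have E : f = g by apply: functional_extensionality_dep.
by case: _ / E gP => gP; congr Ell2; exact: Prop_irrelevance.
Qed.

Lemma sq_hnormD K (x y : K : hilbertType R) :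
  hnorm (x + y) ^+ 2 <= 2 * (hnorm x ^+ 2 + hnorm y ^+ 2).
Proof. by have := parallelogram x y; have := sqr_ge0 (hnorm (x - y)); lra. Qed.

Lemma absum_lin (k : R[i]) (f g : ell2) :
  absum (fun j => hnorm (k *: f j + g j) ^+ 2).
Proof.
apply: (@absum_le _ _ _ (fun j => 2 * (cabs k ^+ 2 * hnorm (f j) ^+ 2 + hnorm (g j) ^+ 2))).
  move=> j; rewrite ger0_norm ?sqr_ge0// (le_trans (sq_hnormD _ _))//.
  by rewrite hnormZ exprMn.
by apply: absumZ; apply: absumD (coordP g); apply: absumZ (coordP f).
Qed.

Definition ell2_lin k f g : ell2 := Ell2 (absum_lin k f g).

Lemma ell2_0P : absum (fun j => hnorm (0 : H j) ^+ 2).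
Proof.
have -> : (fun j => hnorm (0 : H j) ^+ 2) = (fun=> 0).
  by apply/funext => j; rewrite hnorm0 expr0n.
exact: absum0.
Qed.

Definition ell2_0 : ell2 := Ell2 ell2_0P.
Definition ell2_add f g := ell2_lin 1 f g.
Definition ell2_opp f := ell2_lin (-1) f ell2_0.
Definition ell2_scale k f := ell2_lin k f ell2_0.

Lemma ell2_addA : associative ell2_add.
Proof. by move=> f g h; apply: ell2_ext => j /=; rewrite !scale1r addrA. Qed.
Lemma ell2_addC : commutative ell2_add.
Proof. by move=> f g; apply: ell2_ext => j /=; rewrite !scale1r addrC. Qed.
Lemma ell2_add0 : left_id ell2_0 ell2_add.
Proof. by move=> f; apply: ell2_ext => j /=; rewrite !scale1r add0r. Qed.
Lemma ell2_addN : left_inverse ell2_0 ell2_opp ell2_add.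
Proof.
by move=> f; apply: ell2_ext => j /=; rewrite !scale1r addr0 scaleN1r addNr.
Qed.

HB.instance Definition _ :=
  GRing.isZmodule.Build ell2 ell2_addA ell2_addC ell2_add0 ell2_addN.

Lemma ell2_addE (f g : ell2) j : (f + g) j = f j + g j.
Proof. by rewrite -[LHS]/(1 *: f j + g j) scale1r. Qed.

Lemma ell2_scaleA (a b : R[i]) v : ell2_scale a (ell2_scale b v) = ell2_scale (a * b) v.
Proof. by apply: ell2_ext => j /=; rewrite !addr0 scalerA. Qed.
Lemma ell2_scale1 : left_id 1 ell2_scale.
Proof. by move=> v; apply: ell2_ext => j /=; rewrite !addr0 scale1r. Qed.
Lemma ell2_scaleDr : right_distributive ell2_scale +%R.
Proof.
move=> a v w; apply: ell2_ext => j; rewrite ell2_addE.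
rewrite -[LHS]/(a *: (v + w) j + 0) -[RHS]/(a *: v j + 0 + (a *: w j + 0)).
by rewrite ell2_addE !addr0 scalerDr.
Qed.
Lemma ell2_scaleDl v : {morph ell2_scale^~ v : a b / a + b}.
Proof. by move=> a b; apply: ell2_ext => j; rewrite ell2_addE /= !addr0 scalerDl. Qed.

HB.instance Definition _ := GRing.Zmodule_isLmodule.Build R[i] ell2
  ell2_scaleA ell2_scale1 ell2_scaleDr ell2_scaleDl.

Lemma ell2_scaleE k (f : ell2) j : (k *: f) j = k *: f j.
Proof. by rewrite -[LHS]/(k *: f j + 0) addr0. Qed.

Lemma ell2_oppE (f : ell2) j : (- f) j = - f j.
Proof. by rewrite -scaleN1r ell2_scaleE scaleN1r. Qed.

Lemma ell2_zeroE j : (0 : ell2) j = 0. Proof. by []. Qed.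

Definition csum (a : J -> R[i]) : R[i] :=
  (rsum (fun j => complex.Re (a j)) +i* rsum (fun j => complex.Im (a j)))%C.

Definition cabsum (a : J -> R[i]) := absum (fun j => cabs (a j)).

Lemma cabsum_Re a : cabsum a -> absum (fun j => complex.Re (a j)).
Proof.
apply: absum_le => j; rewrite ler_norml Re_le_cabs andbT lerNl.
by rewrite -ReN -cabsN Re_le_cabs.
Qed.

Lemma cabsum_Im a : cabsum a -> absum (fun j => complex.Im (a j)).
Proof.
apply: absum_le => j; rewrite -(ler_pXn2r (n:=2)) ?nnegrE ?cabs_ge0//.
by rewrite real_normK ?num_real// sqr_cabsE lerDr sqr_ge0.
Qed.

Lemma csum_lin k a b : cabsum a -> cabsum b ->
  csum (fun j => k * a j + b j) = k * csum a + csum b.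
Proof.
move=> sa sb; have [ra rb] := (cabsum_Re sa, cabsum_Re sb).
have [ia ib] := (cabsum_Im sa, cabsum_Im sb).
case: k => x y; rewrite /csum.
have -> : (fun j => complex.Re ((x +i* y)%C * a j + b j)) =
  (fun j => (x * complex.Re (a j) + (- y) * complex.Im (a j)) + complex.Re (b j)).
  by apply/funext => j; case: (a j) => p q; case: (b j) => r s /=; rewrite mulNr.
have -> : (fun j => complex.Im ((x +i* y)%C * a j + b j)) =
  (fun j => (x * complex.Im (a j) + y * complex.Re (a j)) + complex.Im (b j)).
  by apply/funext => j; case: (a j) => p q; case: (b j) => r s.
have [h1 h2] := (absumZ x ra, absumZ (- y) ia).
have [h3 h4] := (absumZ x ia, absumZ y ra).
rewrite (rsumD (absumD h1 h2) rb) (rsumD (absumD h3 h4) ib).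
rewrite (rsumD h1 h2) (rsumD h3 h4) (rsumZ x ra) (rsumZ (- y) ia).
by rewrite (rsumZ x ia) (rsumZ y ra) mulNr.
Qed.

Lemma csum_conj a : csum (fun j => (a j)^*) = (csum a)^*.
Proof.
rewrite /csum; congr Complex.
  by congr rsum; apply/funext => j; case: (a j).
rewrite -rsumN; congr rsum; apply/funext => j; by case: (a j).
Qed.

Definition ell2_inner (f g : ell2) : R[i] := csum (fun j => inner (f j) (g j)).

Lemma cabsum_inner (f g : ell2) : cabsum (fun j => inner (f j) (g j)).
Proof.
apply: (@absum_le _ _ _ (fun j => hnorm (f j) ^+ 2 + hnorm (g j) ^+ 2)).
  move=> j; rewrite ger0_norm ?cabs_ge0// (le_trans (cauchy_schwarz _ _))//.
  by have := sqr_ge0 (hnorm (f j) - hnorm (g j)); have := hnorm_ge0 (f j);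
    have := hnorm_ge0 (g j); nra.
by apply: absumD; exact: coordP.
Qed.

Lemma ell2_inner_linear (c : R[i]) (x y z : ell2) :
  ell2_inner (c *: x + y) z = c * ell2_inner x z + ell2_inner y z.
Proof.
rewrite /ell2_inner -csum_lin; [|exact: cabsum_inner|exact: cabsum_inner].
congr csum; apply/funext => j; by rewrite ell2_addE ell2_scaleE inner_is_linear.
Qed.

Lemma ell2_inner_conj (x y : ell2) : ell2_inner y x = (ell2_inner x y)^*.
Proof.
rewrite /ell2_inner -csum_conj; congr csum; apply/funext => j; exact: inner_conj.
Qed.

Definition ell2_sq (f : ell2) : R := rsum (fun j => hnorm (f j) ^+ 2).

Lemma ell2_sq_ge0 f : 0 <= ell2_sq f.
Proof. by apply: rsum_ge0 => j; exact: sqr_ge0. Qed.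

Lemma ell2_innerxx f : ell2_inner f f = (ell2_sq f)%:C%C.
Proof.
rewrite /ell2_inner /csum /ell2_sq; congr Complex; last first.
  rewrite -[RHS](rsum0 R J); congr rsum; apply/funext => j.
  by rewrite innerxx.
by congr rsum; apply/funext => j; rewrite innerxx.
Qed.

Lemma ell2_sq_eq0 f : ell2_sq f = 0 -> f = 0.
Proof.
move=> f0; apply: ell2_ext => j; rewrite ell2_zeroE; apply/hnorm_eq0/eqP.
rewrite -sqrf_eq0 eq_le sqr_ge0 andbT -f0.
by apply: (rsum_ub (q := fun j => hnorm (f j) ^+ 2)) (coordP f) => i; exact: sqr_ge0.
Qed.

Lemma ell2_sq_lin (k : R[i]) f g : ell2_sq (k *: f + g) =
  cabs k ^+ 2 * ell2_sq f + ell2_sq g + 2 * complex.Re (k * ell2_inner f g).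
Proof.
have : ell2_inner (k *: f + g) (k *: f + g) = (ell2_sq (k *: f + g))%:C%C.
  exact: ell2_innerxx.
rewrite ell2_inner_linear [in ell2_inner f _]ell2_inner_conj.
rewrite [in X in _ + X = _]ell2_inner_conj !ell2_inner_linear.
rewrite !ell2_innerxx [ell2_inner g f]ell2_inner_conj.
rewrite sqr_cabsE.
case: (ell2_inner f g) => a b; case: (k) => c d /(congr1 (@complex.Re _))/= <-.
by ring.
Qed.

Lemma ell2_cs f g : cabs (ell2_inner f g) <= Num.sqrt (ell2_sq f) * Num.sqrt (ell2_sq g).
Proof.
rewrite -(ler_pXn2r (n:=2)) ?nnegrE ?cabs_ge0 ?mulr_ge0 ?sqrtr_ge0// exprMn.
rewrite (sqr_sqrtr (ell2_sq_ge0 f)) (sqr_sqrtr (ell2_sq_ge0 g)) [leRHS]mulrC.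
apply: discriminant_le => [|t]; first exact: ell2_sq_ge0.
by have := ell2_sq_ge0 (t *: f + g); rewrite ell2_sq_lin; lra.
Qed.

Definition ell2_norm (f : ell2) : R[i] := (Num.sqrt (ell2_sq f))%:C%C.

Lemma ell2_normD (f g : ell2) : ell2_norm (f + g) <= ell2_norm f + ell2_norm g.
Proof.
rewrite /ell2_norm -rmorphD lecR.
rewrite -(ler_pXn2r (n:=2)) ?nnegrE ?addr_ge0 ?sqrtr_ge0//.
rewrite sqrrD !sqr_sqrtr ?ell2_sq_ge0// -[in leLHS](scale1r f) ell2_sq_lin.
rewrite cabs1 expr1n !mul1r mulr2n.
have := le_trans (Re_le_cabs _) (ell2_cs f g); lra.
Qed.

Lemma ell2_normZ (k : R[i]) f : ell2_norm (k *: f) = `|k| * ell2_norm f.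
Proof.
rewrite /ell2_norm cabsE -rmorphM; congr (_%:C)%C.
rewrite -[cabs k]ger0_norm ?cabs_ge0// -sqrtr_sqr -sqrtrM ?sqr_ge0//.
congr Num.sqrt; rewrite /ell2_sq -rsumZ; last exact: coordP.
by congr rsum; apply/funext => j; rewrite ell2_scaleE hnormZ exprMn.
Qed.

Lemma ell2_norm_eq0 f : ell2_norm f = 0 -> f = 0.
Proof.
move=> /complexI/eqP; rewrite sqrtr_eq0 => f0; apply: ell2_sq_eq0.
by apply/eqP; rewrite eq_le f0 ell2_sq_ge0.
Qed.

HB.instance Definition _ := Lmodule_isNormed.Build R[i] ell2
  ell2_normD ell2_normZ ell2_norm_eq0.

Lemma ell2_normE (f : ell2) : `|f| = (Num.sqrt (ell2_sq f))%:C%C.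
Proof. by []. Qed.

Lemma ell2_norm_lt (f : ell2) (e : R) : 0 < e -> `|f| < e%:C%C <-> ell2_sq f < e ^+ 2.
Proof.
move=> e0; rewrite ell2_normE ltcR.
rewrite -(ltr_pXn2r (n:=2)) ?nnegrE ?sqrtr_ge0 ?(ltW e0)//.
by rewrite sqr_sqrtr ?ell2_sq_ge0.
Qed.

Lemma coord_le (f : ell2) j : hnorm (f j) ^+ 2 <= ell2_sq f.
Proof.
by apply: (rsum_ub (q := fun j => hnorm (f j) ^+ 2)) (coordP f) => i; exact: sqr_ge0.
Qed.

Lemma sum_coord_le (f : ell2) (s : seq J) : uniq s ->
  \sum_(j <- s) hnorm (f j) ^+ 2 <= ell2_sq f.
Proof.
have f0 j : 0 <= hnorm (f j) ^+ 2 by exact: sqr_ge0.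
by move=> us; exact: (sum_le_rsum f0 (coordP f) us).
Qed.

(** Limits are taken coordinatewise, and a Fatou-type estimate on finite sets of coordinates makes
    the convergence uniform. *)
Lemma ell2_seq_complete (u : nat -> ell2) :
  (forall e : R, 0 < e -> exists N, forall m n, (N <= m)%N -> (N <= n)%N ->
    `|u m - u n| < e%:C%C) ->
  exists l, forall e : R, 0 < e -> exists N, forall n, (N <= n)%N ->
    `|l - u n| < e%:C%C.
Proof.
move=> cu.
have ex j : exists l, forall e : R, 0 < e -> exists N, forall n, (N <= n)%N ->
    hnorm (l - u n j) < e.
  apply: hilbert_complete => e e0; have [N uN] := cu e e0; exists N => m n Nm Nn.
  have /(ell2_norm_lt _ e0) h := uN m n Nm Nn; move: h.
  move=> h; rewrite -(ltr_pXn2r (n:=2)) ?nnegrE ?hnorm_ge0 ?(ltW e0)//.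
  apply: le_lt_trans h.
  by have := coord_le (u m - u n) j; rewrite ell2_addE ell2_oppE.
have [l lP] : {l : forall j, H j | forall j (e : R), 0 < e ->
    exists N, forall n, (N <= n)%N -> hnorm (l j - u n j) < e}.
  by exists (fun j => sval (cid (ex j))) => j; exact: (svalP (cid (ex j))).
have key (e : R) N : 0 < e ->
    (forall m n, (N <= m)%N -> (N <= n)%N -> `|u m - u n| < e%:C%C) ->
    forall n, (N <= n)%N -> absum (fun j => hnorm (l j - u n j) ^+ 2) /\
      rsum (fun j => hnorm (l j - u n j) ^+ 2) <= e ^+ 2.
  move=> e0 uN n Nn; apply: rsum_le_fin => [j|s us]; first exact: sqr_ge0.
  apply/ler_addgt0Pr => d d0.
  have e1 : 0 < (size s)%:R * (2 * e + 1) + 1 :> R.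
    by rewrite ltr_wpDl// mulr_ge0//; lra.
  (* The error allowed per coordinate: as [|h j| <= e] and [c <= 1], passing from [|h j|] to
     [|h j| + c] raises the square by at most [c (2 e + 1)], hence the finite sum by at most [d]. *)
  pose c := Num.min 1 (d / ((size s)%:R * (2 * e + 1) + 1)).
  have c0 : 0 < c by rewrite lt_min ltr01 divr_gt0.
  have c1 : c <= 1 by rewrite ge_min lexx.
  have cd : c * ((size s)%:R * (2 * e + 1)) <= d.
    apply: (@le_trans _ _ (c * ((size s)%:R * (2 * e + 1) + 1))).
      by rewrite ler_wpM2l ?(ltW c0)// lerDl.
    by rewrite -ler_pdivlMr// ge_min lexx orbT.
  have [M MP] : exists M, forall j, j \in s -> forall m, (M <= m)%N -> hnorm (l j - u m j) < c.
    move: c c0 {us e1 c1 cd} => c c0; elim: s => [|i s [M IH]]; first by exists 0%N.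
    have [M' M'P] := lP i c c0; exists (maxn M M') => j.
    rewrite inE => /predU1P[->|js] m; rewrite geq_max => /andP[Mm M'm].
      exact: M'P.
    exact: IH.
  pose m := maxn M N.
  have [h hE] : exists h, h = u m - u n by exists (u m - u n).
  have um : ell2_sq h <= e ^+ 2.
    by rewrite hE; apply/ltW/(ell2_norm_lt _ e0)/uN; rewrite ?leq_maxr.
  apply: (@le_trans _ _ (\sum_(j <- s) (hnorm (h j) ^+ 2 + c * (2 * e + 1)))).
    rewrite big_seq [leRHS]big_seq; apply: ler_sum => j js.
    have h1 : hnorm (l j - u n j) <= hnorm (h j) + c.
      rewrite hE ell2_addE ell2_oppE [leRHS]addrC (le_trans (hnorm_le_trans _ (u m j) _))//.
      by rewrite lerD2r ltW// MP// leq_maxl.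
    have h2 : hnorm (h j) <= e.
      rewrite -(ler_pXn2r (n:=2)) ?nnegrE ?hnorm_ge0 ?(ltW e0)//.
      exact: le_trans (coord_le _ _) um.
    have := hnorm_ge0 (h j); have := hnorm_ge0 (l j - u n j); nra.
  rewrite big_split/= lerD//; last first.
    by rewrite big_const_seq count_predT iter_addr_0 -[_ *+ size s]mulr_natl mulrCA.
  by apply: le_trans um; exact: sum_coord_le.
have [N1 /(key _ _ ltr01) /(_ _ (leqnn _))[s1 _]] := cu 1 ltr01.
have lS : absum (fun j => hnorm (l j) ^+ 2).
  apply: (@absum_le _ _ _ (fun j => 2 * (hnorm (l j - u N1 j) ^+ 2 + hnorm (u N1 j) ^+ 2))).
    move=> j; rewrite ger0_norm ?sqr_ge0//.
    by rewrite -[in leLHS](subrK (u N1 j) (l j)) sq_hnormD.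
  by apply: absumZ; apply: absumD s1 (coordP _).
exists (Ell2 lS) => e e0; have e2 : 0 < e / 2 by rewrite divr_gt0.
have [N /(key _ _ e2) h] := cu _ e2; exists N => n /h[_ hn].
apply/(ell2_norm_lt _ e0); apply: (@le_lt_trans _ _ ((e / 2) ^+ 2)).
  apply: le_trans hn; rewrite /ell2_sq le_eqVlt; apply/orP; left; apply/eqP.
  by congr rsum; apply/funext => j; rewrite ell2_addE ell2_oppE.
by rewrite ltr_pXn2r ?nnegrE ?(ltW e0) ?(ltW e2)// ltr_pdivrMr//; lra.
Qed.

Lemma ell2_complete (F : set_system ell2) : ProperFilter F -> cauchy F -> cvg F.
Proof. exact: cauchy_filter_cvg ell2_seq_complete. Qed.

HB.instance Definition _ := Uniform_isComplete.Build ell2 ell2_complete.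

Lemma ell2_inner_norm (x : ell2) : ell2_inner x x = `|x| ^+ 2.
Proof.
by rewrite ell2_innerxx ell2_normE -rmorphXn/= sqr_sqrtr// ell2_sq_ge0.
Qed.

HB.instance Definition _ := isHilbert.Build R ell2
  ell2_inner_linear ell2_inner_conj ell2_inner_norm.

End Ell2.

Section Ell2Operators.
Variables (R : realType) (J : choiceType).
Implicit Types H K L : J -> hilbertType R.

Lemma hnorm_ell2 H (f : ell2 H) : hnorm f ^+ 2 = rsum (fun j => hnorm (f j) ^+ 2).
Proof.
apply: complexI; rewrite -innerxx -[LHS]/(ell2_inner f f) ell2_innerxx.
by [].
Qed.

Lemma hnorm_coord H (f : ell2 H) j : hnorm (f j) <= hnorm f.
Proof.
rewrite -(ler_pXn2r (n:=2)) ?nnegrE ?hnorm_ge0// hnorm_ell2.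
exact: coord_le.
Qed.

Lemma inner_ell2_ext H K (f g : ell2 H) (f' g' : ell2 K) :
  (forall j, inner (f j) (g j) = inner (f' j) (g' j)) -> inner f g = inner f' g'.
Proof. by move=> /funext E; rewrite -[LHS]/(csum _) E. Qed.

Lemma hnorm_ell2_le H K (c : R) (f : ell2 H) (g : ell2 K) : 0 <= c ->
  (forall j, hnorm (f j) <= c * hnorm (g j)) -> hnorm f <= c * hnorm g.
Proof.
move=> c0 fg; rewrite -(ler_pXn2r (n:=2)) ?nnegrE ?mulr_ge0 ?hnorm_ge0//.
rewrite exprMn !hnorm_ell2 -rsumZ; last exact: coordP.
apply: le_rsum; [exact: coordP|exact/absumZ/coordP|move=> j].
by rewrite -exprMn ler_pXn2r ?nnegrE ?mulr_ge0 ?hnorm_ge0.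
Qed.

Definition coordf H j (f : ell2 H) : H j := f j.

Lemma bop_coord H j : bounded_op (@coordf H j).
Proof.
apply/bounded_opP; split=> [k x y|].
  by rewrite /coordf ell2_addE ell2_scaleE.
by exists 1 => // f; rewrite mul1r hnorm_coord.
Qed.

Definition dirac_fun H i (h : H i) : forall j, H j := @eqtype.dfwith J H (fun j => 0 : H j) i h.

Lemma dirac_absum H i (h : H i) : absum (fun j => hnorm (dirac_fun h j) ^+ 2).
Proof.
have [] := @rsum_le_fin _ _ (fun j => hnorm (dirac_fun h j) ^+ 2) (hnorm h ^+ 2) => //.
  by move=> j; exact: sqr_ge0.
move=> s us; have [js|js] := boolP (i \in s).
  rewrite (bigD1_seq i)//= {1}/dirac_fun eqtype.dfwith_in big1 ?addr0// => j ji.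
  by rewrite /dirac_fun eqtype.dfwith_out 1?eq_sym// hnorm0 expr0n.
rewrite big_seq big1 ?sqr_ge0// => j js'; rewrite /dirac_fun eqtype.dfwith_out ?hnorm0 ?expr0n//.
by apply: contraNneq js => ->.
Qed.

Definition ell2_dirac H i (h : H i) : ell2 H := Ell2 (dirac_absum h).

Lemma dirac_in H i (h : H i) : ell2_dirac h i = h.
Proof. exact: eqtype.dfwith_in. Qed.

Lemma dirac_out H i (h : H i) j : i != j -> ell2_dirac h j = 0.
Proof. by move=> ij; rewrite /= /dirac_fun eqtype.dfwith_out. Qed.

Lemma inner_dirac H i (h : H i) (f : ell2 H) : inner (ell2_dirac h) f = inner h (f i).
Proof.
rewrite -[LHS]/(csum (fun j => inner (ell2_dirac h j) (f j))).
have E q : (forall j, i != j -> q j = 0) -> rsum q = q i :> R.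
  move=> qi; pose q' := fun j => (j == i)%:R : R.
  have q'0 j : 0 <= q' j by rewrite ler0n.
  have [|sq q1] := @rsum_le_fin _ _ q' 1 q'0.
    move=> s us; rewrite /q' -natr_sum lern1.
    have -> : (\sum_(j <- s) (j == i) = count (pred1 i) s)%N.
      by rewrite -sum1_count [RHS]big_mkcond; apply: eq_bigr => j _ /=; case: eqP.
    by rewrite count_uniq_mem//; case: (_ \in _).
  have -> : q = (fun j => q i * q' j).
    apply/funext => j; rewrite /q'; have [->|ji] := eqVneq; first by rewrite mulr1.
    by rewrite mulr0 qi 1?eq_sym.
  rewrite rsumZ//; suff -> : rsum q' = 1 by rewrite /q' eqxx.
  apply/eqP; rewrite eq_le q1/=.
  by have := rsum_ub i q'0 sq; rewrite /q' eqxx.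
rewrite /csum !E => [|j ij|j ij]; try by rewrite dirac_out// inner0l.
by rewrite dirac_in; case: (inner h (f i)).
Qed.

Lemma adj_coord H j : adj (@coordf H j) = @ell2_dirac H j.
Proof.
apply/esym/adj_uniq; first exact: bop_coord.
by apply: adjoint_sym => h f; exact: inner_dirac.
Qed.

Lemma hnorm_dirac H i (h : H i) : hnorm (ell2_dirac h) = hnorm h.
Proof. by apply: hnorm_eq_inner; rewrite inner_dirac dirac_in. Qed.

Lemma dirac_total H (f : ell2 H) :
  adherent (span [set g | exists j (h : H j), g = ell2_dirac h]) f.
Proof.
set G := [set g | _]; rewrite -[f](subrK (prj G f)).
suff -> : f - prj G f = 0 by rewrite add0r; exact: prj_span.
apply: ell2_ext => j; rewrite ell2_zeroE; apply: inner_extr => h.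
rewrite inner0r -inner_dirac; apply: (@prj_orth _ _ G).
by exists j, h.
Qed.

Definition ubop H K (a : forall j, H j -> K j) : Prop :=
  (forall j, bounded_op (a j)) /\
  exists2 c : R, 0 <= c & forall j x, hnorm (a j x) <= c * hnorm x.

Lemma amp_absum H K (a : forall j, H j -> K j) (f : ell2 H) : ubop a ->
  absum (fun j => hnorm (a j (f j)) ^+ 2).
Proof.
move=> [_ [c c0 ac]].
apply: (@absum_le _ _ _ (fun j => c ^+ 2 * hnorm (f j) ^+ 2)).
  move=> j; rewrite ger0_norm ?sqr_ge0// -exprMn.
  by rewrite ler_pXn2r ?nnegrE ?mulr_ge0 ?hnorm_ge0.
exact/absumZ/coordP.
Qed.

(* Meaningful only when [a] is uniformly bounded: vectors whose image is not
   square summable are sent to [0]. *)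
Definition amp H K (a : forall j, H j -> K j) (f : ell2 H) : ell2 K :=
  if pselect (absum (fun j => hnorm (a j (f j)) ^+ 2)) is left af
  then Ell2 af else 0.

Lemma ampE H K (a : forall j, H j -> K j) (f : ell2 H) j : ubop a ->
  amp a f j = a j (f j).
Proof. by move=> /(amp_absum f) af; rewrite /amp; case: pselect. Qed.

Lemma hnorm_amp_le H K (a : forall j, H j -> K j) (f : ell2 H) c : ubop a -> 0 <= c ->
  (forall j x, hnorm (a j x) <= c * hnorm x) -> hnorm (amp a f) <= c * hnorm f.
Proof. by move=> ua c0 ac; apply: hnorm_ell2_le => // j; rewrite ampE. Qed.

Lemma bop_amp H K (a : forall j, H j -> K j) : ubop a -> bounded_op (amp a).
Proof.
move=> ua; have [ba [c c0 ac]] := ua; apply/bounded_opP; split=> [k x y|].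
  apply: ell2_ext => j; rewrite ell2_addE ell2_scaleE !ampE//.
  by rewrite ell2_addE ell2_scaleE (bopP (ba j)).
by exists c => // f; exact: hnorm_amp_le.
Qed.

Lemma hnorm_adj_le (X Y : hilbertType R) (T : X -> Y) (c : R) : bounded_op T ->
  (forall x, hnorm (T x) <= c * hnorm x) -> 0 <= c ->
  forall y, hnorm (adj T y) <= c * hnorm y.
Proof.
move=> bT Tc c0 y; have [->|n0] := eqVneq (hnorm (adj T y)) 0.
  by rewrite mulr_ge0 ?hnorm_ge0.
have {}n0 : 0 < hnorm (adj T y) by rewrite lt_neqAle eq_sym n0 hnorm_ge0.
rewrite -(ler_pM2r n0) -expr2 -[_ ^+ 2]ger0_norm ?sqr_ge0// -cabs_real -innerxx.
rewrite -(adjP bT) (le_trans (cauchy_schwarz _ _))// mulrAC ler_wpM2r ?hnorm_ge0//.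
Qed.

Lemma ubop_adj H K (a : forall j, H j -> K j) : ubop a -> ubop (fun j => adj (a j)).
Proof.
move=> [ba [c c0 ac]]; split=> [j|]; first exact: bop_adj.
by exists c => // j; apply: hnorm_adj_le.
Qed.

Lemma ubop_comp H K L (a : forall j, K j -> L j) (b : forall j, H j -> K j) :
  ubop a -> ubop b -> ubop (fun j => a j \o b j).
Proof.
move=> [ba [c c0 ac]] [bb [d d0 bd]]; split=> [j|]; first exact: bop_comp.
by exists (c * d) => [|j x]; rewrite ?mulr_ge0// (le_trans (ac _ _))// -mulrA ler_wpM2l.
Qed.

Lemma adj_amp H K (a : forall j, H j -> K j) : ubop a ->
  adj (amp a) = amp (fun j => adj (a j)).
Proof.
move=> ua; apply/esym/adj_uniq; first exact: bop_amp.
move=> f g; apply: inner_ell2_ext => j; rewrite !ampE//; last exact: ubop_adj.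
by apply: adjP; case: ua.
Qed.

Lemma amp_comp H K L (a : forall j, K j -> L j) (b : forall j, H j -> K j) :
  ubop a -> ubop b -> amp (fun j => a j \o b j) = amp a \o amp b.
Proof.
move=> ua ub; apply/funext => f; apply: ell2_ext => j.
by rewrite /= !ampE//; exact: ubop_comp.
Qed.

Lemma ubop_cst (X Y : hilbertType R) (a : X -> Y) : bounded_op a ->
  ubop (H := fun=> X) (K := fun=> Y) (fun=> a).
Proof. by move=> ba; split=> //; have [c c0 ac] := bop_bound ba; exists c. Qed.

End Ell2Operators.

Arguments amp {R J H K} a f.

Section ConstantAmplification.
Variables (R : realType) (J : choiceType).
Implicit Types X Y Z : hilbertType R.

(** [X] tensored with [l^2(J)]; then [famp a] below is [a] tensored with the identity. *)
Definition pow X := ell2 (fun _ : J => X) : hilbertType R.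

Definition famp X Y (a : X -> Y) : pow X -> pow Y := amp (fun=> a).

Lemma fampE X Y (a : X -> Y) (f : pow X) j : bounded_op a -> famp a f j = a (f j).
Proof. by move=> ba; rewrite /famp ampE//; exact: ubop_cst. Qed.

Lemma bop_famp X Y (a : X -> Y) : bounded_op a -> bounded_op (famp a).
Proof. by move=> ba; apply/bop_amp/ubop_cst. Qed.

Lemma adj_famp X Y (a : X -> Y) : bounded_op a -> adj (famp a) = famp (adj a).
Proof. by move=> ba; rewrite /famp adj_amp//; exact: ubop_cst. Qed.

Lemma famp_comp X Y Z (a : Y -> Z) (b : X -> Y) : bounded_op a -> bounded_op b ->
  famp (a \o b) = famp a \o famp b.
Proof. by move=> ba bb; rewrite /famp -amp_comp//; exact: ubop_cst. Qed.

Lemma famp_id X : famp (idfun : X -> X) = idfun.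
Proof. by apply/funext => f; apply: ell2_ext => j; rewrite fampE//; exact: bop_id. Qed.

Lemma famp_lin X Y (k : R[i]) (a b : X -> Y) : bounded_op a -> bounded_op b ->
  famp (k *: a + b) = k *: famp a + famp b.
Proof.
move=> ba bb; apply/funext => f; apply: ell2_ext => j.
rewrite fampE; last exact: bop_lin.
rewrite -[(_ + famp b) f]/(k *: famp a f + famp b f).
by rewrite ell2_addE ell2_scaleE !fampE.
Qed.

Lemma famp_dirac X Y (a : X -> Y) j (x : X) : bounded_op a ->
  famp a (ell2_dirac (H := fun=> X) (i := j) x) = ell2_dirac (H := fun=> Y) (i := j) (a x).
Proof.
move=> ba; apply: ell2_ext => i; rewrite fampE//.
have [<-|ji] := eqVneq j i; first by rewrite !dirac_in.
by rewrite !dirac_out// bop0.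
Qed.

End ConstantAmplification.

Arguments bop_famp {R J X Y a}.
Arguments adj_famp {R J X Y a}.
Arguments famp_comp {R J X Y Z a b}.
Arguments famp_id {R J X}.
Arguments famp_lin {R J X Y k a b}.
Arguments bop_coord {R J H j}.

(** * Countable powers and the weak-star topology *)

Section Flatten.
Variable R : realType.

Lemma nat_pair_bij : exists e : nat -> nat * nat, set_bij [set: nat] [set: nat * nat] e.
Proof.
have : ([set: nat] #= [set: nat * nat])%card by rewrite card_eq_sym card_nat2.
by move=> /card_set_bijP.
Qed.

(** Tonelli along a bijection of [nat] with pairs. Only norms are matched, but for all operators [a]
    at once, which is what domination asks for. *)
Lemma flatten_ell2 (X : hilbertType R) (F : pow nat (pow nat X)) :
  exists g : pow nat X, forall (Y : hilbertType R) (a : X -> Y), bounded_op a ->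
    hnorm (famp a g) = hnorm (famp (famp a) F).
Proof.
have [e eb] := nat_pair_bij.
have main (q : nat -> nat -> R) : (forall n m, 0 <= q n m) ->
    (forall n, absum (q n)) -> absum (fun n => rsum (q n)) ->
    absum (fun k => q (e k).1 (e k).2) /\
    rsum (fun k => q (e k).1 (e k).2) = rsum (fun n => rsum (q n)).
  move=> q0 sq srq.
  have r0 n : 0 <= rsum (q n) by apply: rsum_ge0.
  have E : nnsum (fun k => q (e k).1 (e k).2) = nnsum (fun n => rsum (q n)).
    rewrite /nnsum -(reindex_esum setT setT e (fun p => (q p.1 p.2)%:E))//.
    have -> : [set: nat * nat] = [set: nat] `*`` (fun=> [set: nat]).
      by apply/seteqP; split.
    rewrite -(@esum_esum _ _ _ setT (fun=> setT) (fun n m => (q n m)%:E)); last first.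
      by move=> *; rewrite lee_fin.
    apply: eq_esum => n _; rewrite rsumE// fineK//.
    exact: absum_fin.
  split; last by rewrite !rsumE// E.
  rewrite /absum (eq_nnsum (q := fun k => q (e k).1 (e k).2)) => [|k]; last first.
    by rewrite ger0_norm.
  rewrite E; move: srq; rewrite /absum (eq_nnsum (q := fun n => rsum (q n)))//.
  by move=> n; rewrite ger0_norm.
pose q (Y : hilbertType R) (a : X -> Y) n m := hnorm (a (F n m)) ^+ 2.
have sqn (Y : hilbertType R) (a : X -> Y) n : bounded_op a -> absum (q Y a n).
  move=> ba; have := coordP (famp a (F n)); congr absum; apply/funext => m.
  by rewrite fampE.
have rqn (Y : hilbertType R) (a : X -> Y) n : bounded_op a ->
    rsum (q Y a n) = hnorm (famp (famp a) F n) ^+ 2.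
  move=> ba; rewrite fampE; last exact: bop_famp.
  rewrite hnorm_ell2; congr rsum; apply/funext => m; by rewrite fampE.
have mainq (Y : hilbertType R) (a : X -> Y) : bounded_op a ->
    absum (fun k => q Y a (e k).1 (e k).2) /\
    rsum (fun k => q Y a (e k).1 (e k).2) = hnorm (famp (famp a) F) ^+ 2.
  move=> ba; have [|||s E] := main (q Y a).
  - by move=> n m; exact: sqr_ge0.
  - by move=> n; exact: sqn.
  - have := coordP (famp (famp a) F); congr absum; apply/funext => n.
    by rewrite rqn.
  split=> //; rewrite E hnorm_ell2; congr rsum; apply/funext => n.
  by rewrite rqn.
have [s _] := mainq _ _ (@bop_id _ X).
exists (Ell2 (H := fun=> X) s) => Y a ba; apply/eqP.
rewrite -(eqrXn2 (n := 2)) ?hnorm_ge0//; apply/eqP; have [_ <-] := mainq _ _ ba.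
rewrite hnorm_ell2; congr rsum; apply/funext => k.
by rewrite fampE.
Qed.

End Flatten.

Section SeriesSums.
Variable R : realType.

Lemma rsum_cvg (q : nat -> R) : absum q -> series q @ \oo --> rsum q.
Proof.
have pos (p : nat -> R) : (forall n, 0 <= p n) -> absum p ->
    series p @ \oo --> fine (nnsum p).
  move=> p0 sp.
  have E : (\sum_(0 <= i <oo) (p i)%:E)%E = nnsum p.
    by rewrite nneseries_esumT// => n; rewrite lee_fin.
  have c : (fun n => \sum_(0 <= i < n) (p i)%:E)%E @ \oo --> (fine (nnsum p))%:E.
    rewrite fineK ?absum_fin// -E.
    by apply: is_cvg_nneseries => n _ _; rewrite lee_fin.
  have h := fine_cvg c; suff -> : series p = fine \o (fun n => \sum_(0 <= i < n) (p i)%:E)%E by exact: h.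
  by apply/funext => n /=; rewrite sumEFin.
move=> sq; have sn := absumN sq.
have -> : series q = series (fun n => Num.max (q n) 0) \- series (fun n => Num.max (- q n) 0).
  apply/funext => n; rewrite /series/= -sumrB; apply: eq_bigr => i _.
  by case: leP => h; case: leP => h'; lra.
apply: cvgB; apply: pos => [n|]; rewrite ?le_max ?lexx ?orbT//; exact: absum_pos.
Qed.

Lemma csum_cvg (a : nat -> R[i]) : cabsum a ->
  series (a : nat -> R[i]^o) @ \oo --> (csum a : R[i]^o).
Proof.
move=> sa; have cR := rsum_cvg (cabsum_Re sa); have cI := rsum_cvg (cabsum_Im sa).
apply/cvgrPdist_lt => e; case: e => e f; rewrite ltcE/= => /andP[/eqP -> e0].
have e2 : 0 < e / 2 by rewrite divr_gt0.
move/cvgrPdist_lt : cR => /(_ _ e2); move/cvgrPdist_lt : cI => /(_ _ e2).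
apply: filterS2 => n hI hR.
have -> : csum a - series a n =
    (rsum (fun j => complex.Re (a j)) - series (fun j => complex.Re (a j)) n)%:C%C +
    (rsum (fun j => complex.Im (a j)) - series (fun j => complex.Im (a j)) n)%:C%C * 'i%C.
  rewrite /csum /series/=.
  have -> : \sum_(0 <= k < n) a k = ((\sum_(0 <= k < n) complex.Re (a k)) +i*
      (\sum_(0 <= k < n) complex.Im (a k)))%C.
    elim: n {hI hR} => [|n IH]; first by rewrite !big_nil.
    by rewrite !big_nat_recr//= IH; case: (a n).
  by apply/eqP; rewrite eq_complex/= !mulr0 !mul0r !mulr1 !subr0 !addr0 !add0r !eqxx.
rewrite -[ltLHS]/(`|_ + _|); rewrite (le_lt_trans (ler_normD _ _))// normrM.
have -> : `|'i%C| = 1 :> R[i] by rewrite normc_def/= expr0n add0r expr1n sqrtr1.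
rewrite mulr1 !cabsE !cabs_real -rmorphD ltcR; lra.
Qed.

Lemma csum_limn (a : nat -> R[i]) : cabsum a ->
  limn (series (a : nat -> R[i]^o)) = csum a.
Proof. by move=> /csum_cvg /cvg_lim; apply; exact: norm_hausdorff. Qed.

Lemma absum_series (q : nat -> R) (c : R) : (forall n, 0 <= q n) ->
  (forall n, series q n <= c) -> absum q.
Proof.
move=> q0 qc; rewrite /absum (eq_nnsum (q := q)) => [|n]; last by rewrite ger0_norm.
apply: (@le_lt_trans _ _ c%:E); last exact: ltry.
rewrite /nnsum -nneseries_esumT => [|n]; last by rewrite lee_fin.
apply: lime_le; first by apply: is_cvg_nneseries => n _ _; rewrite lee_fin.
by apply: nearW => n; rewrite sumEFin lee_fin qc.
Qed.

Lemma square_summableP (H : hilbertType R) (x : nat -> H) :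
  square_summable x <-> absum (fun n => hnorm (x n) ^+ 2).
Proof.
have E n : series (fun n => (`|x n| ^+ 2 : R[i]^o)) n =
    (series (fun n => hnorm (x n) ^+ 2) n)%:C%C.
  rewrite /series/= rmorph_sum; apply: eq_bigr => i _.
  by rewrite hnormE rmorphXn.
split=> [cx|sx].
  have /cvg_ex[l /= /cvgrPdist_lt /(_ 1 ltr01)[N _ Nl]] := cx.
  pose c := cabs l + 1.
  have bnd n : (N <= n)%N -> series (fun n => hnorm (x n) ^+ 2) n <= c.
    move=> /Nl /=; rewrite E => h.
    have : cabs (l - (series (fun n => hnorm (x n) ^+ 2) n)%:C%C) < 1.
      by rewrite -ltcR -cabsE.
    set s := series _ n => h1.
    have := cabsD (s%:C%C - l) l; rewrite subrK cabs_real -cabsN opprB.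
    have := ler_norm s; rewrite /c; lra.
  have sq0 n : 0 <= hnorm (x n) ^+ 2 by exact: sqr_ge0.
  apply: (@absum_series _ c) => // n; have [/bnd//|nN] := leqP N n.
  rewrite (le_trans _ (bnd N (leqnn _)))// /series/= [leRHS](big_cat_nat (n := n))//=.
    by rewrite lerDl sumr_ge0.
  exact: ltnW.
have sa : cabsum (fun n => (hnorm (x n) ^+ 2)%:C%C).
  rewrite /cabsum (_ : (fun n => _) = (fun n => hnorm (x n) ^+ 2))//.
  by apply/funext => n; rewrite cabs_real ger0_norm ?sqr_ge0.
apply/cvg_ex; exists (csum (fun n => (hnorm (x n) ^+ 2)%:C%C) : R[i]^o).
have -> : (fun n => (`|x n| ^+ 2 : R[i]^o)) = (fun n => (hnorm (x n) ^+ 2)%:C%C).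
  by apply/funext => n; rewrite hnormE rmorphXn.
exact: csum_cvg.
Qed.

End SeriesSums.

Section WeakStarTopology.
Variable R : realType.
Implicit Types H K : hilbertType R.

Definition pidx H K (X : pow nat H) (Y : pow nat K) : predual_index H K :=
  exist _ (coord X : nat -> H, coord Y : nat -> K)
    (conj (proj2 (square_summableP X) (coordP X))
          (proj2 (square_summableP Y) (coordP Y))).

(** Normal functionals are vector functionals of the countable amplification; this turns weak-star
    questions into Hilbert space geometry. *)
Lemma predual_evalE H K (T : H -> K) (X : pow nat H) (Y : pow nat K) :
  bounded_op T -> predual_eval T (pidx X Y) = inner (famp T X) Y.
Proof.
move=> bT; rewrite /predual_eval /=.
have -> : (fun n => (inner (T (X n)) (Y n) : R[i]^o)) =
    (fun n => inner (famp T X n) (Y n)).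
  by apply/funext => n; rewrite fampE.
by rewrite csum_limn//; exact: cabsum_inner.
Qed.

Lemma predual_indexP H K (w : predual_index H K) :
  exists (X : pow nat H) (Y : pow nat K), forall T, predual_eval T w = predual_eval T (pidx X Y).
Proof.
case: w => [[x y] [sx sy]].
by exists (Ell2 (H := fun=> H) (proj1 (square_summableP x) sx)),
  (Ell2 (H := fun=> K) (proj1 (square_summableP y) sy)).
Qed.

Lemma wstar_cvg H K (F : set_system (H -> K)) (T : H -> K) : Filter F ->
  (forall w : predual_index H K,
    (fun S => predual_eval S w) @ F --> predual_eval T w) ->
  F --> (T : wstar H K).
Proof.
move=> FF FT.
have ptw : (predual_eval (K:=K) @ F : set_system {ptws predual_index H K -> R[i]^o}) -->
    (predual_eval T : {ptws predual_index H K -> R[i]^o}).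
  apply/cvg_sup => w U [V [[W oW <-] WT]] WU.
  have : nbhs (predual_eval T w) W by apply: open_nbhs_nbhs; split.
  by move=> /(FT w) h; apply: (@filterS _ F FF _ _ _ h) => S ?; exact: WU.
move=> U; rewrite /= nbhsE => -[V [[W oW <-] WT] WU].
have : nbhs (predual_eval T : {ptws predual_index H K -> R[i]^o}) W.
  by apply: open_nbhs_nbhs; split.
by move=> /ptw h; apply: (@filterS _ F FF _ _ _ h) => S ?; exact: WU.
Qed.

Lemma predual_eval_continuous H K (T : wstar H K) (w : predual_index H K) :
  (fun S : wstar H K => predual_eval S w) @ T --> predual_eval T w.
Proof.
have c : (predual_eval (K:=K) : wstar H K -> {ptws predual_index H K -> R[i]^o}) @ T
    --> (predual_eval T : {ptws predual_index H K -> R[i]^o}).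
  exact: initial_continuous.
move=> U Uw.
have h : nbhs (predual_eval T : {ptws predual_index H K -> R[i]^o}) [set g | U (g w)].
  have /cvg_sup/(_ w) cw : nbhs (predual_eval T : {ptws predual_index H K -> R[i]^o})
      --> (predual_eval T : {ptws predual_index H K -> R[i]^o}) by [].
  apply: cw; exact: (@initial_continuous _ _
    (fun f : predual_index H K -> R[i]^o => f w) (predual_eval T) U Uw).
exact: (c _ h).
Qed.

(** The sequence is one vector of a nested power; once flattened, its amplified norm bounds that of
    every entry. *)
Lemma ell2_combine H (F : nat -> pow nat H) :
  absum (fun n => hnorm (F n) ^+ 2) ->
  exists g : pow nat H, forall K (a : H -> K) , bounded_op a ->
    forall n, hnorm (famp a (F n)) <= hnorm (famp a g).
Proof.
move=> sF; have [g gP] := flatten_ell2 (Ell2 (H := fun=> pow nat H) sF).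
exists g => K a ba n; rewrite gP//.
apply: le_trans (hnorm_coord _ n); rewrite fampE//; exact: bop_famp.
Qed.

Lemma ell2_pair H (X Y : pow nat H) :
  exists g : pow nat H, forall K (a : H -> K), bounded_op a ->
    hnorm (famp a X) <= hnorm (famp a g) /\ hnorm (famp a Y) <= hnorm (famp a g).
Proof.
pose F : pow nat (pow nat H) :=
  ell2_dirac (H := fun=> pow nat H) (i := 0%N) X +
  ell2_dirac (H := fun=> pow nat H) (i := 1%N) Y.
have F0 : F 0%N = X by rewrite ell2_addE dirac_in dirac_out// addr0.
have F1 : F 1%N = Y by rewrite ell2_addE dirac_in dirac_out// add0r.
have [g gP] := ell2_combine (coordP F); exists g => K a ba.
by split; [rewrite -[in leLHS]F0|rewrite -[in leLHS]F1]; exact: gP.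
Qed.

(** The seminorms [|famp S X|] define the ultrastrong topology, which is finer than the weak-star
    one by Cauchy-Schwarz. By [ell2_pair] they are directed, so a single vector [X] suffices. *)
Lemma wstar_nbhs H K (T : H -> K) (B : set (H -> K)) : bounded_op T ->
  nbhs (T : wstar H K) B ->
  exists X : pow nat H, exists2 e : R, 0 < e & forall S, bounded_op S ->
    hnorm (famp (S - T) X) < e -> B S.
Proof.
move=> bT nB.
pose F : set_system (H -> K) := [set B' | exists X : pow nat H,
  exists2 e : R, 0 < e & forall S, bounded_op S ->
    hnorm (famp (S - T) X) < e -> B' S].
have bST S : bounded_op S -> bounded_op (S - T).
  by move=> bS; apply: (linear_setB (bop_linear_set H K)).
have FF : Filter F.
  split; first by exists 0, 1.
    move=> P Q [X [e e0 XP]] [Y [d d0 YQ]].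
    have [g gP] := ell2_pair X Y; exists g, (Num.min e d); first by rewrite lt_min e0.
    move=> S bS; rewrite lt_min => /andP[Se Sd]; have [gX gY] := gP _ _ (bST _ bS).
    by split; [apply: XP (le_lt_trans gX Se)|apply: YQ (le_lt_trans gY Sd)].
  by move=> P Q PQ [X [e e0 XP]]; exists X, e => // S bS SX; apply/PQ/XP.
suff : F --> (T : wstar H K) by apply.
apply: wstar_cvg => w; have [X [Y wE]] := predual_indexP w.
apply/cvgrPdist_lt => e; case: e => e f; rewrite ltcE/= => /andP[/eqP -> e0].
have Y1 : 0 < hnorm Y + 1 by have := hnorm_ge0 Y; lra.
exists X, (e / (hnorm Y + 1)) => [|S bS SX]; first by rewrite divr_gt0.
rewrite !wE !predual_evalE// cabsE ltcR -cabsN opprB -innerBl.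
have -> : famp S X - famp T X = famp (S - T) X.
  have -> : S - T = -1 *: T + S by rewrite scaleN1r addrC.
  rewrite famp_lin// -[RHS]/(-1 *: famp T X + famp S X) scaleN1r addrC//.
rewrite (le_lt_trans (cauchy_schwarz _ _))//.
rewrite (@le_lt_trans _ _ (hnorm (famp (S - T) X) * (hnorm Y + 1)))//.
  by rewrite ler_wpM2l ?hnorm_ge0// lerDl.
by rewrite -ltr_pdivlMr.
Qed.

(* By the bipolar theorem; a pair of square summable sequences is a pair of
   vectors of a countable power. *)
Theorem wclosureP H K (S : set (H -> K)) (T : H -> K) :
  linear_set S -> S `<=` @bounded_op R H K ->
  wclosure S T <-> bounded_op T /\ forall (X : pow nat H) (Y : pow nat K),
    (forall s, S s -> inner (famp s X) Y = 0) -> inner (famp T X) Y = 0.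
Proof.
move=> lS bS; split=> [[bT cT]|[bT TS]]; split=> //.
  move=> X Y SXY; apply/cabs_eq0/eqP; rewrite eq_le cabs_ge0 andbT.
  apply/ler_addgt0Pl => e e0; rewrite addr0.
  have eC : 0 < e%:C%C :> R[i] by rewrite ltcE/= eqxx.
  have /cvgrPdist_lt/(_ _ eC) nT := @predual_eval_continuous H K T (pidx X Y).
  have [s [Ss]] := cT _ nT.
  rewrite /= !predual_evalE//; last exact: bS.
  by rewrite (SXY _ Ss) subr0 cabsE ltcR => /ltW.
move=> B /(wstar_nbhs bT)[X [e e0 XB]].
pose E := [set famp s X | s in S].
have lE : linear_set E.
  split; first by exists 0 => //; [case: lS|apply: ell2_ext => j; rewrite fampE//; exact: bop_cst0].
  move=> c _ _ [s Ss <-] [t St <-]; exists (c *: s + t); first by case: lS => _; exact.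
  by rewrite famp_lin//; exact: bS.
have [y Ey yo] := orthogonal_decomposition lE (famp T X).
(* The residual is orthogonal to every [famp s X], hence by the hypothesis on [T] to [famp T X]; it
   is orthogonal to [y] as well, so it is [0]. *)
have Ty : famp T X = y.
  apply/eqP; rewrite -subr_eq0; apply/eqP/innerxx_eq0; rewrite innerBl.
  rewrite (TS X) ?sub0r => [|s Ss]; last by apply: yo; exists s.
  by rewrite (inner_adherent0 yo Ey) oppr0.
have [_ [s Ss <-] sT] : exists2 z, E z & hnorm (famp T X - z) < e.
  by rewrite Ty; exact: Ey.
exists s; split=> //; apply: XB; first exact: bS.
rewrite -hnormN; apply: le_lt_trans sT.
have bs := bS _ Ss.
have -> : s - T = -1 *: T + s by rewrite scaleN1r addrC.
by rewrite famp_lin// -[X in - X]/(-1 *: famp T X + famp s X) scaleN1r opprD opprK.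
Qed.

(** Continuity at [0] sends an ultrastrong ball of radius [e] into the unit disc; homogeneity gives
    the bound, with [2 / e] because the ball is open. *)
Lemma wcontinuous_dominated H K K' (A : set (H -> H)) (f : (H -> H) -> K -> K') xi eta :
  linear_set A -> A `<=` @bounded_op R H H ->
  (forall a, A a -> bounded_op (f a)) ->
  (forall (c : R[i]) a b, A a -> A b -> f (c *: a + b) = c *: f a + f b) ->
  wcontinuous_on A f ->
  exists X : pow nat H, exists2 c : R, 0 <= c & forall a, A a ->
    cabs (inner (f a xi) eta) <= c * hnorm (famp a X).
Proof.
move=> lA bA bf lf /subspace_continuousP cf.
have A0 : A 0 by case: lA.
have f0 : f 0 = 0.
  have := lf (-1) 0 0 A0 A0; rewrite scaler0 addr0 scaleN1r.
  by rewrite addNr.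
have fe a : A a -> inner (f a xi) eta = predual_eval (f a)
    (pidx (ell2_dirac (H := fun=> K) (i := 0%N) xi) (ell2_dirac (H := fun=> K') (i := 0%N) eta)).
  move=> Aa; rewrite predual_evalE; last exact: bf.
  rewrite famp_dirac; last exact: bf.
  by rewrite inner_dirac dirac_in.
move: fe; set w := pidx _ _ => fe.
have n0 : nbhs (f 0 : wstar K K') [set T | `|predual_eval T w| < 1].
  have /cvgrPdist_lt/(_ 1 ltr01) := @predual_eval_continuous K K' (f 0) w.
  apply: filterS => T /=; rewrite -fe// f0 -[(0 : K -> K') xi]/0 inner0l sub0r.
  by rewrite normrN.
have := cf 0 A0 _ n0; rewrite /= nbhs_simpl /within/= => n1.
have [X [e e0 XP]] := wstar_nbhs (@bop_cst0 _ H H) n1.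
have {XP} key a : A a -> hnorm (famp a X) < e -> cabs (inner (f a xi) eta) < 1.
  move=> Aa aX; have := XP a (bA _ Aa); rewrite subr0 => /(_ aX Aa) /=.
  by rewrite -fe// cabsE ltcR.
exists X, (2 / e) => [|a Aa]; first by rewrite divr_ge0 ?ltW.
have sc (r : R) : 0 <= r -> r * hnorm (famp a X) < e -> r * cabs (inner (f a xi) eta) < 1.
  move=> r0 raX; have Ara : A (r%:C%C *: a) by exact: linear_setZ.
  have ba := bA _ Aa.
  have faE : famp (r%:C%C *: a) X = r%:C%C *: famp a X.
    apply: ell2_ext => j; rewrite ell2_scaleE !fampE//.
    exact: (linear_setZ _ (bop_linear_set H H)).
  have := key _ Ara; rewrite faE hnormZr ger0_norm// => /(_ raX).
  have -> : f (r%:C%C *: a) = r%:C%C *: f a.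
    by rewrite -[X in f X]addr0 lf// f0 addr0.
  by rewrite -[(_ *: f a) xi]/(_ *: f a xi) innerZl cabsM cabs_real ger0_norm.
set p := cabs _ in sc *; have p0 : 0 <= p by exact: cabs_ge0.
move: sc; have := hnorm_ge0 (famp a X); move: (hnorm (famp a X)) => h h0 sc.
(* If [h = 0] all multiples of [a] stay in the ball, so [p] is below every positive [d]. *)
have [h1|h1] := eqVneq h 0.
  rewrite h1 mulr0; apply/ler_addgt0Pl => d d0; rewrite addr0.
  have := sc d^-1; rewrite h1 mulr0 invr_ge0 (ltW d0) => /(_ isT e0).
  by rewrite mulrC ltr_pdivrMr// mul1r => /ltW.
have {}h1 : 0 < h by rewrite lt_neqAle eq_sym h1.
have := sc (e / (2 * h)); rewrite divr_ge0 ?(ltW e0) ?mulr_ge0// => /(_ isT).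
have -> : e / (2 * h) * h = e / 2 by field; rewrite gt_eqF.
have -> : (e / 2 < e) = true by lra.
move=> /(_ isT); rewrite mulrAC ltr_pdivrMr ?mulr_gt0// mul1r => h2.
by rewrite mulrAC ler_pdivlMr// mulrC ltW.
Qed.

Lemma dominated_wcontinuous H K K' (A : set (H -> H)) (f : (H -> H) -> K -> K') :
  A `<=` @bounded_op R H H -> (forall a, A a -> bounded_op (f a)) ->
  (forall (X : pow nat K) (Y : pow nat K'), exists (X' Y' : pow nat H),
    forall a, A a -> inner (famp (f a) X) Y = inner (famp a X') Y') ->
  wcontinuous_on A f.
Proof.
move=> bA bf fP; apply/subspace_continuousP => a Aa.
apply: wstar_cvg => w; have [X [Y wE]] := predual_indexP w.
have [X' [Y' XY]] := fP X Y.
have E b : A b -> predual_eval (f b) w = predual_eval b (pidx X' Y').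
  move=> Ab; rewrite wE !predual_evalE; [|exact: bA|exact: bf].
  exact: XY.
rewrite E//; have := @predual_eval_continuous H H a (pidx X' Y').
move=> h U /h; rewrite /= !nbhs_simpl /within/=.
by apply: filterS => b Ub Ab; rewrite /= E.
Qed.

End WeakStarTopology.

(** * Star representations and positive functionals *)

Section StarAlgebras.
Variable R : realType.
Implicit Types H K L : hilbertType R.

Record star_algebra H (A : set (H -> H)) : Prop := {
  sta_linear : linear_set A ;
  sta_bop : A `<=` @bounded_op R H H ;
  sta_comp : forall a b, A a -> A b -> A (a \o b) ;
  sta_id : A idfun ;
  sta_adj : forall a, A a -> A (adj a)
}.

Record star_rep H (A : set (H -> H)) L (rho : (H -> H) -> L -> L) : Prop := {
  rep_bop : forall a, A a -> bounded_op (rho a) ;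
  rep_lin : forall (c : R[i]) a b, A a -> A b ->
    rho (c *: a + b) = c *: rho a + rho b ;
  rep_comp : forall a b, A a -> A b -> rho (a \o b) = rho a \o rho b ;
  rep_id : rho idfun = idfun ;
  rep_adj : forall a, A a -> rho (adj a) = adj (rho a)
}.

Lemma comp_linr H K L (c : R[i]) (S T : H -> K) (U : K -> L) : bounded_op U ->
  U \o (c *: S + T) = c *: (U \o S) + (U \o T).
Proof. by move=> bU; apply/funext => x; rewrite /= -[LHS]/(U (c *: S x + T x)) (bopP bU). Qed.

Lemma comp_linl H K L (c : R[i]) (S T : K -> L) (U : H -> K) :
  (c *: S + T) \o U = c *: (S \o U) + (T \o U).
Proof. by []. Qed.

Lemma fun_linE H K (c : R[i]) (S T : H -> K) x : (c *: S + T) x = c *: S x + T x.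
Proof. by []. Qed.

Lemma star_rep_id H (A : set (H -> H)) : star_algebra A -> star_rep A id.
Proof. by move=> sA; split=> // a; exact: sta_bop. Qed.

Lemma star_rep_famp (J : choiceType) H (A : set (H -> H)) L (rho : (H -> H) -> L -> L) :
  star_rep A rho -> star_rep A (fun a => famp (J := J) (rho a)).
Proof.
move=> sr; split=> [a Aa|c a b Aa Ab|a b Aa Ab||a Aa].
- exact/bop_famp/(rep_bop sr).
- by rewrite (rep_lin sr)// famp_lin//; exact: rep_bop sr _ _.
- by rewrite (rep_comp sr)// famp_comp//; exact: rep_bop sr _ _.
- by rewrite (rep_id sr) famp_id.
- by rewrite (rep_adj sr)// adj_famp//; exact: rep_bop sr _ _.
Qed.

Lemma rep0 H (A : set (H -> H)) L (rho : (H -> H) -> L -> L) :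
  linear_set A -> star_rep A rho -> rho 0 = 0.
Proof.
move=> [A0 _] sr; have := rep_lin sr (-1) A0 A0.
by rewrite scaler0 addr0 scaleN1r addNr.
Qed.

Lemma rep_sqE H (A : set (H -> H)) L (rho : (H -> H) -> L -> L) a xi :
  star_algebra A -> star_rep A rho -> A a ->
  inner (rho (adj a \o a) xi) xi = (hnorm (rho a xi) ^+ 2)%:C%C.
Proof.
move=> sA sr Aa; rewrite (rep_comp sr) ?(rep_adj sr)//; last exact: sta_adj.
have ba := rep_bop sr Aa.
by rewrite /= (adjP (bop_adj ba)) adjK// innerxx.
Qed.

Section PositiveFunctionals.
Variables (H : hilbertType R) (A : set (H -> H)) (sA : star_algebra A).

(** Positivity is tested on [adj a \o a] only, so that square roots of positive elements are never
    formed. *)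
Record posfun (f : (H -> H) -> R[i]) : Prop := {
  pf_lin : forall (c : R[i]) a b, A a -> A b -> f (c *: a + b) = c * f a + f b ;
  pf_ge0 : forall a, A a -> 0 <= f (adj a \o a)
}.

Let Aadj a := @sta_adj _ _ sA a.
Let Acomp a b := @sta_comp _ _ sA a b.
Let Abop a := @sta_bop _ _ sA a.
Let Alin (c : R[i]) a b : A a -> A b -> A (c *: a + b).
Proof. by case: (sta_linear sA) => _; apply. Qed.

Lemma pf_expand f t a b : posfun f -> A a -> A b ->
  f (adj (t *: a + b) \o (t *: a + b)) =
  t * t^* * f (adj a \o a) + t * f (adj b \o a) + t^* * f (adj a \o b) + f (adj b \o b).
Proof.
move=> pf Aa Ab; have [ba bb] := (Abop Aa, Abop Ab).
have [Aa' Ab'] := (Aadj Aa, Aadj Ab).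
rewrite adj_lin// comp_linl !comp_linr; [|exact: bop_adj|exact: bop_adj].
rewrite !(pf_lin pf); try by [exact: Acomp|apply: Alin; exact: Acomp].
by rewrite mulrDr mulrA [t^* * t]mulrC -!addrA; congr (_ + _); rewrite addrCA.
Qed.

(** Polarisation: positivity at [t a + b] makes the sum of the cross terms real for every [t];
    [t = 1] compares the imaginary parts and [t = 'i] the real ones. *)
Lemma pf_herm f a b : posfun f -> A a -> A b -> f (adj a \o b) = (f (adj b \o a))^*.
Proof.
move=> pf Aa Ab.
have real t : complex.Im (t * f (adj b \o a) + t^* * f (adj a \o b)) = 0.
  have := pf_ge0 pf (Alin t Aa Ab); rewrite pf_expand//.
  have h1 : 0 <= t * t^* * f (adj a \o a) + f (adj b \o b).
    apply: addr_ge0; last exact: pf_ge0.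
    by apply: mulr_ge0; [exact: mul_conjC_ge0|exact: pf_ge0].
  move/ger0_Im; move/ger0_Im: h1.
  move: (t * t^* * f (adj a \o a)) (f (adj b \o b)) (t * f (adj b \o a)).
  by move: (t^* * f (adj a \o b)) => [? x] [? y] [? z] [? w]/=; lra.
have := real 1; have := real 'i%C; rewrite conjC1 !mul1r.
by case: (f _) (f _) => [x y] [z w]/= h1 h2; congr Complex; lra.
Qed.

Lemma pf_cauchy_schwarz f a b : posfun f -> A a -> A b ->
  cabs (f (adj b \o a)) ^+ 2 <=
  complex.Re (f (adj b \o b)) * complex.Re (f (adj a \o a)).
Proof.
move=> pf Aa Ab; apply: discriminant_le => [|t].
  by have := pf_ge0 pf Aa; rewrite lecE => /andP[].
have := pf_ge0 pf (Alin t Aa Ab); rewrite pf_expand// (pf_herm pf Aa Ab).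
rewrite lecE => /andP[_] /=; rewrite -sqr_cabs.
case: (f (adj a \o a)) (f (adj b \o b)) (f (adj b \o a)) => x1 y1 [x2 y2] [x3 y3].
move: (cabs t ^+ 2); case: t => t1 t2 s /=; lra.
Qed.

Section Dominated.
Variables (E : hilbertType R) (tau : (H -> H) -> E -> E) (srt : star_rep A tau).
Variable x : E.

Definition pf_dom f := forall a, A a ->
  complex.Re (f (adj a \o a)) <= hnorm (tau a x) ^+ 2.

(** Radon-Nikodym: in operator terms [f a] is the inner product of [tau a x] with [T x], where
    [0 <= T <= 1] commutes with [tau], and [y = T x]; the last bound is [T^2 <= T]. Riesz gives [y]
    without constructing [T], and Cauchy-Schwarz for [f] gives the bound. *)
Lemma pf_vector f : posfun f -> pf_dom f ->
  exists y, [/\ adherent (span [set tau a x | a in A]) y,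
    forall a, A a -> f a = inner (tau a x) y &
    forall a, A a -> hnorm (tau a y) ^+ 2 <= complex.Re (f (adj a \o a))].
Proof.
move=> pf fx; have A1 := sta_id sA.
have Re0 a : A a -> 0 <= complex.Re (f (adj a \o a)).
  by move=> Aa; have := pf_ge0 pf Aa; rewrite lecE => /andP[].
have id1 a : adj (idfun : H -> H) \o a = a by rewrite adj_id.
have [|||y [yA fy _]] := @riesz _ _ A E (fun a => tau a x) f
    (Num.sqrt (complex.Re (f (adj idfun \o idfun)))) (sta_linear sA).
- by move=> k a b Aa Ab; rewrite (rep_lin srt).
- by move=> k a b Aa Ab; exact: pf_lin pf _ _ _ Aa Ab.
- move=> a Aa; rewrite -(ler_pXn2r (n:=2)) ?nnegrE ?cabs_ge0 ?mulr_ge0 ?sqrtr_ge0 ?hnorm_ge0//.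
  rewrite exprMn sqr_sqrtr ?Re0//.
  have := pf_cauchy_schwarz pf Aa A1; rewrite id1 => /le_trans; apply.
  by rewrite ler_wpM2l ?Re0// fx.
have spn : linear_set [set tau a x | a in A].
  split; first by exists 0; [case: (sta_linear sA)|rewrite (rep0 (sta_linear sA) srt)].
  move=> k _ _ [a Aa <-] [b Ab <-]; exists (k *: a + b); first exact: Alin.
  by rewrite (rep_lin srt).
exists y; split=> // [|a Aa].
  by apply: adherent_mono yA; exact: sub_span.
have bta := rep_bop srt Aa.
have yA' : adherent [set tau b x | b in A] (tau a y).
  have := bop_adherent bta yA; apply: adherent_mono => _ [_ [b Ab <-] <-].
  by exists (a \o b); [exact: Acomp|rewrite (rep_comp srt)].
have bnd b : A b -> cabs (inner (tau b x) (tau a y)) <=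
    hnorm (tau b x) * Num.sqrt (complex.Re (f (adj a \o a))).
  move=> Ab; rewrite (adjPr bta) -(rep_adj srt)//.
  have Aa' := Aadj Aa.
  have -> : tau (adj a) (tau b x) = tau (adj a \o b) x by rewrite (rep_comp srt).
  rewrite -fy; last exact: Acomp.
  rewrite -(ler_pXn2r (n:=2)) ?nnegrE ?cabs_ge0 ?mulr_ge0 ?sqrtr_ge0 ?hnorm_ge0//.
  rewrite exprMn sqr_sqrtr ?Re0// mulrC.
  apply: (le_trans (pf_cauchy_schwarz pf Ab Aa)).
  by rewrite ler_wpM2l ?Re0// fx.
rewrite -[leRHS]sqr_sqrtr ?Re0// ler_pXn2r ?nnegrE ?hnorm_ge0 ?sqrtr_ge0//.
apply: hnorm_adherent_dual yA' _; last exact: sqrtr_ge0.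
by move=> _ [b Ab <-]; rewrite mulrC bnd.
Qed.

Definition pf_vec (g : (H -> H) -> R[i]) : E :=
  xget 0 [set y | (forall a, A a -> g a = inner (tau a x) y) /\
    forall a, A a -> hnorm (tau a y) ^+ 2 <= complex.Re (g (adj a \o a))].

(* Peeling off the vector functionals of [pf_vec] exhausts a dominated
   positive functional; this replaces the square root of its Radon-Nikodym
   derivative. *)
Fixpoint pf_peel (f : (H -> H) -> R[i]) (n : nat) : (H -> H) -> R[i] :=
  if n is m.+1 then fun a => pf_peel f m a -
    inner (tau a (pf_vec (pf_peel f m))) (pf_vec (pf_peel f m))
  else f.

Lemma pf_vecP g : posfun g -> pf_dom g ->
  (forall a, A a -> g a = inner (tau a x) (pf_vec g)) /\
  forall a, A a -> hnorm (tau a (pf_vec g)) ^+ 2 <= complex.Re (g (adj a \o a)).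
Proof.
move=> pg gx; have [y [_ gy yg]] := pf_vector pg gx.
by rewrite /pf_vec; case: xgetP => [z -> //|/(_ y)]; case.
Qed.

Lemma pf_peel_step g y : posfun g -> pf_dom g ->
  (forall a, A a -> hnorm (tau a y) ^+ 2 <= complex.Re (g (adj a \o a))) ->
  posfun (fun a => g a - inner (tau a y) y) /\ pf_dom (fun a => g a - inner (tau a y) y).
Proof.
move=> pg gx yg; split; first split=> [c a b Aa Ab|a Aa].
- rewrite (pf_lin pg)// (rep_lin srt)// fun_linE inner_is_linear; ring.
- rewrite (rep_sqE _ sA srt Aa); have := yg a Aa; have := pf_ge0 pg Aa.
  case: (g _) => p q; rewrite !lecE/= => /andP[/eqP -> _] h.
  by rewrite subr0 eqxx/= subr_ge0.
- move=> a Aa; rewrite (rep_sqE _ sA srt Aa) ReD ReN/=.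
  by rewrite (le_trans _ (gx a Aa))// lerBlDr lerDl sqr_ge0.
Qed.

Lemma pf_peelP f n : posfun f -> pf_dom f ->
  posfun (pf_peel f n) /\ pf_dom (pf_peel f n).
Proof.
move=> pf fx; elim: n => [//|n [pn nx]] /=.
by apply: pf_peel_step => //; case: (pf_vecP pn nx).
Qed.

Theorem pf_sum f : posfun f -> pf_dom f ->
  exists Y : pow nat E, forall a, A a ->
    hnorm (famp (tau a) Y) ^+ 2 = complex.Re (f (adj a \o a)).
Proof.
move=> pf fx; pose y n := pf_vec (pf_peel f n).
have yP n := pf_peelP n pf fx.
have yv n : (forall a, A a -> pf_peel f n a = inner (tau a x) (y n)) /\
    forall a, A a -> hnorm (tau a (y n)) ^+ 2 <= complex.Re (pf_peel f n (adj a \o a)).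
  by have [pn nx] := yP n; exact: pf_vecP.
have part a n : A a -> \sum_(0 <= k < n) hnorm (tau a (y k)) ^+ 2 +
    complex.Re (pf_peel f n (adj a \o a)) = complex.Re (f (adj a \o a)).
  move=> Aa; elim: n => [|n IH]; first by rewrite big_nil add0r.
  rewrite big_nat_recr//= ReD ReN (rep_sqE _ sA srt Aa) -IH/=.
  by rewrite -addrA; congr (_ + _); rewrite addrC subrK.
have pos n a : A a -> 0 <= complex.Re (pf_peel f n (adj a \o a)).
  by move=> Aa; have [pn _] := yP n; have := pf_ge0 pn Aa; rewrite lecE => /andP[].
have sy a : A a -> absum (fun n => hnorm (tau a (y n)) ^+ 2).
  move=> Aa; apply: (@absum_series _ _ (complex.Re (f (adj a \o a)))) => n.
    exact: sqr_ge0.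
  by rewrite /series/= -(part a n Aa) lerDl pos.
have A1 := sta_id sA.
have sy1 : absum (fun n => hnorm (y n) ^+ 2).
  by have := sy _ A1; rewrite (rep_id srt).
exists (Ell2 (H := fun=> E) sy1) => a Aa; have bta := rep_bop srt Aa.
rewrite hnorm_ell2; under eq_fun do rewrite fampE//=.
have c1 := rsum_cvg (sy a Aa).
have c2 : series (fun n => hnorm (tau a (y n)) ^+ 2) @ \oo --> complex.Re (f (adj a \o a)).
  have : (fun n => complex.Re (f (adj a \o a)) - complex.Re (pf_peel f n (adj a \o a)))
      @ \oo --> complex.Re (f (adj a \o a)) - 0.
    apply: cvgB; first exact: cvg_cst.
    (* The remainder at [adj a \o a] is the inner product of the fixed vector [tau (adj a \o a) x]
       with [y n], and [y n] tends to [0] since its squared norms are summable. *)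
    pose X := hnorm (tau (adj a \o a) x).
    have X0 : 0 <= X by exact: hnorm_ge0.
    apply/cvgrPdist_lt => e e0.
    have := cvg_series_cvg_0 (cvgP _ (rsum_cvg sy1)).
    have e1 : 0 < (e / (X + 1)) ^+ 2 by rewrite exprn_gt0// divr_gt0// ltr_wpDl.
    move=> /cvgrPdist_lt/(_ _ e1); apply: filterS => n.
    rewrite !sub0r !normrN ger0_norm ?sqr_ge0//.
    rewrite ltr_pXn2r ?nnegrE ?hnorm_ge0 ?divr_ge0 ?(ltW e0) ?addr_ge0// => yn.
    have Aaa : A (adj a \o a) by apply: (sta_comp sA) => //; exact: sta_adj.
    rewrite ger0_norm ?pos//; have [-> // _] := yv n.
    rewrite (le_lt_trans (Re_le_cabs _))// (le_lt_trans (cauchy_schwarz _ _))//.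
    rewrite (@le_lt_trans _ _ ((X + 1) * hnorm (y n)))//.
      by rewrite ler_wpM2r ?hnorm_ge0// lerDl.
    by rewrite mulrC -ltr_pdivlMr// ltr_wpDl.
  rewrite subr0; suff -> : series (fun n => hnorm (tau a (y n)) ^+ 2) =
    (fun n => complex.Re (f (adj a \o a)) - complex.Re (pf_peel f n (adj a \o a))) by [].
  by apply/funext => n; rewrite -(part a n Aa) addrK.
exact: (cvg_unique _ c1 c2).
Qed.

End Dominated.
End PositiveFunctionals.
End StarAlgebras.

(** * Normality expressed as domination *)

Section Domination.
Variable R : realType.
Implicit Types H K L E : hilbertType R.

(* [xi] is dominated when [a |-> |rho a xi|^2] is bounded by a positive normal
   functional in the representation [sigma]. *)
Definition domvec H (A : set (H -> H)) E L (sigma : (H -> H) -> E -> E)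
    (rho : (H -> H) -> L -> L) (xi : L) : Prop :=
  exists X : pow nat E, forall a, A a -> hnorm (rho a xi) <= hnorm (famp (sigma a) X).

(** For [sigma := id] this is normality of [rho]; a general [sigma] serves to compare two
    representations. *)
Definition dominated H (A : set (H -> H)) E L (sigma : (H -> H) -> E -> E)
    (rho : (H -> H) -> L -> L) : Prop :=
  forall xi, domvec A sigma rho xi.

Section Domvec.
Variables (H : hilbertType R) (A : set (H -> H)) (sA : star_algebra A).
Variables (E L : hilbertType R) (sigma : (H -> H) -> E -> E) (rho : (H -> H) -> L -> L).
Hypotheses (srs : star_rep A sigma) (srr : star_rep A rho).

(** The vector functional of [xi] is dominated by that of [X] in the amplification of [sigma]; there
    [pf_sum] writes it as a countable sum of vector functionals, and flattening makes it one. *)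
Lemma domvec_exact xi : domvec A sigma rho xi ->
  exists g : pow nat E, forall a, A a -> hnorm (rho a xi) = hnorm (famp (sigma a) g).
Proof.
move=> [X rX]; have srf := star_rep_famp nat srs.
have [|a Aa|Y YP] := @pf_sum _ _ _ sA _ _ srf X (fun a => inner (rho a xi) xi).
- split=> [c a b Aa Ab|a Aa].
    by rewrite (rep_lin srr)// fun_linE inner_is_linear.
  by rewrite (rep_sqE _ sA srr Aa) ler0c sqr_ge0.
- by rewrite (rep_sqE _ sA srr Aa)/= ler_pXn2r ?nnegrE ?hnorm_ge0// rX.
have [g gP] := flatten_ell2 Y; exists g => a Aa; apply/eqP.
rewrite -(eqrXn2 (n := 2)) ?hnorm_ge0// gP; last exact: rep_bop srs _ Aa.
by rewrite YP// (rep_sqE _ sA srr Aa).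
Qed.

Lemma domvec_scale (r : R) (X : pow nat E) xi : 0 <= r ->
  (forall a, A a -> hnorm (rho a xi) <= r * hnorm (famp (sigma a) X)) ->
  domvec A sigma rho xi.
Proof.
move=> r0 rX; exists (r%:C%C *: X) => a Aa.
rewrite (bopZ (bop_famp (rep_bop srs Aa))) hnormZr ger0_norm//.
exact: rX.
Qed.

Lemma domvec_linear : linear_set (domvec A sigma rho).
Proof.
split=> [|c x y [X xX] [Y yY]].
  by exists 0 => a Aa; rewrite (bop0 (rep_bop srr Aa)) hnorm0 hnorm_ge0.
have [g gP] := ell2_pair X Y.
apply: (@domvec_scale (cabs c + 1) g) => [|a Aa].
  by rewrite addr_ge0 ?cabs_ge0.
have [gX gY] := gP _ _ (rep_bop srs Aa).
rewrite (bopP (rep_bop srr Aa)) (le_trans (hnormD _ _))// mulrDl mul1r hnormZ.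
rewrite lerD//; last exact: le_trans (yY _ Aa) gY.
by rewrite ler_wpM2l ?cabs_ge0//; exact: le_trans (xX _ Aa) gX.
Qed.

(** A fast approximation of [xi] is telescoped. Each difference [d k] is matched exactly by some
    [g k], and equality at [a = idfun] gives [|g k| = |d k|]; a mere bound would not control the
    size of [g k]. *)
Lemma domvec_adherent xi : adherent (domvec A sigma rho) xi -> domvec A sigma rho xi.
Proof.
move=> Dxi; have lD := domvec_linear.
pose q : R := 4^-1; have q0 k : 0 < q ^+ k by rewrite exprn_gt0// invr_gt0.
have /choice[x xP] (k : nat) : exists x, domvec A sigma rho x /\ hnorm (xi - x) < q ^+ k.
  by have [x Dx xk] := Dxi _ (q0 k); exists x.
pose d k := if k is m.+1 then x m.+1 - x m else x 0%N.
have Dd k : domvec A sigma rho (d k).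
  case: k => [|k] /=; first by case: (xP 0%N).
  by apply: linear_setB => //; [case: (xP k.+1)|case: (xP k)].
have sum_d n : \sum_(0 <= k < n.+1) d k = x n.
  elim: n => [|n IH]; first by rewrite big_nat1.
  by rewrite big_nat_recr//= IH addrC subrK.
(* For [q = 1/4] the sum [q ^+ k.+1 + q ^+ k] is [5 * q ^+ k.+1]. *)
pose C := hnorm (x 0%N) + 5.
have C0 : 0 <= C by rewrite addr_ge0 ?hnorm_ge0.
have d_le k : hnorm (d k) <= C * q ^+ k.
  case: k => [|k]; first by rewrite expr0 mulr1 lerDl.
  have h1 : hnorm (d k.+1) <= q ^+ k.+1 + q ^+ k.
    rewrite /= (le_trans (hnorm_le_trans _ xi _))// hnormB lerD//.
      by case: (xP k.+1) => _ /ltW.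
    by case: (xP k) => _ /ltW.
  apply: (le_trans h1); have hx := hnorm_ge0 (x 0%N).
  have := q0 k; rewrite exprS /C /q; nra.
have /choice[g gP] (k : nat) : exists g : pow nat E,
    forall a, A a -> hnorm (rho a (d k)) = hnorm (famp (sigma a) g).
  exact: domvec_exact.
have g_le k : hnorm (g k) <= C * q ^+ k.
  have := gP k _ (sta_id sA); rewrite (rep_id srr) (rep_id srs) famp_id => <-.
  exact: d_le.
(* With weights [2^k] the norms are still of order [2^-k], hence square summable, while a common
   bound [Z] of all [G k] yields [|rho a (d k)| <= 2^-k |famp (sigma a) Z|], which sums to at most
   twice the last norm. *)
pose G k : pow nat E := (2 ^+ k)%:C%C *: g k.
have sG : absum (fun k => hnorm (G k) ^+ 2).
  have geo n : series (fun k => q ^+ k) n <= 2 - 4 / 3 * q ^+ n.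
    elim: n => [|n IH]; rewrite /series/=; first by rewrite big_nil expr0; lra.
    rewrite big_nat_recr//=; move: IH; rewrite /series/= exprS => IH.
    by have := q0 n; have -> : q * q ^+ n = 4^-1 * q ^+ n by []; lra.
  apply: (@absum_series _ _ (C ^+ 2 * 2)) => [k|n]; first exact: sqr_ge0.
  apply: (@le_trans _ _ (C ^+ 2 * series (fun k => q ^+ k) n)); last first.
    by rewrite ler_wpM2l ?sqr_ge0//; have := geo n; have := q0 n; lra.
  rewrite /series/= mulr_sumr; apply: ler_sum => k _.
  have -> : C ^+ 2 * q ^+ k = (2 ^+ k * (C * q ^+ k)) ^+ 2.
    have h4 : (2 ^+ k) ^+ 2 * q ^+ k = 1.
      rewrite -exprM mulnC exprM -exprMn (_ : 2 ^+ 2 * q = 1) ?expr1n// /q.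
      by field.
    rewrite !exprMn mulrCA; congr (_ * _).
    by rewrite [(q ^+ k) ^+ 2]expr2 mulrA h4 mul1r.
  have t0 : 0 <= 2 ^+ k :> R by rewrite exprn_ge0.
  have r0 : 0 <= 2 ^+ k * (C * q ^+ k) by rewrite mulr_ge0// mulr_ge0// ltW.
  rewrite ler_pXn2r ?nnegrE ?hnorm_ge0//.
  by rewrite hnormZr ger0_norm// ler_wpM2l// g_le.
have [Z ZP] := ell2_combine sG.
apply: (@domvec_scale 2 Z) => // a Aa.
have bs := rep_bop srs Aa; have br := rep_bop srr Aa.
have x_le n : hnorm (rho a (x n)) <= 2 * hnorm (famp (sigma a) Z).
  have h n' : hnorm (rho a (\sum_(0 <= k < n') d k)) <=
      (2 - 2 * 2^-1 ^+ n') * hnorm (famp (sigma a) Z).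
    elim: n' => [|m IH]; first by rewrite big_nil (bop0 br) hnorm0 expr0; lra.
    rewrite big_nat_recr//= (bopD br) (le_trans (hnormD _ _))//.
    have e1 : hnorm (rho a (d m)) <= 2^-1 ^+ m * hnorm (famp (sigma a) Z).
      have := ZP _ _ bs m; rewrite (bopZ (bop_famp bs)) hnormZr ger0_norm ?exprn_ge0//.
      by rewrite -gP// exprVn ler_pdivlMl ?exprn_gt0.
    rewrite (le_trans (lerD IH e1))// -mulrDl ler_wpM2r ?hnorm_ge0// exprS.
    by lra.
  have := h n.+1; rewrite sum_d => /le_trans; apply.
  by rewrite ler_wpM2r ?hnorm_ge0// gerDl oppr_le0 mulr_ge0// exprn_ge0.
have xx : adherent [set x n | n in [set: nat]] xi.
  move=> e e0; have [N Ne] : exists N : nat, q ^+ N < e.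
    have [N Ne] := natSinv_lt e0; exists N; apply: le_lt_trans Ne.
    rewrite exprVn lef_pV2 ?posrE ?exprn_gt0 ?ltr0n// -natrX ler_nat.
    exact: ltn_expl.
  exists (x N); first by exists N.
  by case: (xP N) => _ h; exact: lt_trans h Ne.
apply: hnorm_adherent_le (bop_adherent br xx) => _ [_ [n _ <-] <-].
exact: x_le.
Qed.

Lemma domvec_span (G : set L) xi : (forall g, G g -> domvec A sigma rho g) ->
  adherent (span G) xi -> domvec A sigma rho xi.
Proof.
move=> GD Gxi; apply: domvec_adherent; apply: adherent_mono Gxi.
exact: span_sub domvec_linear GD.
Qed.

End Domvec.

(** Vectors with one nonzero coordinate are dominated and total, and the dominated vectors form a
    closed subspace. *)
Lemma dominated_famp (J : choiceType) H (A : set (H -> H)) E L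
    (sigma : (H -> H) -> E -> E) (rho : (H -> H) -> L -> L) :
  star_algebra A -> star_rep A sigma -> star_rep A rho -> dominated A sigma rho ->
  dominated A sigma (fun a => famp (J := J) (rho a)).
Proof.
move=> sA srs srr dr xi.
apply: (domvec_span sA srs (star_rep_famp J srr)) (dirac_total xi).
move=> _ [j [h ->]]; have [X hX] := dr h; exists X => a Aa.
rewrite famp_dirac ?hnorm_dirac; first exact: hX.
exact: rep_bop srr _ Aa.
Qed.

Lemma dominated_trans H (A : set (H -> H)) E K L (tau : (H -> H) -> K -> K)
    (sigma : (H -> H) -> E -> E) (rho : (H -> H) -> L -> L) :
  star_algebra A -> star_rep A tau -> star_rep A sigma ->
  dominated A tau sigma -> dominated A sigma rho -> dominated A tau rho.
Proof.
move=> sA srt srs dts dsr xi; have [X xX] := dsr xi.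
have [Y yY] := dominated_famp (J := nat) sA srt srs dts X.
by exists Y => a Aa; exact: le_trans (xX _ Aa) (yY _ Aa).
Qed.

Lemma dominated_refl H (A : set (H -> H)) L (rho : (H -> H) -> L -> L) :
  star_rep A rho -> dominated A rho rho.
Proof.
move=> sr xi; exists (ell2_dirac (H := fun=> L) (i := 0%N) xi) => a Aa.
by rewrite famp_dirac ?hnorm_dirac//; exact: rep_bop sr _ Aa.
Qed.

End Domination.

(** * Normal representations as subrepresentations of amplifications *)

Section Structure.
Variable R : realType.
Implicit Types H K L E : hilbertType R.

Lemma isometry_inner H K (T : H -> K) (S : set H) : bounded_op T -> linear_set S ->
  (forall u, S u -> hnorm (T u) = hnorm u) ->
  forall u v, S u -> S v -> inner (T u) (T v) = inner u v.
Proof.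
move=> bT lS iT.
have ReE u v : S u -> S v -> complex.Re (inner (T u) (T v)) = complex.Re (inner u v).
  move=> Su Sv; have := iT _ (linear_setD lS Su Sv) => /(congr1 (fun x => x ^+ 2)).
  by rewrite (bopD bT) !hnorm_sqD !iT// => /addrI; lra.
move=> u v Su Sv; have h1 := ReE _ _ Su Sv.
have := ReE _ _ (linear_setZ 'i%C lS Su) Sv.
rewrite (bopZ bT) !innerZl.
move: h1; case: (inner (T u) (T v)) (inner u v) => [a b] [c d]/= -> h.
by congr Complex; lra.
Qed.

Lemma bounded_extension (U : lmodType R[i]) (D : set U) H K (u : U -> H) (v : U -> K) (c : R) :
  0 <= c -> linear_set D ->
  (forall k a b, D a -> D b -> u (k *: a + b) = k *: u a + u b) ->
  (forall k a b, D a -> D b -> v (k *: a + b) = k *: v a + v b) ->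
  (forall a, D a -> hnorm (v a) <= c * hnorm (u a)) ->
  exists T : H -> K, [/\ bounded_op T, forall a, D a -> T (u a) = v a &
    forall h, hnorm (T h) <= c * hnorm (prj (u @` D) h)].
Proof.
move=> c0 lD lu lv vu.
have /choice[S SP] (z : K) : exists y, [/\ adherent (u @` D) y,
    (forall a, D a -> inner (v a) z = inner (u a) y) & hnorm y <= c * hnorm z].
  have [k a b Da Db|a Da|y [yD yP yz]] := @riesz _ U D H u (fun a => inner (v a) z) (c * hnorm z) lD lu.
  - by rewrite lv// inner_is_linear.
  - rewrite (le_trans (cauchy_schwarz _ _))// mulrAC.
    by rewrite ler_wpM2r ?hnorm_ge0// vu.
  by exists y; split=> //; apply: yz; rewrite mulr_ge0 ?hnorm_ge0.
have lA : linear_set (adherent (u @` D)).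
  apply: adherent_linear; split.
    exists 0; first by case: lD.
    have := lu (-1) 0 0; rewrite scaler0 addr0 scaleN1r.
    by move=> ->; [rewrite addNr|case: lD|case: lD].
  move=> k _ _ [a Da <-] [b Db <-]; exists (k *: a + b); last exact: lu.
  by case: lD => _; exact.
have uniq y y' : adherent (u @` D) y -> adherent (u @` D) y' ->
    (forall a, D a -> inner (u a) y = inner (u a) y') -> y = y'.
  move=> yD yD' yy; apply/eqP; rewrite -subr_eq0; apply/eqP/innerxx_eq0.
  apply: (inner_adherent0 _ (linear_setB lA yD yD')) => _ [a Da <-].
  by rewrite innerBr yy// subrr.
have bS : bounded_op S.
  apply/bounded_opP; split=> [k x y|]; last by exists c => // z; have [] := SP z.
  have [Sx xP _] := SP x; have [Sy yP _] := SP y; have [Sk kP _] := SP (k *: x + y).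
  apply: uniq => //; first by case: lA => _; exact.
  by move=> a Da; rewrite -kP// !innerDr !innerZr xP// yP.
have bT := bop_adj bS.
exists (adj S); split=> // [a Da|h].
  apply: inner_extl => z; rewrite -(adjPr bS).
  by have [_ <-] := SP z.
have -> : adj S h = adj S (prj (u @` D) h).
  apply: inner_extl => z; rewrite -!(adjPr bS) inner_conj [RHS]inner_conj.
  congr (_^*); have [Sz _ _] := SP z.
  rewrite -[X in _ = inner _ X]/(prj _ h) -proj_inner prj_id//.
  by apply: adherent_mono Sz; exact: sub_span.
apply: hnorm_adj_le => //.
by move=> z; have [] := SP z.
Qed.

Section Bessel.
Variables (H : hilbertType R) (J : choiceType) (P : J -> projection H).
Hypothesis orthP : forall i j h, i != j -> P i (P j h) = 0.

Lemma bessel (s : seq J) h : uniq s ->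
  \sum_(i <- s) hnorm (P i h) ^+ 2 <= hnorm h ^+ 2.
Proof.
suff : uniq s -> hnorm (h - \sum_(i <- s) P i h) ^+ 2 + \sum_(i <- s) hnorm (P i h) ^+ 2
    = hnorm h ^+ 2 by move=> + us => /(_ us) <-; rewrite lerDr sqr_ge0.
elim: s => [_|i s IH]; first by rewrite !big_nil subr0 addr0.
move=> /= /andP[nis us]; rewrite !big_cons -{}IH// addrA; congr (_ + _).
set r := h - \sum_(j <- s) P j h.
have Pr : P i r = P i h.
  have bP := @proj_bounded _ _ (P i).
  rewrite (bopB bP) (_ : P i (\sum_(j <- s) P j h) = 0) ?subr0//.
  have [big0 bigD] := (bop0 bP, bopD bP).
  rewrite (big_morph (P i) bigD big0) big_seq big1// => j js.
  by rewrite orthP//; apply: contraNneq nis => ->.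
have -> : h - (P i h + \sum_(j <- s) P j h) = r - P i r.
  by rewrite Pr opprD addrA addrAC.
rewrite -Pr -hnorm_sqD_orth; last first.
  by rewrite innerBl [X in _ - X]proj_inner projK subrr.
by rewrite subrK.
Qed.

End Bessel.

(** The multiplicity space is [l^2(L)] tensored with [l^2(nat)]: [nat] for the sequences of the
    predual, and the set of vectors of [L] because a cyclic decomposition of [L] is indexed by its
    own generators. *)
Definition bpow L E : hilbertType R := pow L (pow nat E).

Definition bamp L E E' (a : E -> E') : bpow L E -> bpow L E' := famp (famp a).

Lemma bop_bamp L E E' (a : E -> E') : bounded_op a -> bounded_op (bamp (L := L) a).
Proof. by move=> ba; apply/bop_famp/bop_famp. Qed.

Lemma bampE L E E' (a : E -> E') (f : bpow L E) i n : bounded_op a ->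
  bamp a f i n = a (f i n).
Proof. by move=> ba; rewrite fampE ?fampE//; exact: bop_famp. Qed.

Lemma adj_bamp L E E' (a : E -> E') : bounded_op a ->
  adj (bamp (L := L) a) = bamp (adj a).
Proof. by move=> ba; rewrite /bamp adj_famp ?adj_famp//; exact: bop_famp. Qed.

Lemma bamp_comp L E E' E'' (a : E' -> E'') (b : E -> E') :
  bounded_op a -> bounded_op b -> bamp (L := L) (a \o b) = bamp a \o bamp b.
Proof.
by move=> ba bb; rewrite /bamp (famp_comp ba bb) (famp_comp (bop_famp ba) (bop_famp bb)).
Qed.

Section StructureTheorem.
Variables (H : hilbertType R) (A : set (H -> H)) (sA : star_algebra A).
Variables (E L : hilbertType R) (sigma : (H -> H) -> E -> E) (rho : (H -> H) -> L -> L).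
Hypotheses (srs : star_rep A sigma) (srr : star_rep A rho).

Definition cyclic_orth (F : set L) : Prop :=
  forall k k' a, F k -> F k' -> k <> k' -> A a -> inner (rho a k) k' = 0.

(** Empty for [k] outside [F], so that families may be indexed by all of [L] with zero terms off
    [F]. *)
Definition orbit (F : set L) (k : L) : set L :=
  [set v | F k /\ exists2 a, A a & v = rho a k].

(** By Zorn: a nonzero vector orthogonal to all cyclic subspaces of a maximal family could be added
    to it. *)
Lemma cyclic_decomposition : exists2 F : set L, cyclic_orth F &
  forall h, (forall k, F k -> forall v, orbit F k v -> inner v h = 0) -> h = 0.
Proof.
have [FF FFP totF|F [oF maxF]] := @Zorn_bigcup L cyclic_orth.
  move=> k k' a [F1 F1F F1k] [F2 F2F F2k'] kk' Aa.
  have [F12|F21] := totF _ _ F1F F2F; first by apply: (FFP _ F2F) => //; exact: F12.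
  by apply: (FFP _ F1F) => //; exact: F21.
exists F => // h hF; apply: contrapT => h0.
have Fh : ~ F h.
  move=> Fh; apply/h0/innerxx_eq0; apply: (hF h) => //; split=> //.
  by exists idfun; [exact: sta_id sA|rewrite (rep_id srr)].
apply: (maxF (F `|` [set h])).
  by split=> [x|]; [left|move=> /(_ h)/=; apply: contra_not Fh => /(_ (or_intror erefl))].
move=> k k' a [Fk|->] [Fk'|->] kk' Aa //.
- exact: oF.
- by apply: (hF k) => //; split=> //; exists a.
- have ba := rep_bop srr Aa; rewrite (adjP ba) -(rep_adj srr)//.
  apply: inner_sym0; apply: (hF k') => //; split=> //.
  by exists (adj a) => //; exact: (sta_adj sA).
Qed.

(** On the cyclic subspace of a generator [i], the map [rho a i |-> famp (sigma a) g] is isometric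
    by [domvec_exact]. Distinct generators go to distinct coordinates of [bpow L E], which preserves
    orthogonality, and Bessel's inequality makes the coordinates square summable. *)
Theorem structure_theorem : dominated A sigma rho ->
  exists V : L -> bpow L E, [/\ bounded_op V, forall h, hnorm (V h) = hnorm h &
    forall a, A a -> V \o rho a = bamp (sigma a) \o V].
Proof.
move=> dom; have [F oF totF] := cyclic_decomposition.
pose G k := orbit F k.
have A1 := sta_id sA.
have Alin (c : R[i]) a b : A a -> A b -> A (c *: a + b) by case: (sta_linear sA) => _; apply.
have orb_other k k' a : F k -> k <> k' -> A a -> prj (G k') (rho a k) = 0.
  move=> Fk kk' Aa; apply: prj_eq0 => _ [Fk' [b Ab ->]].
  have bb := rep_bop srr Ab.
  rewrite (adjP bb) -(rep_adj srr)//; apply: inner_sym0.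
  have Ab' := sta_adj sA Ab.
  rewrite -[rho (adj b) _]/((rho (adj b) \o rho a) k) -(rep_comp srr)//.
  by apply: oF => //; apply: (sta_comp sA).
have /choice[W WP] (i : L) : exists W : L -> pow nat E, [/\ bounded_op W,
    forall h, hnorm (W h) <= hnorm (prj (G i) h),
    forall a, A a -> F i -> hnorm (W (rho a i)) = hnorm (rho a i) &
    forall a b, A a -> A b -> W (rho (a \o b) i) = famp (sigma a) (W (rho b i))].
  have [Fi|nFi] := pselect (F i); last first.
    exists 0; split=> // [|h|a b Aa Ab]; first exact: bop_cst0.
      by rewrite -[(0 : L -> _) h]/(0 : pow nat E) hnorm0 hnorm_ge0.
    by rewrite -[LHS]/(0 : pow nat E) bop0//; apply/bop_famp/(rep_bop srs).
  have [g gP] := domvec_exact sA srs srr (dom i).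
  have [//|||||W [bW Wg Wle]] := @bounded_extension _ A L (pow nat E)
    (fun a => rho a i) (fun a => famp (sigma a) g) 1.
  - exact: sta_linear sA.
  - by move=> k a b Aa Ab; rewrite (rep_lin srr).
  - move=> k a b Aa Ab; rewrite (rep_lin srs)// famp_lin//; exact: (rep_bop srs).
  - by move=> a Aa; rewrite mul1r gP.
  exists W; split=> // [h|a Aa _|a b Aa Ab].
  - rewrite (le_trans (Wle h))// mul1r le_eqVlt; apply/orP; left; apply/eqP.
    congr hnorm; congr (prj _ h); apply/seteqP; split=> [_ [a Aa <-]|_ [_ [a Aa ->]]].
      by split=> //; exists a.
    by exists a.
  - by rewrite Wg// gP.
  - rewrite !Wg//; last by apply: (sta_comp sA).
    by rewrite (rep_comp srs)// famp_comp//; exact: (rep_bop srs).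
have bW i : bounded_op (W i) by have [] := WP i.
have Wle i h : hnorm (W i h) <= hnorm (prj (G i) h) by have [] := WP i.
have orthG i j h : i != j -> prj (G i) (prj (G j) h) = 0.
  move=> /eqP ij; apply: (bop_adherent_eq0 (@proj_bounded _ _ (prj (G i))) _ (prj_span (G j) h)).
  move=> s Gs; apply: (Gs [set s | prj (G i) s = 0]); split.
    exact: linear_set_eq0 (@proj_bounded _ _ (prj (G i))).
  move=> _ [Fj [a Aa ->]]; exact: orb_other (nesym ij) Aa.
have sV h : absum (fun i => hnorm (W i h) ^+ 2) /\
    rsum (fun i => hnorm (W i h) ^+ 2) <= hnorm h ^+ 2.
  apply: rsum_le_fin => [i|s us]; first exact: sqr_ge0.
  apply: le_trans (bessel orthG h us); apply: ler_sum => i _.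
  by rewrite ler_pXn2r ?nnegrE ?hnorm_ge0.
pose V h : bpow L E := Ell2 (H := fun=> pow nat E) (proj1 (sV h)).
have VE h i : V h i = W i h by [].
have Vle h : hnorm (V h) <= hnorm h.
  rewrite -(ler_pXn2r (n:=2)) ?nnegrE ?hnorm_ge0// hnorm_ell2.
  exact: (proj2 (sV h)).
have bV : bounded_op V.
  apply/bounded_opP; split=> [k x y|].
    by apply: ell2_ext => i; rewrite ell2_addE ell2_scaleE !VE (bopP (bW i)).
  by exists 1 => // h; rewrite mul1r.
pose GG := [set v | exists k, G k v].
have totGG h : adherent (span GG) h.
  rewrite -[h](subrK (prj GG h)).
  rewrite (_ : h - prj GG h = 0) ?add0r; first exact: prj_span.
  apply: totF => k Fk v Gv; apply: prj_orth; by exists k.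
have W_other i k a : F k -> i <> k -> A a -> W i (rho a k) = 0.
  move=> Fk ik Aa; apply: hnorm_eq0; apply/eqP; rewrite eq_le hnorm_ge0 andbT.
  by rewrite (le_trans (Wle _ _))// orb_other ?hnorm0//; exact: nesym.
have V_orb k a : F k -> A a -> V (rho a k) = ell2_dirac (H := fun=> pow nat E) (i := k) (W k (rho a k)).
  move=> Fk Aa; apply: ell2_ext => i; rewrite VE.
  have [<-|ki] := eqVneq k i; first by rewrite dirac_in.
  by rewrite dirac_out// W_other//; apply/eqP; rewrite eq_sym.
have rep_orb k a b : A a -> A b -> rho a (rho b k) = rho (a \o b) k.
  by move=> Aa Ab; rewrite (rep_comp srr).
have V_GG u v : GG u -> GG v -> inner (V u) (V v) = inner u v.
  move=> [k [Fk [a Aa ->]]] [k' [Fk' [b Ab ->]]].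
  rewrite (V_orb k)// (V_orb k')// inner_dirac.
  have [kk'|kk'] := eqVneq k' k.
    subst k'; rewrite dirac_in.
    apply: (@isometry_inner _ _ (W k) [set rho c k | c in A]); first exact: bW.
    - split; first by exists 0; [case: (sta_linear sA)|rewrite (rep0 (sta_linear sA) srr)].
      move=> c _ _ [x Ax <-] [y Ay <-]; exists (c *: x + y); first exact: Alin.
      by rewrite (rep_lin srr).
    - by move=> _ [c Ac <-]; have [_ _ + _] := WP k; apply.
    - by exists a.
    - by exists b.
  rewrite dirac_out// inner0r; apply/esym/inner_sym0.
  have ba := rep_bop srr Aa; rewrite (adjPr ba) -(rep_adj srr)//.
  have Aa' := sta_adj sA Aa; apply: inner_sym0.
  rewrite rep_orb//; apply/inner_sym0/oF => //; first exact/eqP.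
  exact: (sta_comp sA).
have GG_total h : (forall v, GG v -> inner v h = 0) -> h = 0.
  by move=> hG; apply: totF => k Fk v Gv; apply: hG; exists k.
have VV h : adj V (V h) = h.
  apply: (bop_span_eq (S := adj V \o V) (T := idfun) _ _ _ (totGG h)).
  - exact: bop_comp (bop_adj bV) bV.
  - exact: bop_id.
  move=> v Gv; apply/eqP; rewrite /= -subr_eq0; apply/eqP/GG_total => u Gu.
  by rewrite innerBr -(adjP bV) V_GG// subrr.
exists V; split=> // [h|a Aa].
  by apply: hnorm_eq_inner; rewrite (adjP bV) VV.
have [ba bs] := (rep_bop srr Aa, rep_bop srs Aa).
apply/funext => h; apply: ell2_ext => i.
rewrite /= fampE; last exact: bop_famp.
apply: (bop_span_eq (S := W i \o rho a) (T := famp (sigma a) \o W i) _ _ _ (totGG h)).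
- exact: bop_comp.
- by apply: bop_comp => //; exact: bop_famp.
move=> _ [k [Fk [b Ab ->]]] /=; rewrite rep_orb//.
have [_ _ _ Wk] := WP k.
have [->|/eqP ik] := eqVneq i k; first exact: Wk.
rewrite !W_other ?bop0//; first exact: bop_famp.
exact: (sta_comp sA).
Qed.

End StructureTheorem.
End Structure.

Arguments bop_bamp {R L E E' a}.
Arguments adj_bamp {R L E E' a}.
Arguments bamp_comp {R L E E' E'' a b}.

(** * Commutants and faithful normal representations *)

Section Bicommutant.
Variable R : realType.
Implicit Types H K L E : hilbertType R.

Definition commutant H (S : set (H -> H)) : set (H -> H) :=
  [set s | bounded_op s /\ forall a, S a -> s \o a = a \o s].

(* [theta] is, up to coordinates, a direct sum of copies of the identity. *)
Definition amplification L E (theta : (L -> L) -> E -> E) : Prop :=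
  (forall T, bounded_op T -> bounded_op (theta T)) /\
  exists (I : Type) (c : I -> E -> L),
    [/\ forall i, bounded_op (c i), forall e, (forall i, c i e = 0) -> e = 0,
        forall i T, bounded_op T -> c i \o theta T = T \o c i &
        forall i T, bounded_op T -> theta T \o adj (c i) = adj (c i) \o T].

Lemma amplification_id L : amplification (id : (L -> L) -> L -> L).
Proof.
split=> //; exists unit, (fun=> idfun); split=> //.
- by move=> _; exact: bop_id.
- by move=> e /(_ tt).
- by move=> _ T bT; rewrite adj_id.
Qed.

Lemma amplification_famp (J : choiceType) L E (theta : (L -> L) -> E -> E) :
  amplification theta -> amplification (fun T => famp (J := J) (theta T)).
Proof.
move=> [bth [I [c [bc c0 cT Tc]]]]; split=> [T bT|]; first exact/bop_famp/bth.
exists (J * I)%type, (fun ji => c ji.2 \o coordf (H := fun=> E) ji.1); split.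
- by move=> [j i]; apply: bop_comp (bc i) bop_coord.
- move=> e e0; apply: ell2_ext => j; rewrite ell2_zeroE; apply: c0 => i.
  exact: (e0 (j, i)).
- move=> [j i] T bT; apply/funext => e /=.
  have /= <- := congr1 (@^~ (e j)) (cT i T bT).
  by rewrite /coordf fampE//; exact: bth.
- move=> [j i] T bT; rewrite (adj_comp (bc i) bop_coord) adj_coord/=.
  apply/funext => l /=; rewrite famp_dirac; last exact: bth.
  congr ell2_dirac.
  by rewrite -[LHS]/((theta T \o adj (c i)) l) Tc.
Qed.

Lemma amplification_bamp M L : amplification (bamp (L := M) (E := L) (E' := L)).
Proof.
exact: (@amplification_famp M L _ (fun T => famp T)
  (@amplification_famp nat L _ id (amplification_id L))).
Qed.

Lemma amplification_bamp2 M M' L :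
  amplification (fun T : L -> L => bamp (L := M) (bamp (L := M') T)).
Proof.
exact: (@amplification_famp M L _ (fun T => famp (bamp T))
  (@amplification_famp nat L _ (fun T => bamp T) (amplification_bamp M' L))).
Qed.

Lemma ampl_total L E (I : Type) (c : I -> E -> L) :
  (forall i, bounded_op (c i)) -> (forall e, (forall i, c i e = 0) -> e = 0) ->
  forall e, adherent (span [set v | exists i l, v = adj (c i) l]) e.
Proof.
move=> bc c0 e; set G := [set v | _]; rewrite -[e](subrK (prj G e)).
suff -> : e - prj G e = 0 by rewrite add0r; exact: prj_span.
apply: c0 => i; apply: inner_extr => l; rewrite inner0r.
rewrite (adjPr (bc i)); apply: (@prj_orth _ _ G); by exists i, l.
Qed.

(** The matrix entries [c' i' \o Q \o adj (c i)] of an intertwiner lie in the commutant of [S], so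
    they commute with [T]; totality of the coordinates reassembles [Q]. *)
Lemma ampl_commute L E E' (theta : (L -> L) -> E -> E) (theta' : (L -> L) -> E' -> E')
    (S : set (L -> L)) (T : L -> L) (Q : E -> E') :
  amplification theta -> amplification theta' -> S `<=` @bounded_op R L L ->
  bounded_op T -> bounded_op Q ->
  (forall s, commutant S s -> s \o T = T \o s) ->
  (forall s, S s -> Q \o theta s = theta' s \o Q) -> Q \o theta T = theta' T \o Q.
Proof.
move=> [bth [I [c [bc c0 cT Tc]]]] [bth' [I' [c' [bc' c0' cT' Tc']]]] bS bT bQ comT QS.
apply/funext => e; apply/eqP; rewrite -subr_eq0; apply/eqP/c0' => i'.
apply/eqP; rewrite (bopB (bc' i')) subr_eq0; apply/eqP.
have -> : c' i' ((theta' T \o Q) e) = T (c' i' (Q e)).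
  by rewrite -[LHS]/((c' i' \o theta' T) (Q e)) cT'.
apply: (bop_span_eq (S := c' i' \o (Q \o theta T)) (T := T \o (c' i' \o Q))
  _ _ _ (ampl_total bc c0 e)).
- by apply: bop_comp => //; apply: bop_comp => //; exact: bth.
- by apply: bop_comp => //; exact: bop_comp.
move=> _ [i [l ->]] /=.
have -> : theta T (adj (c i) l) = adj (c i) (T l).
  by rewrite -[LHS]/((theta T \o adj (c i)) l) Tc.
pose s := c' i' \o Q \o adj (c i).
suff : commutant S s by move=> /comT/(congr1 (@^~ l)).
split=> [|a Sa].
  by apply: bop_comp (bop_adj (bc i)); exact: bop_comp.
apply/funext => x; rewrite /s /=.
have -> : adj (c i) (a x) = theta a (adj (c i) x).
  by rewrite -[RHS]/((theta a \o adj (c i)) x) Tc//; exact: bS.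
rewrite -[Q (theta a _)]/((Q \o theta a) (adj (c i) x)) QS//=.
by rewrite -[LHS]/((c' i' \o theta' a) (Q (adj (c i) x))) cT'//; exact: bS.
Qed.

Record vna H (A : set (H -> H)) : Prop := {
  vna_star : star_algebra A ;
  vna_closed : wclosure A `<=` A
}.

(** Von Neumann's argument in an amplification: the projection onto the closure of the vectors
    [famp a X] commutes with each [famp a], hence with [famp T]. So [famp T X] is in that closure,
    to which [Y] is orthogonal. *)
Theorem bicommutant H (A : set (H -> H)) (T : H -> H) : vna A -> bounded_op T ->
  (forall s, commutant A s -> s \o T = T \o s) -> A T.
Proof.
move=> [sA cA] bT comT; have bA := sta_bop sA.
apply/cA/(wclosureP _ (sta_linear sA) bA); split=> // X Y XY.
pose G := [set famp a X | a in A].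
have PG (a : H -> H) : A a -> prj G \o famp a = famp a \o prj G.
  move=> Aa; have ba := bA _ Aa; apply/funext => f /=.
  have inv b : A b -> forall h, prj G (famp b (prj G h)) = famp b (prj G h).
    move=> Ab h; apply: prj_id; apply: (bop_span (bop_famp (bA _ Ab)) _ (prj_span G h)).
    move=> _ [c Ac <-]; apply: adherent_sub; apply: sub_span.
    exists (b \o c); first exact: (sta_comp sA).
    by rewrite (famp_comp (bA _ Ab) (bA _ Ac)).
  apply: (@proj_commute _ _ (prj G)); [exact: bop_famp|exact: inv|].
  by rewrite (adj_famp ba); apply/inv/(sta_adj sA).
have PT : prj G \o famp T = famp T \o prj G.
  apply: (ampl_commute (S := A) (theta := fun T => famp T) (theta' := fun T => famp T)) => //.
  - by apply: amplification_famp; exact: amplification_id.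
  - by apply: amplification_famp; exact: amplification_id.
  - exact: proj_bounded.
have X_G : prj G X = X.
  by apply: prj_gen; exists idfun; [exact: sta_id sA|rewrite famp_id].
have Y_G : prj G Y = 0 by apply: prj_eq0 => _ [a Aa <-]; exact: XY.
have -> : famp T X = prj G (famp T X).
  by rewrite -{1}X_G -[LHS]/((famp T \o prj G) X) -PT.
by rewrite proj_inner Y_G inner0r.
Qed.

Lemma wclosure_commutant H (S : set (H -> H)) (T : H -> H) :
  linear_set S -> S `<=` @bounded_op R H H -> wclosure S T ->
  forall s, commutant S s -> s \o T = T \o s.
Proof.
move=> lS bS /(wclosureP _ lS bS)[bT TS] s [bs sS].
apply/funext => x; apply: inner_extl => y /=.
(* With these vectors the normal functional at [a] is the inner product of [s (a x) - a (s x)] with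
   [y]; its vanishing on [S] passes to [T]. *)
pose X : pow nat H := ell2_dirac (H := fun=> H) (i := 0%N) x -
  ell2_dirac (H := fun=> H) (i := 1%N) (s x).
pose Y : pow nat H := ell2_dirac (H := fun=> H) (i := 0%N) (adj s y) +
  ell2_dirac (H := fun=> H) (i := 1%N) y.
have E a : bounded_op a -> inner (famp a X) Y = inner (s (a x)) y - inner (a (s x)) y.
  move=> ba; rewrite (bopB (bop_famp ba)) !famp_dirac// innerBl !inner_dirac.
  by rewrite !ell2_addE !dirac_in !dirac_out// addr0 add0r -(adjP bs).
apply/eqP; rewrite -subr_eq0 -E//; apply/eqP/TS => a Sa; rewrite E; last exact: bS.
by rewrite -[s (a x)]/((s \o a) x) sS// subrr.
Qed.

Record frep H (A : set (H -> H)) L (pi : (H -> H) -> L -> L) : Prop := {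
  fr_rep : star_rep A pi ;
  fr_inj : forall a, A a -> pi a = 0 -> a = 0 ;
  fr_dom : dominated A id pi
}.

(* The vectors dominated by [pi] span a closed subspace invariant under [A] and
   its commutant, so the complementary projection [p] lies in [A]. If [p] were not
   [0] then [pi p] would not be either, and a vector functional of [pi] in the
   range of [pi p] would produce a nonzero dominated vector in the range of [p]. *)
Theorem frep_inverse_dominated H (A : set (H -> H)) L (pi : (H -> H) -> L -> L) :
  vna A -> frep A pi -> dominated A pi id.
Proof.
move=> vA [srp injp domp]; have sA := vna_star vA; have sri := star_rep_id sA.
have bA := sta_bop sA.
pose D : set H := domvec A pi id; pose P := prj D.
have DP h : D (P h).
  apply: (domvec_span sA srp sri _ (prj_span D h)).
  by [].
have DA a h : A a -> D h -> D (a h).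
  move=> Aa [X hX]; exists (famp (pi a) X) => b Ab.
  have := hX _ (sta_comp sA Ab Aa); rewrite (rep_comp srp)// famp_comp//;
    exact: (rep_bop srp).
have DA' s h : commutant A s -> D h -> D (s h).
  move=> [bs sA'] [X hX]; have [c c0 sc] := bop_bound bs.
  apply: (domvec_scale srp c0 (X := X)) => a Aa.
  rewrite -[id a (s h)]/((a \o s) h) -sA'// (le_trans (sc _))// ler_wpM2l//.
  exact: hX.
have P_id h : D h -> P h = h by move=> Dh; exact: prj_gen.
have adjA' s : commutant A s -> commutant A (adj s).
  move=> [bs sA']; split=> [|a Aa]; first exact: bop_adj.
  have ba := bA _ Aa; have Aa' := sta_adj sA Aa; have ba' := bop_adj ba.
  by rewrite -{1}(adjK ba) -adj_comp// -sA'// adj_comp// adjK.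
have PA a : A a -> P \o a = a \o P.
  move=> Aa; apply/funext => h /=; apply: (@proj_commute _ _ P); first exact: bA.
    by move=> k; apply/P_id/DA.
  by move=> k; apply/P_id/DA => //; exact: (sta_adj sA).
have PA' s : commutant A s -> P \o s = s \o P.
  move=> sA'; apply/funext => h /=; apply: (@proj_commute _ _ P); first by case: sA'.
    by move=> k; apply/P_id/DA'.
  by move=> k; apply/P_id/DA' => //; exact: adjA'.
pose p : H -> H := idfun - (P : H -> H).
have pE h : p h = h - P h by [].
have bP : bounded_op P := @proj_bounded _ _ P.
have bp : bounded_op p.
  exact: (linear_setB (bop_linear_set H H) (@bop_id _ H) bP).
have Ap : A p.
  apply: bicommutant => // s sA'; apply/funext => h /=; rewrite !pE.
  have [bs _] := sA'; rewrite (bopB bs); congr (_ - _).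
  by rewrite -[LHS]/((s \o P) h) -PA'.
have pp : p \o p = p.
  apply/funext => h /=; rewrite [LHS]pE pE (bopB bP).
  by rewrite projK subrr subr0.
suff p0 : p = 0.
  move=> h; have : D (P h) by [].
  by have -> : P h = h by apply/eqP; rewrite eq_sym -subr_eq0 -pE p0.
apply: injp => //; apply/funext => xi0; apply: contrapT.
set xi := pi p xi0 => xi_neq0.
have xip : pi p xi = xi by rewrite /xi -[LHS]/((pi p \o pi p) xi0) -(rep_comp srp)// pp.
have [X hX] := domp xi.
have srf := star_rep_famp nat sri.
pose f a := inner (pi a xi) xi.
have fE a : A a -> f (adj a \o a) = (hnorm (pi a xi) ^+ 2)%:C%C.
  by move=> Aa; rewrite /f (rep_sqE _ sA srp Aa).
have pf : posfun A f.
  split=> [c a b Aa Ab|a Aa]; last by rewrite fE// ler0c sqr_ge0.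
  by rewrite /f (rep_lin srp)// fun_linE inner_is_linear.
(* As [pi p] fixes [xi], the bound for [a \o p] at [xi] is a bound for [a] with [famp p X] in place
   of [X]. *)
have fdom : pf_dom A (fun a => famp (id a)) (famp p X) f.
  move=> a Aa; rewrite fE//= ler_pXn2r ?nnegrE ?hnorm_ge0//.
  rewrite -[famp a (famp p X)]/((famp a \o famp p) X) -(famp_comp (bA _ Aa) bp).
  have := hX _ (sta_comp sA Aa Ap); rewrite (rep_comp srp)//=.
  by rewrite xip.
have [y [yA fy yle]] := pf_vector sA srf pf fdom.
have py : famp p y = y.
  apply: (bop_span_eq (T := idfun) (bop_famp bp) (bop_id _) _ yA) => _ [a Aa <-].
  have ba := bA _ Aa.
  apply: ell2_ext => n; rewrite !fampE//=.
  have : p (a (p (X n))) = a (p (p (X n))).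
    move: (p (X n)) => x; rewrite [LHS]pE [p x]pE (bopB ba); congr (_ - _).
    by rewrite -[LHS]/((P \o a) _) PA.
  by move=> ->; rewrite -[p (p _)]/((p \o p) _) pp.
(* Each [y n] is a dominated vector, by [|a (y n)| <= |famp a y| <= |pi a xi|], hence fixed by [P];
   it is fixed by the complement [p] as well, so it vanishes. *)
have y0 : y = 0.
  apply: ell2_ext => n; rewrite ell2_zeroE -py fampE//.
  suff Dy : D (y n) by rewrite pE P_id// subrr.
  exists (ell2_dirac (H := fun=> L) (i := 0%N) xi) => a Aa.
  rewrite famp_dirac ?hnorm_dirac; last exact: (rep_bop srp).
  apply: (@le_trans _ _ (hnorm (famp a y))).
    by have := hnorm_coord (famp a y) n; rewrite fampE//; exact: bA.
  have := yle _ Aa; rewrite fE//= ler_pXn2r ?nnegrE ?hnorm_ge0//.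
apply: xi_neq0; apply: innerxx_eq0.
have := fy _ (sta_id sA); rewrite y0 inner0r /f (rep_id srp).
by [].
Qed.

End Bicommutant.

Section FaithfulRepresentations.
Variable R : realType.
Implicit Types H K L E : hilbertType R.

Lemma star_algebra_lin H (A : set (H -> H)) (c : R[i]) a b :
  star_algebra A -> A a -> A b -> A (c *: a + b).
Proof. by move=> sA; case: (sta_linear sA) => _; apply. Qed.

Lemma star_algebraZ H (A : set (H -> H)) (c : R[i]) a :
  star_algebra A -> A a -> A (c *: a).
Proof. by move=> sA Aa; exact: linear_setZ (sta_linear sA) Aa. Qed.

Lemma repZ H (A : set (H -> H)) L (rho : (H -> H) -> L -> L) (c : R[i]) a :
  star_algebra A -> star_rep A rho -> A a -> rho (c *: a) = c *: rho a.
Proof.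
move=> sA sr Aa; have [A0 _] := sta_linear sA.
by rewrite -[X in rho X]addr0 (rep_lin sr)// (rep0 (sta_linear sA) sr) addr0.
Qed.

Lemma frep_id H (A : set (H -> H)) : star_algebra A -> frep A id.
Proof.
move=> sA; split=> //; first exact: star_rep_id.
exact/dominated_refl/star_rep_id.
Qed.

Lemma frep_injE H (A : set (H -> H)) L (pi : (H -> H) -> L -> L) a b :
  star_algebra A -> frep A pi -> A a -> A b -> pi a = pi b -> a = b.
Proof.
move=> sA [sr ir _] Aa Ab ab; apply/eqP; rewrite -subr_eq0 addrC -scaleN1r.
apply/eqP/ir; first exact: star_algebra_lin.
by rewrite (rep_lin sr)// ab scaleN1r addNr.
Qed.

Lemma frep_dominated H (A : set (H -> H)) L K (pi : (H -> H) -> L -> L)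
    (rho : (H -> H) -> K -> K) : vna A -> frep A pi -> dominated A id rho ->
  dominated A pi rho.
Proof.
move=> vA fp; have sA := vna_star vA.
apply: (dominated_trans sA (fr_rep fp) (star_rep_id sA)).
exact: frep_inverse_dominated.
Qed.

Lemma frep_embed H (A : set (H -> H)) L K (pi : (H -> H) -> L -> L)
    (rho : (H -> H) -> K -> K) : vna A -> frep A pi -> star_rep A rho ->
  dominated A id rho ->
  exists V : K -> bpow K L, [/\ bounded_op V, forall h, hnorm (V h) = hnorm h &
    forall a, A a -> V \o rho a = bamp (pi a) \o V].
Proof.
move=> vA fp sr dr; have sA := vna_star vA.
exact: (structure_theorem sA (fr_rep fp) sr (frep_dominated vA fp dr)).
Qed.

Lemma star_algebra_image H (A : set (H -> H)) L (pi : (H -> H) -> L -> L) :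
  star_algebra A -> star_rep A pi -> star_algebra (pi @` A).
Proof.
move=> sA sr; split.
- split; first by exists 0; [case: (sta_linear sA)|exact: rep0 (sta_linear sA) sr].
  move=> c _ _ [a Aa <-] [b Ab <-]; exists (c *: a + b); first exact: star_algebra_lin.
  by rewrite (rep_lin sr).
- by move=> _ [a Aa <-]; exact: (rep_bop sr).
- move=> _ _ [a Aa <-] [b Ab <-]; exists (a \o b); first exact: (sta_comp sA).
  by rewrite (rep_comp sr).
- by exists idfun; [exact: sta_id sA|exact: rep_id sr].
- move=> _ [a Aa <-]; exists (adj a); first exact: (sta_adj sA).
  by rewrite (rep_adj sr).
Qed.

Lemma isometry_adjK H K (V : H -> K) : bounded_op V ->
  (forall h, hnorm (V h) = hnorm h) -> forall h, adj V (V h) = h.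
Proof.
move=> bV iV h; apply: inner_extr => z; rewrite -(adjP bV).
by apply: (@isometry_inner _ _ _ V setT) => // u _; exact: iV.
Qed.

(** Embeddings exist both ways: [W] of the identity representation in an amplification of [pi], and
    [V] of [pi] in an amplification of the identity. The first pulls a limit [T] back to an element
    of [A], the second shows that [pi] sends this element to [T]. *)
Theorem frep_image_vna H (A : set (H -> H)) L (pi : (H -> H) -> L -> L) :
  vna A -> frep A pi -> vna (pi @` A).
Proof.
move=> vA fp; have [srp injp domp] := fp; have sA := vna_star vA.
have sI := star_algebra_image sA srp; split=> // T cT.
have bI := sta_bop sI.
have bT : bounded_op T by case: cT.
have comT := wclosure_commutant (sta_linear sI) bI cT.
have [W [bW iW WE]] := frep_embed vA fp (star_rep_id sA) (fr_dom (frep_id sA)).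
have [V [bV iV VE]] := structure_theorem sA (star_rep_id sA) srp domp.
have WK := isometry_adjK bW iW.
have com (Q : bpow H L -> bpow H L) : bounded_op Q ->
    (forall a, A a -> Q \o bamp (pi a) = bamp (pi a) \o Q) -> Q \o bamp T = bamp T \o Q.
  move=> bQ Qa; apply: (ampl_commute (amplification_bamp H L) (amplification_bamp H L) bI bT bQ comT).
  by move=> _ [a Aa <-]; exact: Qa.
have aW a : A a -> adj W \o bamp (pi a) = a \o adj W.
  move=> Aa; have Aa' := sta_adj sA Aa; have ba := sta_bop sA Aa.
  have := congr1 (@adj _ _ _) (WE _ Aa').
  rewrite (adj_comp bW (bop_adj ba)) (adjK ba).
  have bp' := rep_bop srp Aa'.
  by rewrite (adj_comp (bop_bamp bp') bW) (adj_bamp bp') -(rep_adj srp Aa') (adjK ba).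
(* The preimage of [T]. Since [W \o adj W] and [W \o s \o adj W], for [s] in the commutant of [A],
   commute with the amplification of [pi], they commute with that of [T]; so [a0] is in the
   bicommutant and [W] intertwines it with [bamp T]. *)
pose a0 := adj W \o bamp T \o W.
have ba0 : bounded_op a0 by apply: bop_comp => //; apply: bop_comp (bop_adj bW) (bop_bamp bT).
have WW : W \o adj W \o bamp T = bamp T \o (W \o adj W).
  apply: com; first exact: bop_comp bW (bop_adj bW).
  move=> a Aa; apply/funext => e /=; rewrite -[adj W _]/((adj W \o bamp (pi a)) e) aW//.
  by rewrite -[LHS]/((W \o a) (adj W e)) WE.
have Aa0 : A a0.
  apply: bicommutant => // s [bs sA'].
  apply/funext => h; rewrite /a0 /=.
  have key : (W \o s \o adj W) \o bamp T = bamp T \o (W \o s \o adj W).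
    apply: com; first by apply: bop_comp (bop_adj bW); exact: bop_comp.
    move=> a Aa; apply/funext => e /=.
    rewrite -[adj W _]/((adj W \o bamp (pi a)) e) aW//=.
    rewrite -[s (a _)]/((s \o a) (adj W e)) sA'//=.
    by rewrite -[LHS]/((W \o a) _) WE.
  have := congr1 (@^~ (W h)) key; rewrite /= WK => <-.
  by rewrite WK.
have Wa0 : W \o a0 = bamp T \o W.
  apply/funext => h; rewrite /a0 /=.
  by have := congr1 (@^~ (W h)) WW; rewrite /= WK.
exists a0 => //.
(* [Q] embeds the space of [pi] in a double amplification of itself and intertwines [pi], hence [T];
   on the other hand it carries [pi a0] to the double amplification of [T]. *)
pose Q : L -> bpow L (bpow H L) := bamp W \o V.
have bQ : bounded_op Q by apply: bop_comp => //; exact: bop_bamp.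
have QT : Q \o T = bamp (bamp T) \o Q.
  apply: (ampl_commute (amplification_id L) (amplification_bamp2 L H L) bI bT bQ comT).
  move=> _ [a Aa <-]; have ba := sta_bop sA Aa; have bpa := rep_bop srp Aa.
  have Wa : bamp (L := L) W \o bamp a = bamp (bamp (pi a)) \o bamp W.
    rewrite -(bamp_comp bW ba) (WE _ Aa).
    exact: (bamp_comp (bop_bamp bpa) bW).
  apply/funext => l; have /= Vl := congr1 (@^~ l) (VE _ Aa).
  rewrite -[LHS]/(bamp W (V (pi a l))) Vl.
  exact: (congr1 (@^~ (V l)) Wa).
have bpa0 := rep_bop srp Aa0.
apply/funext => l.
have Qinj x y : Q x = Q y -> x = y.
  move=> Qxy; rewrite -(isometry_adjK bV iV x) -(isometry_adjK bV iV y); congr (adj V _).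
  apply: ell2_ext => i; apply: ell2_ext => n.
  rewrite -(WK (V x i n)) -(WK (V y i n)); congr (adj W _).
  by rewrite -!(bampE _ _ _ bW) -[LHS]/(Q x i n) Qxy.
apply: Qinj.
have Wa : bamp (L := L) W \o bamp a0 = bamp (bamp T) \o bamp W.
  rewrite -(bamp_comp bW ba0) Wa0.
  exact: (bamp_comp (bop_bamp bT) bW).
rewrite -[RHS]/((Q \o T) l) QT; have /= Vl := congr1 (@^~ l) (VE _ Aa0).
rewrite -[LHS]/(bamp W (V (pi a0 l))) Vl.
exact: (congr1 (@^~ (V l)) Wa).
Qed.

Lemma hnorm_bamp_le M E E' (T : E -> E') (c : R) (f : bpow M E) : bounded_op T ->
  0 <= c -> (forall x, hnorm (T x) <= c * hnorm x) -> hnorm (bamp T f) <= c * hnorm f.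
Proof.
move=> bT c0 Tc; apply: hnorm_amp_le => // [|j x]; first exact/ubop_cst/bop_famp.
by apply: hnorm_amp_le => //; exact: ubop_cst.
Qed.

Lemma embed_norm_le H (A : set (H -> H)) L K (pi : (H -> H) -> L -> L)
    (rho : (H -> H) -> K -> K) (V : K -> bpow K L) a (c : R) :
  (forall h, hnorm (V h) = hnorm h) ->
  (forall a, A a -> V \o rho a = bamp (pi a) \o V) -> star_rep A pi -> A a -> 0 <= c ->
  (forall x, hnorm (pi a x) <= c * hnorm x) -> forall x, hnorm (rho a x) <= c * hnorm x.
Proof.
move=> iV VE srp Aa c0 ac x.
rewrite -[in leLHS]iV -[V _]/((V \o rho a) x) VE//= -(iV x).
by apply: hnorm_bamp_le => //; exact: (rep_bop srp).
Qed.

Lemma frep_norm_le H (A : set (H -> H)) L K (pi : (H -> H) -> L -> L)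
    (rho : (H -> H) -> K -> K) a (c : R) : vna A -> frep A pi -> frep A rho -> A a ->
  0 <= c -> (forall x, hnorm (pi a x) <= c * hnorm x) ->
  forall x, hnorm (rho a x) <= c * hnorm x.
Proof.
move=> vA fp [srr _ dr] Aa c0 ac; have [V [_ iV VE]] := frep_embed vA fp srr dr.
exact: embed_norm_le iV VE (fr_rep fp) Aa c0 ac.
Qed.

Lemma inner_famp_ge0 (J : choiceType) E (T : E -> E) (f : pow J E) : bounded_op T ->
  positive_op T -> 0 <= inner (famp T f) f.
Proof.
move=> bT T0; rewrite -[inner _ _]/(csum (fun j => inner (famp T f j) (f j))).
have T0j j : 0 <= inner (famp T f j) (f j) by rewrite fampE.
rewrite /csum lecE/= rsum_ge0 ?andbT => [|j]; last first.
  by have := T0j j; rewrite lecE => /andP[].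
rewrite (_ : (fun j => _) = (fun=> 0)) ?rsum0//.
by apply/funext => j; exact: ger0_Im.
Qed.

(** Positivity may be read in any faithful normal representation, as [rho a] is a compression of an
    amplification of [pi a]. *)
Lemma frep_positive H (A : set (H -> H)) L K (pi : (H -> H) -> L -> L)
    (rho : (H -> H) -> K -> K) a : vna A -> frep A pi -> frep A rho -> A a ->
  positive_op (pi a) -> positive_op (rho a).
Proof.
move=> vA fp [srr _ dr] Aa a0 x; have [V [bV iV VE]] := frep_embed vA fp srr dr.
rewrite -(isometry_adjK bV iV (rho a x)) -(adjPr bV) -[V (rho a x)]/((V \o rho a) x).
have ba := rep_bop (fr_rep fp) Aa.
rewrite VE//= inner_conj conjC_ge0 inner_conj conjC_ge0.
by apply: inner_famp_ge0 => [|f]; [exact: bop_famp|exact: inner_famp_ge0].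
Qed.

(* In bipolar form: the range projection of [J] lies in the w*-closure of its span. *)
Theorem unit_limit H (J : set (H -> H)) (X Y : pow nat H) :
  J `<=` @bounded_op R H H -> (forall a b, J a -> J b -> J (a \o b)) ->
  (forall a, J a -> J (adj a)) ->
  (forall j, J j -> inner (famp j X) Y = 0) ->
  inner (famp (prj [set v | exists2 j, J j & exists h, v = j h]) X) Y = 0.
Proof.
move=> bJ JJ Ja JXY; set G := [set v | _]; set e := prj G.
have be : bounded_op e := @proj_bounded _ _ e.
have ej j h : J j -> e (j h) = j h by move=> Jj; apply: prj_gen; exists j => //; exists h.
have je j h : J j -> j (e h) = j h.
  move=> Jj; have bj := bJ _ Jj; apply: inner_extl => z.
  by rewrite !(adjP bj) proj_inner ej//; exact: Ja.
pose GX := [set famp j X | j in J].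
(* [f] is orthogonal to all [famp j X]. Each [famp j f] lies in their closed span and is orthogonal
   to it, so [J] kills [f]; but [f] is also in the range of [famp e], hence [0]. *)
pose u := prj GX (famp e X); pose f := famp e X - u.
have famp_GX j : J j -> adherent (span GX) (famp j f).
  move=> Jj; have bj := bJ _ Jj; rewrite /f (bopB (bop_famp bj)).
  apply: (linear_setB (adherent_linear (span_linear GX))).
    have -> : famp j (famp e X) = famp j X.
      by apply: ell2_ext => n; rewrite !fampE//= je.
    by apply: adherent_sub; apply: sub_span; exists j.
  apply: (bop_span (bop_famp bj) _ (prj_span GX _)) => _ [k Jk <-].
  apply: adherent_sub; apply: sub_span; exists (j \o k); first exact: JJ.
  by rewrite (famp_comp bj (bJ _ Jk)).
have fj0 j : J j -> famp j f = 0.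
  move=> Jj; apply: innerxx_eq0; apply: (inner_span0 _ (famp_GX _ Jj)) => _ [k Jk <-].
  have [bj bk] := (bJ _ Jj, bJ _ Jk).
  rewrite (adjPr (bop_famp bj)) (adj_famp bj) -[famp (adj j) _]/((famp (adj j) \o famp k) X).
  rewrite -(famp_comp (bop_adj bj) bk); apply: prj_orth.
  by exists (adj j \o k) => //; apply: JJ => //; exact: Ja.
have ef : famp e f = f.
  rewrite /f (bopB (bop_famp be)); congr (_ - _).
    by apply: ell2_ext => n; rewrite !fampE// projK.
  apply: (bop_span_eq (T := idfun) (bop_famp be) (bop_id _) _ (prj_span GX _)) => _ [k Jk <-].
  by apply: ell2_ext => n; rewrite !fampE//; [exact: ej|exact: bJ].
have f0 : f = 0.
  rewrite -ef; apply: ell2_ext => n; rewrite fampE//; apply: prj_eq0 => _ [j Jj [h ->]].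
  have bj := bJ _ Jj; rewrite (adjP bj).
  have := congr1 (fun g : pow nat H => g n) (fj0 _ (Ja _ Jj)).
  by rewrite fampE => [->|]; [rewrite inner0r|exact: bop_adj].
have -> : famp e X = u by apply/eqP; rewrite -subr_eq0 -/f f0.
by apply: (inner_span0 _ (prj_span GX _)) => _ [j Jj <-]; exact: JXY.
Qed.

Lemma unit_mem H (A J : set (H -> H)) : vna A -> J `<=` A ->
  (forall a b, J a -> J b -> J (a \o b)) -> (forall a, J a -> J (adj a)) ->
  A (prj [set v | exists2 j, J j & exists h, v = j h]).
Proof.
move=> vA JA JJ Ja; have sA := vna_star vA; have bA := sta_bop sA.
apply/(vna_closed vA)/(wclosureP _ (sta_linear sA) bA); split; first exact: proj_bounded.
move=> X Y XY; apply: unit_limit => // j /JA; [exact: bA|exact: XY].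
Qed.

End FaithfulRepresentations.

(** * Completely isometric weak-star continuous homomorphisms versus faithful normal
    representations *)

Section WeakStarHomomorphisms.
Variable R : realType.
Implicit Types H K L E : hilbertType R.

(** Each vector [S (X n)] is matched exactly by some [g n] of norm at most [d |X n|], so all of them
    fit into one vector [Z]; then [|famp (f a) X| <= c |famp a Z|], and Riesz represents the
    functional on [A] as a normal one. *)
Lemma wcontinuous_crit H (A : set (H -> H)) L K K' (rho : (H -> H) -> L -> L)
    (f : (H -> H) -> K -> K') (S : K -> L) (c d : R) :
  star_algebra A -> star_rep A rho -> dominated A id rho ->
  (forall a, A a -> bounded_op (f a)) ->
  (forall (k : R[i]) a b, A a -> A b -> f (k *: a + b) = k *: f a + f b) ->
  0 <= c -> 0 <= d -> (forall x, hnorm (S x) <= d * hnorm x) ->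
  (forall a, A a -> forall x, hnorm (f a x) <= c * hnorm (rho a (S x))) ->
  wcontinuous_on A f.
Proof.
move=> sA sr dr bf lf c0 d0 Sd fc; have bA := sta_bop sA; have sri := star_rep_id sA.
apply: dominated_wcontinuous => // X Y.
have /choice[g gP] (n : nat) : exists g : pow nat H, forall a, A a ->
    hnorm (rho a (S (X n))) = hnorm (famp a g).
  by have := domvec_exact sA sri sr (dr (S (X n))).
have g_le n : hnorm (g n) <= d * hnorm (X n).
  have := gP n _ (sta_id sA); rewrite (rep_id sr) famp_id => <-; exact: Sd.
have sg : absum (fun n => hnorm (g n) ^+ 2).
  apply: (@absum_le _ _ _ (fun n => d ^+ 2 * hnorm (X n) ^+ 2)) => [n|].
    by rewrite ger0_norm ?sqr_ge0// -exprMn ler_pXn2r ?nnegrE ?mulr_ge0 ?hnorm_ge0.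
  exact/absumZ/coordP.
pose G : pow nat (pow nat H) := Ell2 (H := fun=> pow nat H) sg.
have [Z ZP] := flatten_ell2 G.
have fZ a : A a -> hnorm (famp (f a) X) <= c * hnorm (famp a Z).
  move=> Aa; have ba := bA _ Aa; rewrite (ZP _ _ ba).
  apply: hnorm_ell2_le => // n; rewrite fampE; last exact: bf.
  rewrite fampE; last exact: bop_famp.
  by rewrite -[G n]/(g n) -gP//; exact: fc.
have [k a b Aa Ab|k a b Aa Ab|a Aa|y [_ fy _]] := @riesz _ _ A _ (fun a => famp a Z)
    (fun a => inner (famp (f a) X) Y) (c * hnorm Y) (sta_linear sA).
- by rewrite famp_lin//; exact: bA.
- rewrite lf// famp_lin; [|exact: bf|exact: bf].
  by rewrite fun_linE inner_is_linear.
- rewrite (le_trans (cauchy_schwarz _ _))// mulrAC.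
  by rewrite ler_wpM2r ?hnorm_ge0// fZ.
by exists Z, y.
Qed.

(** The homogeneous form of an upper bound for the set whose supremum is [mx_opnorm]; bounds
    transfer between representations more easily than a supremum. *)
Definition mx_bound H K n (a : 'M[H -> K]_n) (N : R) : Prop := forall x : 'I_n -> H,
  \sum_(i < n) hnorm (\sum_(j < n) a i j (x j)) ^+ 2 <= N ^+ 2 * \sum_(j < n) hnorm (x j) ^+ 2.

Let mx_values H K n (a : 'M[H -> K]_n) : set R :=
  [set Num.sqrt (\sum_(i < n) hnorm (\sum_(j < n) a i j (x j)) ^+ 2) |
    x in [set x : 'I_n -> H | \sum_(j < n) hnorm (x j) ^+ 2 <= 1]].

Let sum_sq_ge0 H n (x : 'I_n -> H) : 0 <= \sum_(j < n) hnorm (x j) ^+ 2.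
Proof. by apply: sumr_ge0 => i _; exact: sqr_ge0. Qed.

Lemma mx_bound_ubound H K n (a : 'M[H -> K]_n) (N : R) :
  (forall i j, bounded_op (a i j)) -> 0 <= N ->
  mx_bound a N <-> ubound (mx_values a) N.
Proof.
move=> ba N0; split=> [aN _ [x x1 <-]|aN x].
  rewrite -(ler_pXn2r (n:=2)) ?nnegrE ?sqrtr_ge0// sqr_sqrtr//.
  rewrite (le_trans (aN x))// -[leRHS]mulr1 ler_wpM2l ?sqr_ge0//.
have [x0|x0] := eqVneq (\sum_(j < n) hnorm (x j) ^+ 2) 0.
  have xj0 j : x j = 0.
    apply/hnorm_eq0/eqP; rewrite -sqrf_eq0; apply/eqP.
    by move/eqP: x0; rewrite psumr_eq0 => [/allP/(_ j)|i _];
      [rewrite mem_index_enum => /(_ isT)/eqP|exact: sqr_ge0].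
  rewrite x0 mulr0 big1// => i _; rewrite big1 ?hnorm0 ?expr0n// => j _.
  by rewrite xj0 (bop0 (ba i j)).
set s := \sum_(j < n) hnorm (x j) ^+ 2 in x0 *.
have s0 : 0 < s by rewrite lt_neqAle eq_sym x0 sum_sq_ge0.
pose r := (Num.sqrt s)^-1.
have r0 : 0 < r by rewrite invr_gt0 sqrtr_gt0.
have rs : r ^+ 2 * s = 1 by rewrite exprVn sqr_sqrtr ?(ltW s0)// mulVf.
have sc H' (y : H') : hnorm (r%:C%C *: y) ^+ 2 = r ^+ 2 * hnorm y ^+ 2.
  by rewrite hnormZr exprMn real_normK ?num_real.
have := aN (Num.sqrt (r ^+ 2 * \sum_(i < n) hnorm (\sum_(j < n) a i j (x j)) ^+ 2)).
have h : mx_values a (Num.sqrt (r ^+ 2 * \sum_(i < n) hnorm (\sum_(j < n) a i j (x j)) ^+ 2)).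
  exists (fun j => r%:C%C *: x j) => /=.
    by under eq_bigr do rewrite sc; rewrite -mulr_sumr rs.
  congr Num.sqrt; rewrite mulr_sumr; apply: eq_bigr => i _.
  rewrite -sc scaler_sumr; congr (hnorm _ ^+ 2); apply: eq_bigr => j _.
  by rewrite (bopZ (ba i j)).
move=> /(_ h); rewrite -(ler_pXn2r (n:=2)) ?nnegrE ?sqrtr_ge0//.
rewrite sqr_sqrtr; last by rewrite mulr_ge0 ?sqr_ge0.
by rewrite -ler_pdivlMl ?exprn_gt0// mulrC exprVn invrK sqr_sqrtr ?(ltW s0).
Qed.

Lemma mx_values0 H K n (a : 'M[H -> K]_n) : (forall i j, bounded_op (a i j)) ->
  mx_values a 0.
Proof.
move=> ba; exists (fun=> 0) => /=.
  by rewrite big1// => j _; rewrite hnorm0 expr0n.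
rewrite big1 ?sqrtr0// => i _; rewrite big1 ?hnorm0 ?expr0n// => j _.
exact: bop0 (ba i j).
Qed.

(** Sets of values with the same upper bounds have the same supremum; if there is no bound, [sup]
    takes its default on both sides. *)
Lemma mx_opnorm_eq H K H' K' n (a : 'M[H -> K]_n) (b : 'M[H' -> K']_n) :
  (forall i j, bounded_op (a i j)) -> (forall i j, bounded_op (b i j)) ->
  (forall N, 0 <= N -> mx_bound a N <-> mx_bound b N) -> mx_opnorm a = mx_opnorm b.
Proof.
move=> ba bb ab; rewrite /mx_opnorm -/(mx_values a) -/(mx_values b).
have [va vb] := (mx_values0 ba, mx_values0 bb).
have ub N : ubound (mx_values a) N <-> ubound (mx_values b) N.
  by split=> h; have N0 : 0 <= N by [exact: h]; apply/(mx_bound_ubound _ N0) => //;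
    apply/(ab _ N0)/(mx_bound_ubound _ N0).
have [sa|nsa] := pselect (has_sup (mx_values a)).
  have sb : has_sup (mx_values b).
    by split; [exists 0|case: sa => _ [N /ub]; exists N].
  apply/eqP; rewrite eq_le; apply/andP; split; apply: sup_le_ub; try by exists 0.
    by apply/ub; exact: sup_upper_bound.
  by apply/ub; exact: sup_upper_bound.
rewrite !sup_out// => -[_ [N /ub aN]]; apply: nsa; split; first by exists 0.
by exists N.
Qed.

Lemma embed_mx_bound H (A : set (H -> H)) L K (pi : (H -> H) -> L -> L)
    (rho : (H -> H) -> K -> K) (V : K -> bpow K L) n (a : 'M[H -> H]_n) (N : R) :
  bounded_op V -> (forall h, hnorm (V h) = hnorm h) ->
  (forall a, A a -> V \o rho a = bamp (pi a) \o V) -> star_rep A pi ->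
  (forall i j, A (a i j)) -> mx_bound (map_mx pi a) N -> mx_bound (map_mx rho a) N.
Proof.
move=> bV iV VE srp Aa piN x.
have sumV (s : seq 'I_n) (F : 'I_n -> K) : V (\sum_(j <- s) F j) = \sum_(j <- s) V (F j).
  by rewrite (big_morph V (bopD bV) (bop0 bV)).
have coord_sum J E (s : seq 'I_n) (F : 'I_n -> pow J E) i :
    (\sum_(j <- s) F j) i = \sum_(j <- s) F j i.
  by elim: s => [|j s IH]; rewrite ?big_nil// !big_cons ell2_addE IH.
have rsum_sum (J : choiceType) (F : 'I_n -> J -> R) : (forall i, absum (F i)) ->
    absum (fun j => \sum_(i < n) F i j) /\
    rsum (fun j => \sum_(i < n) F i j) = \sum_(i < n) rsum (F i).
  move=> sF; elim: (index_enum _) => [|i s [IH1 IH2]].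
    rewrite big_nil; under eq_fun do rewrite big_nil.
    by split; [exact: absum0|exact: rsum0].
  rewrite big_cons -IH2 -rsumD//.
  have -> : (fun j => \sum_(k <- i :: s) F k j) = (fun j => F i j + \sum_(k <- s) F k j).
    by apply/funext => j; rewrite big_cons.
  by split=> //; exact: absumD.
(* A matrix bound survives amplification: apply it in each coordinate and sum. It is used twice
   because [bamp] is a double amplification. *)
have key J E E' (f : 'I_n -> pow J E) (T : 'I_n -> 'I_n -> E -> E') :
    (forall i j, bounded_op (T i j)) ->
    (forall y : 'I_n -> E, \sum_(i < n) hnorm (\sum_(j < n) T i j (y j)) ^+ 2 <=
      N ^+ 2 * \sum_(j < n) hnorm (y j) ^+ 2) ->
    \sum_(i < n) hnorm (\sum_(j < n) famp (T i j) (f j)) ^+ 2 <=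
      N ^+ 2 * \sum_(j < n) hnorm (f j) ^+ 2.
  move=> bT TN.
  under eq_bigr do rewrite hnorm_ell2.
  under [in leRHS]eq_bigr do rewrite hnorm_ell2.
  have [s1 <-] := rsum_sum _ _ (fun i => coordP (\sum_(j < n) famp (T i j) (f j))).
  have [s2 <-] := rsum_sum _ _ (fun i => coordP (f i)).
  rewrite -rsumZ//; apply: le_rsum => //; first exact: absumZ.
  move=> k; apply: le_trans (TN (fun j => f j k)); apply: ler_sum => i _.
  rewrite coord_sum le_eqVlt; apply/orP; left; apply/eqP; congr (hnorm _ ^+ 2).
  by apply: eq_bigr => j _; rewrite fampE.
have bp i j : bounded_op (pi (a i j)) by exact: (rep_bop srp).
have E1 i : hnorm (\sum_(j < n) (map_mx rho a) i j (x j)) =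
    hnorm (\sum_(j < n) bamp (pi (a i j)) (V (x j))).
  rewrite -iV sumV; congr hnorm; apply: eq_bigr => j _; rewrite mxE.
  by have /= := congr1 (@^~ (x j)) (VE _ (Aa i j)).
under eq_bigr do rewrite E1.
have -> : \sum_(j < n) hnorm (x j) ^+ 2 = \sum_(j < n) hnorm (V (x j)) ^+ 2.
  by apply: eq_bigr => j _; rewrite iV.
apply: (key _ _ _ (fun j => V (x j)) (fun i j => famp (pi (a i j)))) => [i j|y].
  exact: bop_famp.
apply: (key _ _ _ y (fun i j => pi (a i j))) => // z.
by have := piN z; under eq_bigr do under eq_bigr do rewrite mxE.
Qed.

Theorem frep_wstar_ci_hom H (A : set (H -> H)) L (pi : (H -> H) -> L -> L) :
  vna A -> frep A pi -> wstar_ci_hom A pi.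
Proof.
move=> vA fp; have [srp _ dp] := fp; have sA := vna_star vA.
have fi := frep_id sA; split.
- by move=> a; exact: (rep_bop srp).
- by move=> c a b; exact: (rep_lin srp).
- by move=> a b; exact: (rep_comp srp).
- move=> n a Aa; apply: mx_opnorm_eq => [i j|i j|N N0].
  + by rewrite mxE; exact: (rep_bop srp).
  + exact: (sta_bop sA).
  have E : map_mx id a = a by apply/matrixP => i j; rewrite mxE.
  have [V [bV iV VE]] := frep_embed vA fi srp dp.
  have [W [bW iW WE]] := frep_embed vA fp (star_rep_id sA) (fr_dom fi).
  rewrite -[in X in _ <-> X]E; split.
    exact: (embed_mx_bound bW iW WE srp Aa).
  exact: (embed_mx_bound bV iV VE (star_rep_id sA) Aa).
- apply: (@wcontinuous_crit _ _ _ _ _ pi pi id 1 1) => //.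
  + by move=> a; exact: (rep_bop srp).
  + by move=> c a b; exact: (rep_lin srp).
  + by move=> x; rewrite mul1r.
  + by move=> a Aa x; rewrite mul1r.
Qed.

(** The sesquilinear form [q] measuring the failure of symmetry vanishes on the diagonal, hence
    everywhere by polarisation with [1] and ['i]. *)
Lemma selfadjoint_real H (T : H -> H) : bounded_op T ->
  (forall x, complex.Im (inner (T x) x) = 0) -> adj T = T.
Proof.
move=> bT rT; have bT' := bop_adj bT.
pose q x y := inner (T x) y - inner x (T y).
have q0 x : q x x = 0.
  rewrite /q (inner_conj (T x)); have := rT x.
  by case: (inner (T x) x) => a b /= ->; apply/eqP; rewrite eq_complex/= subrr opprK addr0 !eqxx.
apply/esym/(adj_uniq bT) => x y; apply/eqP; rewrite -subr_eq0 -/(q x y).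
have e1 : q x y + q y x = 0.
  have -> : q x y + q y x = q (x + y) (x + y) - q x x - q y y.
    by rewrite /q (bopD bT) !innerDl !innerDr; ring.
  by rewrite !q0 !subr0.
have e2 : 'i%C * q x y - 'i%C * q y x = 0.
  have -> : 'i%C * q x y - 'i%C * q y x =
      q ('i%C *: x + y) ('i%C *: x + y) + 'i%C * 'i%C * q x x - q y y.
    rewrite /q (bopP bT) !innerDl !innerDr !innerZl !innerZr.
    have -> : ('i%C)^* = - 'i%C :> R[i] by apply/eqP; rewrite eq_complex/= oppr0 !eqxx.
    ring.
  by rewrite !q0 mulr0 addr0 subr0.
have e3 : 2 * q x y = 0.
  have -> : 2 * q x y = (q x y + q y x) - 'i%C * ('i%C * q x y - 'i%C * q y x).
    have i2 : 'i%C * 'i%C = -1 :> R[i] by rewrite -expr2 sqr_i.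
    have -> : 'i%C * ('i%C * q x y - 'i%C * q y x) = 'i%C * 'i%C * (q x y - q y x) by ring.
    by rewrite i2; ring.
  by rewrite e1 e2 mulr0 subr0.
by move/eqP: e3; rewrite mulf_eq0 pnatr_eq0.
Qed.

(** Isometry on [1 x 1] matrices is enough here. A unital contraction sends self-adjoint elements to
    self-adjoint ones, which gives the adjoints; injectivity is isometry, and normality comes from
    weak-star continuity. *)
Theorem wstar_ci_hom_frep H (A : set (H -> H)) L (f : (H -> H) -> L -> L) :
  vna A -> wstar_ci_hom A f -> (f @` A) idfun -> frep A f.
Proof.
move=> vA [bf lf mf cf wf] [e Ae fe]; have sA := vna_star vA; have bA := sta_bop sA.
have A1 := sta_id sA.
have f1 : f idfun = idfun.
  by rewrite -[LHS]/(f idfun \o idfun) -fe -mf.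
have bound1 K (T : K -> K) N : bounded_op T -> 0 <= N ->
    mx_bound (const_mx T : 'M[K -> K]_1) N <-> (forall x, hnorm (T x) <= N * hnorm x).
  move=> bT N0; split=> [TN x|TN x].
    have := TN (fun=> x); rewrite !big_ord1 mxE -exprMn.
    by rewrite ler_pXn2r ?nnegrE ?mulr_ge0 ?hnorm_ge0.
  rewrite !big_ord1 mxE -exprMn.
  by rewrite ler_pXn2r ?nnegrE ?mulr_ge0 ?hnorm_ge0.
have norm1 K (T : K -> K) : bounded_op T -> forall x,
    hnorm (T x) <= mx_opnorm (const_mx T : 'M[K -> K]_1) * hnorm x.
  move=> bT; have bm (i j : 'I_1) : bounded_op ((const_mx T : 'M[K -> K]_1) i j) by rewrite mxE.
  have [c c0 Tc] := bop_bound bT.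
  have uc : ubound (mx_values (const_mx T : 'M[K -> K]_1)) c.
    by apply/mx_bound_ubound => //; apply/bound1.
  have N0 : 0 <= mx_opnorm (const_mx T : 'M[K -> K]_1).
    by apply: ub_le_sup; [exists c|exact: mx_values0].
  apply/bound1 => //; apply/mx_bound_ubound => //.
  by apply: sup_upper_bound; split; [exists 0; exact: mx_values0|exists c].
have norm2 K (T : K -> K) N : bounded_op T -> 0 <= N ->
    (forall x, hnorm (T x) <= N * hnorm x) -> mx_opnorm (const_mx T : 'M[K -> K]_1) <= N.
  move=> bT N0 TN; have bm (i j : 'I_1) : bounded_op ((const_mx T : 'M[K -> K]_1) i j) by rewrite mxE.
  apply: sup_le_ub; first by exists 0; exact: mx_values0.
  by apply/mx_bound_ubound => //; apply/bound1.
have iso a : A a -> mx_opnorm (const_mx (f a) : 'M[L -> L]_1) = mx_opnorm (const_mx a : 'M[H -> H]_1).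
  move=> Aa; rewrite -(cf 1%N (const_mx a)) => [|i j]; last by rewrite mxE.
  by congr mx_opnorm; apply/matrixP => i j; rewrite !mxE.
have f_le a N : A a -> 0 <= N -> (forall x, hnorm (a x) <= N * hnorm x) ->
    forall y, hnorm (f a y) <= N * hnorm y.
  move=> Aa N0 aN y; rewrite (le_trans (norm1 _ _ (bf _ Aa) y))//.
  by rewrite ler_wpM2r ?hnorm_ge0// iso// norm2//; exact: bA.
have lf' (c : R[i]) a b x : A a -> A b -> f (c *: a + b) x = c *: f a x + f b x.
  by move=> Aa Ab; rewrite lf.
have f_sa a : A a -> adj a = a -> adj (f a) = f a.
  move=> Aa aa; have ba := bA _ Aa; apply: selfadjoint_real; first exact: bf.
  move=> y; have [c c0 ac] := bop_bound ba.
  set s := complex.Im _.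
  (* For self-adjoint [a] the norm of [a + 'i t] is at most the square root of [c^2 + t^2], and [f]
     does not increase it. Expanded at [y], the terms in [t^2] cancel and a bound linear in [t]
     remains, which forces [s = 0]. *)
  have key (t : R) : 2 * t * s <= c ^+ 2 * hnorm y ^+ 2.
    pose it : R[i] := (0 +i* t)%C.
    have nt : cabs it ^+ 2 = t ^+ 2 by rewrite sqr_cabsE/= expr0n add0r.
    have Ait : A (it *: idfun + a) by exact: star_algebra_lin.
    have h1 x : hnorm ((it *: idfun + a) x) <= Num.sqrt (c ^+ 2 + t ^+ 2) * hnorm x.
      rewrite -(ler_pXn2r (n:=2)) ?nnegrE ?mulr_ge0 ?sqrtr_ge0 ?hnorm_ge0//.
      rewrite exprMn sqr_sqrtr ?addr_ge0 ?sqr_ge0//.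
      rewrite -[(_ + _) x]/(it *: x + a x) hnorm_sqD hnormZ exprMn nt innerZl.
      have -> : complex.Re (it * inner x (a x)) = 0.
        have : inner x (a x) = (inner x (a x))^* by rewrite -inner_conj (adjP ba) aa.
        case: (inner x (a x)) => p q [] /= qq.
        by rewrite mul0r sub0r (_ : q = 0) ?mulr0 ?oppr0//; lra.
      have : hnorm (a x) ^+ 2 <= c ^+ 2 * hnorm x ^+ 2.
        by rewrite -exprMn ler_pXn2r ?nnegrE ?mulr_ge0 ?hnorm_ge0.
      lra.
    have h2 := f_le _ _ Ait (sqrtr_ge0 _) h1 y; move: h2.
    rewrite -(@ler_pXn2r _ 2%N) ?nnegrE ?mulr_ge0 ?sqrtr_ge0 ?hnorm_ge0//.
    rewrite exprMn sqr_sqrtr ?addr_ge0 ?sqr_ge0// lf'// f1.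
    rewrite hnorm_sqD hnormZ exprMn nt innerZl inner_conj.
    have -> : complex.Re (it * (inner (f a y) y)^*) = t * s.
      rewrite /s; case: (inner (f a y) y) => p q /=; ring.
    have := sqr_ge0 (hnorm (f a y)); lra.
  apply/eqP; apply: contraT => s0; have s2 : 0 < s ^+ 2 by rewrite exprn_even_gt0.
  (* This [t] makes the left side exceed the bound by exactly [1]. *)
  have := key ((c ^+ 2 * hnorm y ^+ 2 + 1) / (2 * s)).
  have -> : 2 * ((c ^+ 2 * hnorm y ^+ 2 + 1) / (2 * s)) * s = c ^+ 2 * hnorm y ^+ 2 + 1.
    by field; rewrite s0.
  lra.
have i2 : 'i%C * 'i%C = -1 :> R[i] by rewrite -expr2 sqr_i.
have f_adj a : A a -> f (adj a) = adj (f a).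
  move=> Aa; have Aa' := sta_adj sA Aa; have [ba ba'] := (bA _ Aa, bA _ Aa').
  have sc (c : R[i]) b : A b -> A (c *: b) by exact: star_algebraZ.
  have h1 : adj (1 *: a + adj a) = 1 *: a + adj a.
    by rewrite adj_lin// adjK// conjC1 !scale1r addrC.
  have h2 : adj ('i%C *: a + (- 'i%C) *: adj a) = 'i%C *: a + (- 'i%C) *: adj a.
    rewrite adj_lin//; last exact: bA _ (sc _ _ Aa').
    have -> : adj (- 'i%C *: adj a) = (- 'i%C)^* *: a.
      rewrite -[X in adj X]addr0 adj_lin//; last exact: bop_cst0.
      by rewrite adj0 addr0 adjK.
    have -> : ('i%C)^* = - 'i%C :> R[i] by apply/eqP; rewrite eq_complex/= oppr0 !eqxx.
    have -> : (- 'i%C)^* = 'i%C :> R[i] by apply/eqP; rewrite eq_complex/= oppr0 opprK !eqxx.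
    by rewrite addrC.
  have Ab1 : A (1 *: a + adj a) by exact: star_algebra_lin.
  have Ab2 : A ('i%C *: a + (- 'i%C) *: adj a) by apply: star_algebra_lin => //; exact: sc.
  have fsc (c : R[i]) b : A b -> f (c *: b) = c *: f b.
    move=> Ab; have f0 : f 0 = 0.
      have A0 : A 0 by case: (sta_linear sA).
      have := lf (-1) _ _ A0 A0; rewrite scaler0 addr0 scaleN1r.
      by rewrite addNr.
    rewrite -[X in f X]addr0 lf//; first by rewrite f0 addr0.
    by case: (sta_linear sA).
  have bfa := bf _ Aa; have bfa' := bf _ Aa'.
  apply/(adj_uniq bfa) => x y.
  have k1 : inner (f (1 *: a + adj a) x) y = inner x (f (1 *: a + adj a) y).
    by rewrite (adjP (bf _ Ab1)) f_sa.
  have k2 : inner (f ('i%C *: a + (- 'i%C) *: adj a) x) y =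
      inner x (f ('i%C *: a + (- 'i%C) *: adj a) y).
    by rewrite (adjP (bf _ Ab2)) f_sa.
  have Ai : A (- 'i%C *: adj a) by exact: sc.
  move: k1 k2; rewrite !lf'// !fsc// -![(_ *: f (adj a)) _]/(- 'i%C *: f (adj a) _).
  rewrite !innerDl !innerDr !innerZl !innerZr conjC1 !mul1r.
  have -> : ('i%C)^* = - 'i%C :> R[i] by apply/eqP; rewrite eq_complex/= oppr0 !eqxx.
  have -> : (- 'i%C)^* = 'i%C :> R[i] by apply/eqP; rewrite eq_complex/= oppr0 opprK !eqxx.
  move: (inner (f a x) y) (inner (f (adj a) x) y) (inner x (f a y)) (inner x (f (adj a) y)).
  move=> p q r s k1 k2.
  (* The elements [a + adj a] and ['i (a - adj a)] are self-adjoint; the two identities for their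
     images combine to this one. *)
  have : 2 * (p - s) = 0.
    have -> : 2 * (p - s) = (p + q - (r + s)) + - 'i%C * ('i%C * p + - 'i%C * q - (- 'i%C * r + 'i%C * s)).
      have -> : - 'i%C * ('i%C * p + - 'i%C * q - (- 'i%C * r + 'i%C * s)) =
        - ('i%C * 'i%C) * (p - q + r - s) by ring.
      by rewrite i2; ring.
    by rewrite k1 k2 !subrr mulr0 addr0.
  by move/eqP; rewrite mulf_eq0 pnatr_eq0/= subr_eq0 => /eqP.
have srf : star_rep A f by split.
split=> // [a Aa fa0|xi].
  apply/funext => x; apply: hnorm_eq0; apply/eqP; rewrite eq_le hnorm_ge0 andbT.
  rewrite (le_trans (norm1 _ _ (bA _ Aa) x))// -iso// -[leRHS](mul0r (hnorm x)).
  rewrite ler_wpM2r ?hnorm_ge0// norm2//; first exact: bf.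
  by move=> y; rewrite fa0 -[(0 : L -> L) y]/0 hnorm0 mul0r.
(* The vector functional of [xi] becomes the inner product of [famp a X] with some [y]; at
   [adj a \o a] it is that of [famp a X] with [famp a y], so [|f a xi|^2] is bounded by the square
   of a single amplified norm. *)
have [X [c c0 Xc]] := wcontinuous_dominated xi xi (sta_linear sA) bA bf lf wf.
have [k a b Aa Ab|k a b Aa Ab|a Aa|y [_ fy _]] := @riesz _ _ A _ (fun a => famp a X)
    (fun a => inner (f a xi) xi) c (sta_linear sA).
- by rewrite famp_lin//; exact: bA.
- by rewrite lf'// inner_is_linear.
- exact: Xc.
have [Z ZP] := ell2_pair X y; exists Z => a Aa; have ba := bA _ Aa.
rewrite -(ler_pXn2r (n:=2)) ?nnegrE ?hnorm_ge0//.
have -> : hnorm (f a xi) ^+ 2 = cabs (inner (f (adj a \o a) xi) xi).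
  by rewrite (rep_sqE _ sA srf Aa) cabs_real ger0_norm// sqr_ge0.
have Aaa : A (adj a \o a) by apply: (sta_comp sA) => //; exact: (sta_adj sA).
rewrite fy// (famp_comp (bop_adj ba) ba) -(adj_famp ba)/= -(adjPr (bop_famp ba)).
have [ZX Zy] := ZP _ _ ba.
by rewrite (le_trans (cauchy_schwarz _ _))// expr2 ler_pM ?hnorm_ge0.
Qed.

End WeakStarHomomorphisms.

Section VonNeumannAlgebras.
Variable R : realType.
Implicit Types H K L E F : hilbertType R.

Lemma vna_of H (A : set (H -> H)) : von_neumann_algebra A -> vna A.
Proof.
move=> [[[lA cA bA wA] iA] aA]; split=> //; split=> // a Aa.
by apply: aA; exists a => //; case: (adj_spec (bA _ Aa)).
Qed.

Lemma vna_unital_dual H (A : set (H -> H)) : vna A -> unital_dual_algebra A.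
Proof.
move=> [sA cA]; split; last exact: sta_id sA.
split=> //; [exact: sta_linear sA|exact: sta_comp sA|exact: sta_bop sA].
Qed.

Lemma wspanP H K (S : set (H -> K)) T : S `<=` @bounded_op R H K ->
  wspan S T <-> bounded_op T /\ forall X Y : pow nat _,
    (forall s, S s -> inner (famp s X) Y = 0) -> inner (famp T X) Y = 0.
Proof.
move=> bS; have bsS : span S `<=` @bounded_op R H K.
  by apply: span_sub bS; exact: bop_linear_set.
rewrite -[wspan S]/(wclosure (span S)).
split=> [/(wclosureP _ (span_linear S) bsS)[bT TP]|[bT TP]].
  split=> // X Y SXY; apply: TP => s Ss.
  have : (@bounded_op R H K `&` [set s | inner (famp s X) Y = 0]) s.
    apply: (span_sub _ _ Ss) => [|t St]; last by split; [exact: bS|exact: SXY].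
    split=> [|c u v [bu u0] [bv v0]].
      split; first exact: bop_cst0.
      rewrite /= -[famp _ X]/(famp (0 : H -> K) X) (_ : famp _ X = 0) ?inner0l//.
      by apply: ell2_ext => j; rewrite fampE//; exact: bop_cst0.
    split; first exact: bop_lin.
    by rewrite /= famp_lin// fun_linE inner_is_linear u0 v0 mulr0 addr0.
  by case.
apply/(wclosureP _ (span_linear S) bsS); split=> // X Y SXY.
by apply: TP => s Ss; apply: SXY; exact: sub_span.
Qed.

Lemma wspan_eq H (A S : set (H -> H)) : vna A -> S `<=` A ->
  (forall X Y : pow nat H, (forall s, S s -> inner (famp s X) Y = 0) ->
    forall a, A a -> inner (famp a X) Y = 0) -> wspan S = A.
Proof.
move=> [sA cA] SA AXY; have bA := sta_bop sA.
have bS := subset_trans SA bA.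
apply/seteqP; split=> [T /(wspanP _ bS)[bT TP]|T AT].
  apply/cA/(wclosureP _ (sta_linear sA) bA); split=> // X Y XY.
  by apply: TP => s /SA; exact: XY.
apply/(wspanP _ bS); split; first exact: bA.
by move=> X Y /AXY; apply.
Qed.

End VonNeumannAlgebras.

Lemma pincl_inj (R : realType) (H : hilbertType R) (p : projection H) :
  injective (@pincl R H p).
Proof. exact: val_inj. Qed.

Section Compression.
Variables (R : realType) (H : hilbertType R) (A : set (H -> H)) (sA : star_algebra A).
Variables (L : hilbertType R) (rho : (H -> H) -> L -> L) (p : projection L).
Hypothesis srr : star_rep A rho.
Hypothesis prho : forall a, A a -> forall x, p (rho a (p x)) = rho a (p x).

Definition compress (a : H -> H) : prange p -> prange p := @pcut R L p \o rho a \o @pincl R L p.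

Lemma pincl_compress a x : A a -> pincl (compress a x) = rho a (pincl x).
Proof. by move=> Aa; rewrite -[LHS]/(p (rho a (pincl x))) -(proj_pincl x) prho. Qed.

Lemma compress_pcut a x : A a -> compress a (pcut p x) = pcut p (rho a x).
Proof.
move=> Aa; have Aa' := sta_adj sA Aa; have ba := rep_bop srr Aa.
rewrite -[LHS]/(pcut p (rho a (p x))); apply: val_inj => /=.
rewrite prho//; apply/esym/(@proj_commute _ _ p) => //; first exact: prho.
by rewrite -(rep_adj srr)//; exact: prho.
Qed.

Lemma star_rep_compress : star_rep A compress.
Proof.
have bi := @bop_pincl _ _ p; have bc := @bop_pcut _ _ p.
split=> [a Aa|c a b Aa Ab|a b Aa Ab||a Aa].
- by apply: bop_comp bi; apply: bop_comp => //; exact: (rep_bop srr).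
- by rewrite /compress (rep_lin srr)// comp_linr.
- apply/funext => x; rewrite -[RHS]/(compress a (pcut p (rho b (pincl x)))).
  by rewrite compress_pcut// -[LHS]/(pcut p (rho (a \o b) (pincl x))) (rep_comp srr).
- by apply/funext => x; rewrite /compress (rep_id srr) /= pinclK.
- have ba := rep_bop srr Aa.
  rewrite /compress (adj_comp (bop_comp bc ba) bi) (adj_comp bc ba).
  by rewrite adj_pincl adj_pcut (rep_adj srr).
Qed.

Lemma dominated_compress : dominated A id rho -> dominated A id compress.
Proof.
move=> dr x; have [X hX] := dr (pincl x); exists X => a Aa.
by rewrite -pincl_hnorm pincl_compress// hX.
Qed.

End Compression.
Arguments compress {R H L} rho p a _.

(** * Bimodules between represented algebras *)

Section MoritaBimodules.
Variable R : realType.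
Implicit Types H K L E F : hilbertType R.

Lemma comp0r H K L (U : K -> L) : bounded_op U -> U \o (0 : H -> K) = 0.
Proof. by move=> bU; apply/funext => x; exact: bop0. Qed.

Lemma comp0l H K L (U : H -> K) : (0 : K -> L) \o U = 0.
Proof. by []. Qed.

(** Density of the span of the ranges, in the dual form that the proofs test; [total_adherent]
    recovers the density. *)
Definition total E F (X : set (E -> F)) : Prop :=
  forall l, (forall x, X x -> adj x l = 0) -> l = 0.

Lemma total_adherent E F (X : set (E -> F)) : X `<=` @bounded_op R E F -> total X ->
  forall l, adherent (span [set v | exists2 x, X x & exists k, v = x k]) l.
Proof.
move=> bX tX l; set G := [set v | _]; rewrite -[l](subrK (prj G l)).
suff -> : l - prj G l = 0 by rewrite add0r; exact: prj_span.
apply: tX => x Xx; apply: inner_extr => k; rewrite inner0r.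
by rewrite -(adjP (bX _ Xx)); apply: (@prj_orth _ _ G); exists x => //; exists k.
Qed.

Lemma total_eq E F L (X : set (E -> F)) (S T : F -> L) : X `<=` @bounded_op R E F ->
  total X -> bounded_op S -> bounded_op T -> (forall x, X x -> S \o x = T \o x) -> S = T.
Proof.
move=> bX tX bS bT ST; apply/funext => l.
apply: (bop_span_eq bS bT _ (total_adherent bX tX l)) => _ [x Xx [k ->]].
exact: (congr1 (@^~ k) (ST _ Xx)).
Qed.

(* When [X] is moreover total on the right, this is an equivalence bimodule
   between [tau A] and [sigma B]; in general one between [tau A] and a direct
   summand of [sigma B]. *)
Record bimodule H K (A : set (H -> H)) (B : set (K -> K)) F E
    (tau : (H -> H) -> F -> F) (sigma : (K -> K) -> E -> E) (X : set (E -> F)) : Prop := {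
  bi_tau : frep A tau ;
  bi_sigma : frep B sigma ;
  bi_bop : X `<=` @bounded_op R E F ;
  bi_lin : linear_set X ;
  bi_left : forall a x, A a -> X x -> X (tau a \o x) ;
  bi_right : forall x b, X x -> B b -> X (x \o sigma b) ;
  bi_ipB : forall x y, X x -> X y -> exists2 b, B b & sigma b = adj x \o y ;
  bi_ipA : forall x y, X x -> X y -> exists2 a, A a & tau a = x \o adj y ;
  bi_total : total X
}.

(** Totality of the adjoints: the non-degeneracy on the side of [B] that a bimodule may lack. *)
Definition full E F (X : set (E -> F)) : Prop :=
  forall k, (forall x, X x -> x k = 0) -> k = 0.

Definition embeds_in H K (A : set (H -> H)) (B : set (K -> K)) : Prop :=
  exists F E (tau : (H -> H) -> F -> F) (sigma : (K -> K) -> E -> E) X,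
    bimodule A B tau sigma X.

Definition adjs E F (X : set (E -> F)) : set (F -> E) := [set adj x | x in X].

Lemma bimodule_sym H K (A : set (H -> H)) (B : set (K -> K)) F E
    (tau : (H -> H) -> F -> F) (sigma : (K -> K) -> E -> E) X :
  star_algebra A -> star_algebra B -> bimodule A B tau sigma X -> full X ->
  bimodule B A sigma tau (adjs X).
Proof.
move=> sA sB [ft fs bX lX lX1 rX1 XB XA tX] fX.
have [bt bs] := (fr_rep ft, fr_rep fs).
split=> //.
- by move=> _ [x Xx <-]; exact/bop_adj/bX.
- split; first by exists 0; [case: lX|exact: adj0].
  move=> c _ _ [x Xx <-] [y Xy <-]; exists (c^* *: x + y); first by case: lX => _; apply.
  by rewrite adj_lin ?conjCK//; exact: bX.
- move=> b _ Bb [x Xx <-]; have Bb' := sta_adj sB Bb.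
  exists (x \o sigma (adj b)); first exact: rX1.
  rewrite adj_comp; [|exact: bX|exact: (rep_bop bs)].
  by rewrite -(rep_adj bs)// adjK//; exact: (sta_bop sB).
- move=> _ a [x Xx <-] Aa; have Aa' := sta_adj sA Aa.
  exists (tau (adj a) \o x); first exact: lX1.
  rewrite adj_comp; [|exact: (rep_bop bt)|exact: bX].
  by rewrite -(rep_adj bt)// adjK//; exact: (sta_bop sA).
- move=> _ _ [x Xx <-] [y Xy <-]; rewrite adjK; last exact: bX.
  exact: XA.
- move=> _ _ [x Xx <-] [y Xy <-]; rewrite adjK; last exact: bX.
  exact: XB.
- by move=> k kX; apply: fX => x Xx; rewrite -(adjK (bX _ Xx)); apply: kX; exists x.
Qed.

Lemma full_adjs E F (X : set (E -> F)) : total X -> full (adjs X).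
Proof. by move=> tX k kX; apply: tX => x Xx; apply: kX; exists x. Qed.

(** By sesquilinearity the conditions pass from generators to their span. [X] is never asked to be
    closed, so that products of bimodules need no completion. *)
Lemma bimodule_span H K (A : set (H -> H)) (B : set (K -> K)) F E
    (tau : (H -> H) -> F -> F) (sigma : (K -> K) -> E -> E) (X : set (E -> F)) :
  star_algebra A -> star_algebra B ->
  frep A tau -> frep B sigma -> X `<=` @bounded_op R E F ->
  (forall a x, A a -> X x -> X (tau a \o x)) ->
  (forall x b, X x -> B b -> X (x \o sigma b)) ->
  (forall x y, X x -> X y -> exists2 b, B b & sigma b = adj x \o y) ->
  (forall x y, X x -> X y -> exists2 a, A a & tau a = x \o adj y) ->
  total X -> bimodule A B tau sigma (span X).
Proof.
move=> sA sB ft fs bX lX rX XB XA tX.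
have [st ss] := (fr_rep ft, fr_rep fs).
have [lA lB] := (star_algebra_image sA st, star_algebra_image sB ss).
have bsX : span X `<=` @bounded_op R E F by apply: span_sub bX; exact: bop_linear_set.
have lsX := span_linear X; have sX := @sub_span _ _ X.
split=> //.
- move=> a x Aa sXx; have bta := rep_bop st Aa.
  suff : [set x : E -> F | span X (tau a \o x)] x by []; apply: (span_sub _ _ sXx) => [|y Xy]; last by apply: sX; exact: lX.
  split=> [|c y z]; last by rewrite /= comp_linr//; case: lsX => _; apply.
  rewrite /= comp0r//.
  by case: lsX.
- move=> x b sXx Bb.
  suff : [set x : E -> F | span X (x \o sigma b)] x by []; apply: (span_sub _ _ sXx) => [|y Xy]; last by apply: sX; exact: rX.
  split=> [|c y z]; last by rewrite /= comp_linl; case: lsX => _; apply.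
  rewrite /= comp0l.
  by case: lsX.
- move=> x y sXx sXy.
  suff : (@bounded_op R E F `&` [set x : E -> F | (sigma @` B) (adj x \o y)]) x by case.
  apply: (span_sub _ _ sXx) => [|{sXx}x Xx].
    split=> [|c u v [bu u0] [bv v0]]; split.
    + exact: bop_cst0.
    + by rewrite /= adj0; have [] := sta_linear lB.
    + exact: bop_lin.
    + by rewrite /= adj_lin// comp_linl; exact: (star_algebra_lin _ lB).
  split; first exact: bX.
  have bx := bop_adj (bX _ Xx).
  suff : [set y : E -> F | (sigma @` B) (adj x \o y)] y by []; apply: (span_sub _ _ sXy) => [|z Xz].
    split=> [|c u v u0 v0] /=; last by rewrite comp_linr//; exact: (star_algebra_lin _ lB).
    rewrite /= comp0r//.
    by have [] := sta_linear lB.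
  by have [b Bb bE] := XB _ _ Xx Xz; exists b.
- move=> x y sXx sXy.
  suff : [set x : E -> F | (tau @` A) (x \o adj y)] x by []; apply: (span_sub _ _ sXx) => [|{sXx}x Xx].
    split=> [|c u v u0 v0] /=; last by rewrite comp_linl; exact: (star_algebra_lin _ lA).
    rewrite /= comp0l.
    by have [] := sta_linear lA.
  have bx := bX _ Xx.
  suff : (@bounded_op R E F `&` [set y : E -> F | (tau @` A) (x \o adj y)]) y by case.
  apply: (span_sub _ _ sXy) => [|{sXy}y Xy].
    split=> [|c u v [bu u0] [bv v0]]; split.
    + exact: bop_cst0.
    + rewrite /= adj0; rewrite comp0r//.
      by have [] := sta_linear lA.
    + exact: bop_lin.
    + by rewrite /= adj_lin// comp_linr//; exact: (star_algebra_lin _ lA).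
  split; first exact: bX.
  by have [a Aa aE] := XA _ _ Xx Xy; exists a.
- by move=> l lX0; apply: tX => x Xx; apply: lX0; exact: sX.
Qed.

Lemma bimodule_refl H (A : set (H -> H)) : vna A -> bimodule A A id id A.
Proof.
move=> vA; have sA := vna_star vA; have fA := frep_id sA; split=> //.
- exact: sta_bop sA.
- exact: sta_linear sA.
- exact: sta_comp sA.
- exact: sta_comp sA.
- by move=> x y Ax Ay; exists (adj x \o y) => //; apply: (sta_comp sA) => //; exact: (sta_adj sA).
- by move=> x y Ax Ay; exists (x \o adj y) => //; apply: (sta_comp sA) => //; exact: (sta_adj sA).
- by move=> l /(_ _ (sta_id sA)); rewrite adj_id.
Qed.

(** The inner product of [x \o y] and [x' \o y'] is that of [y] with [sigma b \o y'], where
    [sigma b = adj x \o x']. This needs the same [sigma] on both sides, whence [bimodule_change]. *)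
Lemma bimodule_comp H K L (A : set (H -> H)) (B : set (K -> K)) (C : set (L -> L)) F E E'
    (tau : (H -> H) -> F -> F) (sigma : (K -> K) -> E -> E) (rho : (L -> L) -> E' -> E') X Y :
  star_algebra A -> star_algebra C ->
  bimodule A B tau sigma X -> bimodule B C sigma rho Y ->
  bimodule A C tau rho (span [set x \o y | x in X & y in Y]).
Proof.
move=> sA sC [ft fs bX lX lX1 rX1 XB XA tX] [_ fr bY lY lY1 rY1 YB YA tY].
apply: bimodule_span => //.
- by move=> _ [x Xx [y Yy <-]]; apply: bop_comp; [exact: bX|exact: bY].
- by move=> a _ Aa [x Xx [y Yy <-]]; exists (tau a \o x); [exact: lX1|exists y].
- by move=> _ b [x Xx [y Yy <-]] Bb; exists x => //; exists (y \o rho b) => //; exact: rY1.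
- move=> _ _ [x Xx [y Yy <-]] [x' Xx' [y' Yy' <-]].
  have [b Bb bE] := XB _ _ Xx Xx'; have [c Cc cE] := YB _ _ Yy (lY1 _ _ Bb Yy').
  exists c => //; rewrite cE bE (adj_comp (bX _ Xx) (bY _ Yy)).
  by [].
- move=> _ _ [x Xx [y Yy <-]] [x' Xx' [y' Yy' <-]].
  have [b Bb bE] := YA _ _ Yy Yy'; have [a Aa aE] := XA _ _ (rX1 _ _ Xx Bb) Xx'.
  by exists a => //; rewrite aE bE (adj_comp (bX _ Xx') (bY _ Yy')).
- move=> l lXY; apply: tX => x Xx; apply: tY => y Yy.
  have := lXY (x \o y); rewrite (adj_comp (bX _ Xx) (bY _ Yy)); apply.
  by exists x => //; exists y.
Qed.

End MoritaBimodules.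

Section ChangeOfRepresentation.
Variable R : realType.
Implicit Types H K L E F : hilbertType R.

Lemma star_rep_bamp M H (A : set (H -> H)) L (rho : (H -> H) -> L -> L) :
  star_rep A rho -> star_rep A (fun a => bamp (L := M) (rho a)).
Proof. by move=> sr; exact: (star_rep_famp M (star_rep_famp nat sr)). Qed.

Lemma dominated_bamp M H (A : set (H -> H)) L (rho : (H -> H) -> L -> L) :
  star_algebra A -> star_rep A rho -> dominated A id rho ->
  dominated A id (fun a => bamp (L := M) (rho a)).
Proof.
move=> sA sr dr; have si := star_rep_id sA.
exact: (dominated_famp (J := M) sA si (star_rep_famp nat sr) (dominated_famp (J := nat) sA si sr dr)).
Qed.

Lemma bamp_lin M E E' (c : R[i]) (a b : E -> E') : bounded_op a -> bounded_op b ->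
  bamp (L := M) (c *: a + b) = c *: bamp a + bamp b.
Proof. by move=> ba bb; rewrite /bamp famp_lin// famp_lin//; exact: bop_famp. Qed.

Lemma bamp0 M E E' : bamp (L := M) (0 : E -> E') = 0.
Proof.
apply/funext => f; apply: ell2_ext => i; apply: ell2_ext => n.
by rewrite bampE//; exact: bop_cst0.
Qed.

Lemma total_left_eq0 E F L (X : set (E -> F)) (S : F -> L) : X `<=` @bounded_op R E F ->
  total X -> bounded_op S -> (forall x, X x -> S \o x = 0) -> S = 0.
Proof.
move=> bX tX bS SX; apply: (total_eq bX tX bS (@bop_cst0 _ _ _)) => x Xx.
by rewrite SX.
Qed.

Lemma bimodule_faithful H K (A : set (H -> H)) (B : set (K -> K)) F E
    (tau : (H -> H) -> F -> F) (sigma : (K -> K) -> E -> E) (X : set (E -> F)) a :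
  star_algebra A -> bimodule A B tau sigma X -> A a ->
  (forall x y, X x -> X y -> adj x \o tau a \o y = 0) -> a = 0.
Proof.
move=> sA [ft fs bX lX lX1 rX1 XB XA tX] Aa Xa; have bt := rep_bop (fr_rep ft).
apply: (fr_inj ft Aa); apply: (total_left_eq0 bX tX (bt _ Aa)) => x Xx.
apply/funext => k; apply: tX => y Xy.
exact: (congr1 (@^~ k) (Xa _ _ Xy Xx)).
Qed.

(** An embedding [V] of [rho] in an amplification of [sigma] replaces [x] by [bamp x \o V]; inner
    products become [adj V \o bamp (sigma b) \o V], which is [rho b]. The new left space is the
    closed span of the ranges, with the subrepresentation of an amplification of [tau] on it. *)
Theorem bimodule_change H K (A : set (H -> H)) (B : set (K -> K)) F E E'
    (tau : (H -> H) -> F -> F) (sigma : (K -> K) -> E -> E) (rho : (K -> K) -> E' -> E') X :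
  vna A -> vna B -> bimodule A B tau sigma X -> frep B rho ->
  exists F' (tau' : (H -> H) -> F' -> F') X', bimodule A B tau' rho X'.
Proof.
move=> vA vB biX fr; have [ft fs bX lX lX1 rX1 XB XA tX] := biX.
have [sA sB] := (vna_star vA, vna_star vB).
have [st ss sr] := And3 (fr_rep ft) (fr_rep fs) (fr_rep fr).
have [V [bV iV VE]] := frep_embed vB fs sr (fr_dom fr).
have VK := isometry_adjK bV iV.
pose G : set (bpow E' F) := [set v | exists2 x, X x & exists e, v = bamp x (V e)].
pose p := prj G.
have bb x : X x -> bounded_op (bamp (L := E') x) by move=> /bX; exact: bop_bamp.
have pG x e : X x -> p (bamp x (V e)) = bamp x (V e).
  by move=> Xx; apply: prj_gen; exists x => //; exists e.
have stb := star_rep_bamp E' st.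
have prho a : A a -> forall f, p (bamp (tau a) (p f)) = bamp (tau a) (p f).
  move=> Aa f; have bta := rep_bop st Aa; apply: prj_id.
  apply: (bop_span (bop_bamp bta) _ (prj_span G f)) => _ [x Xx [e ->]].
  apply: adherent_sub; apply: sub_span; exists (tau a \o x); first exact: lX1.
  by exists e; rewrite (bamp_comp bta (bX _ Xx)).
have bi := @bop_pincl _ _ p; have bc := @bop_pcut _ _ p.
pose w x : E' -> prange p := @pcut _ _ p \o (bamp x \o V).
have bw x : X x -> bounded_op (w x).
  by move=> Xx; apply: bop_comp bc _; exact: bop_comp (bb _ Xx) bV.
have adjw x : X x -> adj (w x) = adj V \o bamp (adj x) \o @pincl _ _ p.
  move=> Xx; rewrite (adj_comp bc (bop_comp (bb _ Xx) bV)) (adj_comp (bb _ Xx) bV).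
  by rewrite adj_pcut (adj_bamp (bX _ Xx)).
have iw x e : X x -> pincl (w x e) = bamp x (V e) by move=> Xx; exact: pG.
have wB x y b : X x -> X y -> B b -> sigma b = adj x \o y -> rho b = adj (w x) \o w y.
  move=> Xx Xy Bb bE; apply/funext => e; rewrite adjw//=.
  rewrite -/(w y e) iw// -[bamp (adj x) _]/((bamp (adj x) \o bamp y) (V e)).
  rewrite -(bamp_comp (bop_adj (bX _ Xx)) (bX _ Xy)) -bE.
  by have /= <- := congr1 (@^~ e) (VE _ Bb); rewrite VK.
exists (prange p), (compress (fun a => bamp (tau a)) p), (w @` X).
have sc := star_rep_compress sA stb prho.
split.
- split; [exact: sc| |].
  2: exact: (dominated_compress prho (dominated_bamp (M := E') sA st (fr_dom ft))).
  (* Cutting an amplification could lose faithfulness. It is recovered from the inner products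
     [adj x \o tau a \o y], which determine [a] and reappear in the faithful representation
     [rho]. *)
  move=> a Aa a0; have Aa' := sta_adj sA Aa; apply: (bimodule_faithful sA biX Aa) => x y Xx Xy.
  have [b Bb bE] := XB _ _ Xx (lX1 _ _ Aa Xy).
  suff b0 : b = 0 by rewrite -[LHS]bE b0 (rep0 (sta_linear sB) ss).
  apply: (fr_inj fr Bb); rewrite (wB _ _ _ Xx (lX1 _ _ Aa Xy) Bb bE).
  apply/funext => e /=; rewrite adjw//=.
  have -> : w (tau a \o y) e = compress (fun a => bamp (tau a)) p a (w y e).
    apply: pincl_inj; apply: (etrans (iw _ e (lX1 _ _ Aa Xy))).
    apply: (etrans _ (esym (pincl_compress prho (w y e) Aa))).
    apply: (etrans _ (congr1 (bamp (tau a)) (esym (iw _ e Xy)))).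
    by rewrite (bamp_comp (rep_bop st Aa) (bX _ Xy)).
  rewrite a0 -[(0 : _ -> prange p) _]/(0 : prange p) (bop0 bi).
  by rewrite (bop0 (bop_bamp (bop_adj (bX _ Xx)))) (bop0 (bop_adj bV)).
- exact: fr.
- by move=> _ [x Xx <-]; exact: bw.
- split.
    exists 0; first by case: lX.
    by apply/funext => e; rewrite /w /= bamp0 -[(0 : _ -> _) (V e)]/0 (bop0 bc).
  move=> c _ _ [x Xx <-] [y Xy <-]; exists (c *: x + y).
    by case: lX => _; apply.
  by rewrite /w (bamp_lin _ _ (bX _ Xx) (bX _ Xy)) comp_linl comp_linr.
- move=> a _ Aa [x Xx <-]; exists (tau a \o x); first exact: lX1.
  apply/funext => e; apply: pincl_inj.
  apply: (etrans (iw _ e (lX1 _ _ Aa Xx))).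
  apply: (etrans _ (esym (pincl_compress prho (w x e) Aa))).
  apply: (etrans _ (congr1 (bamp (tau a)) (esym (iw _ e Xx)))).
  by rewrite (bamp_comp (rep_bop st Aa) (bX _ Xx)).
- move=> _ b [x Xx <-] Bb; exists (x \o sigma b); first exact: rX1.
  apply/funext => e; rewrite /w /= (bamp_comp (bX _ Xx) (rep_bop ss Bb)) /=.
  by have /= -> := congr1 (@^~ e) (VE _ Bb).
- move=> _ _ [x Xx <-] [y Xy <-]; have [b Bb bE] := XB _ _ Xx Xy.
  by exists b; [exact: Bb|exact: wB].
- move=> _ _ [x Xx <-] [y Xy <-]; have [a Aa aE] := XA _ _ Xx Xy; exists a; first exact: Aa.
  have bta := rep_bop st Aa.
  suff key f : compress (fun a => bamp (tau a)) p a (pcut p f) =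
      w x (adj V (bamp (adj y) (p f))).
    apply/funext => l; apply: (etrans (congr1 _ (esym (pinclK l)))).
    apply: (etrans (key _)).
    apply: (etrans _ (congr1 (w x) (congr1 (@^~ l) (esym (adjw _ Xy))))).
    exact: (congr1 (fun f => w x (adj V (bamp (adj y) f))) (proj_pincl l)).
  apply: (etrans (compress_pcut sA stb prho f Aa)).
  pose S := @pcut _ _ p \o (bamp (tau a) \o p).
  pose T := w x \o adj V \o bamp (adj y) \o p.
  have bp := @proj_bounded _ _ p.
  have -> : pcut p (bamp (tau a) f) = S f.
    exact: (esym (compress_pcut sA stb prho f Aa)).
  rewrite -[RHS]/(T f).
  have -> : S f = S (p f) by exact: (congr1 (fun h => pcut p (bamp (tau a) h)) (esym (projK p f))).
  have -> : T f = T (p f) by exact: (congr1 (fun h => w x (adj V (bamp (adj y) h))) (esym (projK p f))).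
  have bS : bounded_op S by apply: bop_comp bc (bop_comp (bop_bamp bta) bp).
  have bT : bounded_op T.
    by apply: bop_comp bp; apply: bop_comp (bop_bamp (bop_adj (bX _ Xy))); apply: bop_comp (bw _ Xx) (bop_adj bV).
  (* On a generator [bamp z (V e)] the product [adj y \o z] is some [sigma b], which [V] exchanges
     with [rho b]; both sides are then the cut of [bamp (x \o adj y \o z) (V e)]. *)
  apply: (bop_span_eq bS bT _ (prj_span G f)) => _ [z Xz [e ->]].
  apply: (etrans (congr1 (fun h => pcut p (bamp (tau a) h)) (pG z e Xz))).
  apply: (etrans _ (congr1 (fun h => w x (adj V (bamp (adj y) h))) (esym (pG z e Xz)))).
  have [b Bb bE] := XB _ _ Xy Xz.
  rewrite -[bamp (adj y) _]/((bamp (adj y) \o bamp z) (V e)).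
  rewrite -(bamp_comp (bop_adj (bX _ Xy)) (bX _ Xz)) -bE.
  have /= <- := congr1 (@^~ e) (VE _ Bb); rewrite VK.
  rewrite /w /=; have /= -> := congr1 (@^~ e) (VE _ Bb).
  rewrite -[bamp x _]/((bamp x \o bamp (sigma b)) (V e)) -(bamp_comp (bX _ Xx) (rep_bop ss Bb)).
  rewrite -[bamp (tau a) _]/((bamp (tau a) \o bamp z) (V e)) -(bamp_comp bta (bX _ Xz)).
  by rewrite aE bE.
- move=> l lX0; rewrite -(pinclK l); set f := pincl l.
  have -> : pcut p f = pcut p (p f) by apply: pincl_inj; rewrite !pcutK projK.
  suff -> : p f = 0 by exact: bop0 bc.
  apply: prj_eq0 => _ [x Xx [e ->]].
  rewrite -[V e]/(V e) -(iw _ _ Xx) pincl_inner (adjP (bw _ Xx)) lX0 ?inner0r//.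
Qed.

Theorem embeds_in_trans H K L (A : set (H -> H)) (B : set (K -> K)) (C : set (L -> L)) :
  vna A -> vna B -> vna C -> embeds_in A B -> embeds_in B C -> embeds_in A C.
Proof.
move=> vA vB vC [F [E [tau [sigma [X biX]]]]] [E' [N [sigma' [rho [Y biY]]]]].
have [F' [tau' [X' biX']]] := bimodule_change vA vB biX (bi_tau biY).
exists F', N, tau', rho, (span [set x \o y | x in X' & y in Y]).
exact: (bimodule_comp (vna_star vA) (vna_star vC) biX' biY).
Qed.

End ChangeOfRepresentation.

(** * Passing between TROs and bimodules *)

Section DeltaEmbeddings.
Variable R : realType.
Implicit Types H K L E F : hilbertType R.

Lemma wspan_eq0 H K (S : set (H -> K)) T h : S `<=` @bounded_op R H K -> wspan S T ->
  (forall s, S s -> s h = 0) -> T h = 0.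
Proof.
move=> bS /(wspanP _ bS)[bT TP] Sh; apply: inner_extl => y; rewrite inner0l.
have E s : bounded_op s -> inner (famp s (ell2_dirac (H := fun=> H) (i := 0%N) h))
    (ell2_dirac (H := fun=> K) (i := 0%N) y) = inner (s h) y.
  by move=> bs; rewrite famp_dirac// inner_dirac dirac_in.
rewrite -E//; apply: TP => s Ss; rewrite E; last exact: bS.
by rewrite Sh// inner0l.
Qed.

(** The adjoint of a TRO element, precomposed with [pcut p], is an operator [E -> F]. [M] is not
    given as a module over the algebras, so these operators are saturated by [tau A] and [sigma B];
    the two TRO identities put the inner products in the right algebras. *)
Lemma delta_embeds_bimodule H K (A : set (H -> H)) (B : set (K -> K)) : vna A -> vna B ->
  delta_embeds A B -> embeds_in A B.
Proof.
move=> vA vB [E [F [sigma [tau [hs ht [[_ it] [_ is_] [p pB [M [[lM bM tM] AE CE]]]]]]]]].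
have fs := wstar_ci_hom_frep vB hs is_; have ft := wstar_ci_hom_frep vA ht it.
have [sA sB] := (vna_star vA, vna_star vB).
have [st ss] := (fr_rep ft, fr_rep fs).
have [lA lB] := (star_algebra_image sA st, star_algebra_image sB ss).
have bi := @bop_pincl _ _ p; have bc := @bop_pcut _ _ p.
have bcor : corner p (sigma @` B) `<=` @bounded_op R _ _.
  move=> T [_ [b Bb <-] TE].
  have -> : T = @pcut _ _ p \o sigma b \o @pincl _ _ p by apply/funext => x; apply: pincl_inj; exact: TE.
  by apply: bop_comp bi; apply: bop_comp bc (rep_bop ss Bb).
have badjM : adjset M `<=` @bounded_op R _ _.
  by move=> T [m Mm mT]; rewrite (adj_uniq (bM _ Mm) mT); exact/bop_adj/bM.
have adjM m : M m -> adjset M (adj m) by move=> Mm; exists m => //; exact: adjP (bM _ Mm).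
have b1 : mulset (adjset M) (mulset (corner p (sigma @` B)) M) `<=` @bounded_op R _ _.
  move=> _ [m Mm [_ [T cT [m' Mm' <-]] <-]].
  by apply: bop_comp (badjM _ Mm) _; apply: bop_comp (bcor _ cT) (bM _ Mm').
have b2 : mulset M (mulset (tau @` A) (adjset M)) `<=` @bounded_op R _ _.
  move=> _ [m Mm [_ [T [a Aa <-] [m' Mm' <-]] <-]].
  by apply: bop_comp (bM _ Mm) _; apply: bop_comp (rep_bop st Aa) (badjM _ Mm').
have sub K1 K2 (S : set (K1 -> K2)) : S `<=` @bounded_op R _ _ -> S `<=` wspan S.
  by move=> bS T ST; apply/(wspanP _ bS); split=> [|X Y]; [exact: bS|apply].
pose q m a b : E -> F := tau a \o (adj m \o @pcut _ _ p) \o sigma b.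
pose X := [set x | exists m, exists a, exists b, [/\ M m, A a, B b & x = q m a b]].
have bq m a b : M m -> A a -> B b -> bounded_op (q m a b).
  move=> Mm Aa Bb; apply: bop_comp (rep_bop ss Bb); apply: bop_comp (rep_bop st Aa) _.
  exact: bop_comp (bop_adj (bM _ Mm)) bc.
have adjq m a b : M m -> A a -> B b ->
    adj (q m a b) = sigma (adj b) \o (@pincl _ _ p \o m) \o tau (adj a).
  move=> Mm Aa Bb; have [ba bb] := (rep_bop st Aa, rep_bop ss Bb).
  have bmc := bop_comp (bop_adj (bM _ Mm)) bc.
  rewrite (adj_comp (bop_comp ba bmc) bb) (adj_comp ba bmc) (adj_comp (bop_adj (bM _ Mm)) bc).
  by rewrite (adjK (bM _ Mm)) adj_pcut (rep_adj st Aa) (rep_adj ss Bb).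
have [b0 Bb0 b0p] := pB.
exists F, E, tau, sigma, (span X); apply: bimodule_span => //.
- by move=> _ [m [a [b [Mm Aa Bb ->]]]]; exact: bq.
- move=> a _ Aa [m [a' [b [Mm Aa' Bb ->]]]]; exists m, (a \o a'), b; split=> //.
    exact: (sta_comp sA).
  by rewrite /q (rep_comp st).
- move=> _ b [m [a [b' [Mm Aa Bb' ->]]]] Bb; exists m, a, (b' \o b); split=> //.
    exact: (sta_comp sB).
  by rewrite /q (rep_comp ss).
- move=> _ _ [m [a [b [Mm Aa Bb ->]]]] [m' [a' [b' [Mm' Aa' Bb' ->]]]].
  have Aa1 := sta_adj sA Aa; have Bb1 := sta_adj sB Bb.
  have Aa2 := sta_comp sA Aa1 Aa'.
  have : corner p (sigma @` B) (m \o (tau (adj a \o a') \o adj m')).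
    rewrite CE; apply: (sub _ _ _ b2); exists m => //.
    exists (tau (adj a \o a') \o adj m') => //; exists (tau (adj a \o a')); first by exists (adj a \o a').
    by exists (adj m') => //; exact: adjM.
  move=> [_ [c Bc <-] cE].
  (* An element of the corner, extended by [0], is [p \o sigma c \o p], and [p] is [sigma b0]. *)
  have B1 : B (adj b \o b0 \o c \o b0 \o b') by do 4 (apply: (sta_comp sB) => //).
  exists (adj b \o b0 \o c \o b0 \o b') => //.
  rewrite (adjq _ _ _ Mm Aa Bb).
  have B2 : B (adj b \o b0) by exact: (sta_comp sB).
  have B3 : B (adj b \o b0 \o c) by exact: (sta_comp sB).
  have B4 : B (adj b \o b0 \o c \o b0) by exact: (sta_comp sB).
  rewrite (rep_comp ss B4 Bb') (rep_comp ss B3 Bb0) (rep_comp ss B2 Bc) (rep_comp ss Bb1 Bb0) b0p.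
  apply/funext => e; rewrite /q /=; congr (sigma (adj b) _).
  have := cE (pcut p (sigma b' e)).
  rewrite (rep_comp st Aa1 Aa').
  by move=> /esym.
- move=> _ _ [m [a [b [Mm Aa Bb ->]]]] [m' [a' [b' [Mm' Aa' Bb' ->]]]].
  have Aa1 := sta_adj sA Aa'; have Bb1 := sta_adj sB Bb'.
  have Bb2 := sta_comp sB Bb Bb1.
  pose T := @pcut _ _ p \o sigma (b \o adj b') \o @pincl _ _ p.
  have cT : corner p (sigma @` B) T.
    by exists (sigma (b \o adj b')); [exists (b \o adj b')|].
  have : (tau @` A) (adj m \o (T \o m')).
    rewrite AE; apply: (sub _ _ _ b1); exists (adj m); first exact: adjM.
    by exists (T \o m') => //; exists T => //; exists m'.
  move=> [c Ac cE]; have A2 := sta_comp sA Aa Ac.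
  exists (a \o c \o adj a'); first exact: (sta_comp sA).
  rewrite (adjq _ _ _ Mm' Aa' Bb') (rep_comp st A2 Aa1) (rep_comp st Aa Ac) cE /q.
  by rewrite /T (rep_comp ss Bb Bb1).
- move=> l lX.
  have Ml m : M m -> m l = 0.
    move=> Mm; have := lX (q m idfun idfun); rewrite (adjq _ _ _ Mm (sta_id sA) (sta_id sB)).
    rewrite !adj_id (rep_id st) (rep_id ss) /= => h; apply: pincl_inj; rewrite h.
      by rewrite (bop0 bi).
    by exists m, idfun, idfun; split=> //; [exact: sta_id sA|exact: sta_id sB].
  (* The unit is in the weak-star span of products whose right factor is in [M], so a vector killed
     by [M] is [0]. *)
  have : wspan (mulset (adjset M) (mulset (corner p (sigma @` B)) M)) idfun by rewrite -AE.
  move=> /(wspan_eq0 (h := l) b1); apply => _ [m Mm [_ [T cT [m' Mm' <-]] <-]] /=.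
  by rewrite Ml// (bop0 (bcor _ cT)) (bop0 (badjM _ Mm)).
Qed.

(** The range projection [e] of [J] is in [P], and [J] kills [1 - e]; so [e] is the identity, and by
    [unit_limit] a functional vanishing on [J] vanishes there. *)
Lemma ideal_dense H (P J : set (H -> H)) : vna P -> J `<=` P ->
  (forall a j, P a -> J j -> J (a \o j)) -> (forall j, J j -> J (adj j)) ->
  (forall a, P a -> (forall j, J j -> j \o a = 0) -> a = 0) -> wspan J = P.
Proof.
move=> vP JP PJ Ja J0; have sP := vna_star vP; have bP := sta_bop sP.
apply: wspan_eq => // X Y JXY a Pa; have ba := bP _ Pa.
have bJ := subset_trans JP bP.
have JJ i j : J i -> J j -> J (i \o j) by move=> /JP; exact: PJ.
(* Moving [a] into the second vector reduces its case to that of the identity, as [J] is a left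
   ideal. *)
have JXY' j : J j -> inner (famp j X) (famp (adj a) Y) = 0.
  move=> Jj; rewrite -(adj_famp ba) -(adjP (bop_famp ba)).
  rewrite -[famp a _]/((famp a \o famp j) X) -(famp_comp ba (bJ _ Jj)).
  by apply: JXY; exact: PJ.
have := unit_limit bJ JJ Ja JXY'; have := unit_mem vP JP JJ Ja.
set e := prj _ => Pe; have -> : (e : H -> H) = idfun.
  suff e0 : -1 *: (e : H -> H) + idfun = 0.
    apply/funext => h; apply/esym/eqP; rewrite -subr_eq0 addrC -scaleN1r.
    by rewrite -[_ + _]/((-1 *: (e : H -> H) + idfun) h) e0.
  apply: J0 => [|j Jj]; first exact: (star_algebra_lin (-1) sP Pe (sta_id sP)).
  apply/funext => h; apply: inner_extr => z; rewrite [in RHS]/= inner0r.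
  rewrite -[(j \o _) h]/(j (-1 *: e h + h)) scaleN1r addrC.
  rewrite (adjPr (bJ _ Jj)); apply: prj_orth.
  by exists (adj j); [exact: Ja|exists z].
by rewrite famp_id -(adj_famp ba) -(adjP (bop_famp ba)).
Qed.

Lemma adjset_adjs E F (M : set (E -> F)) : M `<=` @bounded_op R E F -> adjset M = adjs M.
Proof.
move=> bM; apply/seteqP; split=> [T [m Mm mT]|_ [m Mm <-]].
  by exists m => //; apply/esym/adj_uniq => //; exact: bM.
by exists m => //; exact: adjP (bM _ Mm).
Qed.

Lemma adjs_bop E F (M : set (E -> F)) : M `<=` @bounded_op R E F ->
  adjs M `<=` @bounded_op R F E.
Proof. by move=> bM _ [m Mm <-]; exact/bop_adj/bM. Qed.

Lemma adjsK E F (M : set (E -> F)) : M `<=` @bounded_op R E F -> adjs (adjs M) = M.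
Proof.
move=> bM; apply/seteqP; split=> [_ [_ [m Mm <-] <-]|m Mm].
  by rewrite adjK//; exact: bM.
by exists (adj m); [exists m|rewrite adjK//; exact: bM].
Qed.

(** The products form an ideal of [P] containing every [adj m \o m]; an element [a] annihilated by
    it has [m \o a = 0] for all [m], hence is [0] by fullness. *)
Lemma linking_dense F E (P : set (F -> F)) (Q : set (E -> E)) (M : set (F -> E)) :
  vna P -> star_algebra Q -> M `<=` @bounded_op R F E ->
  (forall m p, M m -> P p -> M (m \o p)) -> (forall q m, Q q -> M m -> M (q \o m)) ->
  (forall m n, M m -> M n -> P (adj m \o n)) -> full M ->
  P = wspan (mulset (adjs M) (mulset Q M)).
Proof.
move=> vP sQ bM MP QM MM fM; have sP := vna_star vP; have bP := sta_bop sP.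
have bQ := sta_bop sQ.
apply/esym/ideal_dense => //.
- by move=> _ [_ [m Mm <-] [_ [q Qq [n Mn <-]] <-]]; apply: MM => //; exact: QM.
- move=> a _ Pa [_ [m Mm <-] [_ [q Qq [n Mn <-]] <-]].
  have Pa' := sta_adj sP Pa.
  exists (a \o adj m); last by exists (q \o n) => //; exists q => //; exists n.
  exists (m \o adj a); first exact: MP.
  by rewrite adj_comp ?adjK//; [exact: bP|exact: bM|exact/bop_adj/bP].
- move=> _ [_ [m Mm <-] [_ [q Qq [n Mn <-]] <-]].
  have [bm bn bq] := And3 (bM _ Mm) (bM _ Mn) (bQ _ Qq).
  exists (adj n); first by exists n.
  exists (adj q \o m).
    by exists (adj q); [exact: (sta_adj sQ)|exists m].
  rewrite (adj_comp (bop_adj bm) (bop_comp bq bn)) (adj_comp bq bn) adjK//.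
- move=> a Pa a0; apply/funext => h; apply: fM => m Mm; apply: innerxx_eq0.
  rewrite (adjP (bM _ Mm)) (_ : adj m (m (a h)) = 0) ?inner0r//.
  apply: (congr1 (@^~ h) (a0 (adj m \o (idfun \o m)) _)); exists (adj m); first by exists m.
  by exists (idfun \o m) => //; exists idfun; [exact: sta_id sQ|exists m].
Qed.

Lemma bimodule_TRO F E (P : set (F -> F)) (Q : set (E -> E)) (M : set (F -> E)) :
  vna P -> vna Q -> M `<=` @bounded_op R F E -> linear_set M ->
  (forall m p, M m -> P p -> M (m \o p)) -> (forall q m, Q q -> M m -> M (q \o m)) ->
  (forall m n, M m -> M n -> P (adj m \o n)) ->
  (forall m n, M m -> M n -> Q (m \o adj n)) -> full M -> total M -> TRO_equiv P Q.
Proof.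
move=> vP vQ bM lM MP QM PM MQ fM tM; have [sP sQ] := (vna_star vP, vna_star vQ).
exists M; rewrite adjset_adjs//; split.
- split=> //; rewrite adjset_adjs// => _ [m Mm [_ [_ [n Mn <-] [k Mk <-]] <-]].
  by apply: MP => //; exact: PM.
- exact: linking_dense.
- rewrite -{1}(adjsK bM); apply: linking_dense => //.
  + exact: adjs_bop.
  + move=> _ q [m Mm <-] Qq; exists (adj q \o m); first by apply: QM => //; exact: (sta_adj sQ).
    have bq := sta_bop sQ Qq.
    by rewrite (adj_comp (bop_adj bq) (bM _ Mm)) adjK.
  + move=> p _ Pp [m Mm <-]; exists (m \o adj p); first by apply: MP => //; exact: (sta_adj sP).
    have bp := sta_bop sP Pp.
    by rewrite (adj_comp (bM _ Mm) (bop_adj bp)) adjK.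
  + by move=> _ _ [m Mm <-] [n Mn <-]; rewrite adjK; [exact: MQ|exact: bM].
  + by move=> k kM; apply: tM => m Mm; apply: kM; exists m.
Qed.

Lemma vna_corner E (Q : set (E -> E)) (z : projection E) : vna Q -> Q z -> vna (corner z Q).
Proof.
move=> vQ Qz; have sQ := vna_star vQ; have bQ := sta_bop sQ.
have bi := @bop_pincl _ _ z; have bc := @bop_pcut _ _ z.
(* Membership in the corner is membership in [Q] after extension by [0]; correspondingly, a
   functional of [Q] restricts to the corner by cutting both of its vectors. *)
have corP T : corner z Q T <-> Q (@pincl _ _ z \o T \o @pcut _ _ z).
  split=> [[a Qa TE]|QT].
    have -> : @pincl _ _ z \o T \o @pcut _ _ z = z \o a \o z.
      by apply/funext => h; exact: TE.
    by apply: (sta_comp sQ) => //; exact: (sta_comp sQ).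
  exists (@pincl _ _ z \o T \o @pcut _ _ z) => // x.
  by rewrite /= pinclK [RHS]proj_pincl.
have bcor : corner z Q `<=` @bounded_op R _ _.
  move=> T /corP/bQ bT.
  have -> : T = @pcut _ _ z \o (@pincl _ _ z \o T \o @pcut _ _ z) \o @pincl _ _ z.
    by apply/funext => x; rewrite /= !pinclK.
  by apply: bop_comp bi; exact: bop_comp bc bT.
have lcor : linear_set (corner z Q).
  have [Q0 _] := sta_linear sQ.
  split=> [|c S T /corP QS /corP QT]; apply/corP.
    by rewrite comp0r// comp0l.
  rewrite comp_linr// comp_linl; exact: (star_algebra_lin _ sQ).
split=> [|T /(wclosureP _ lcor bcor)[bT TP]].
  split=> //.
  - move=> S T /corP QS /corP QT; apply/corP.
    have -> : @pincl _ _ z \o (S \o T) \o @pcut _ _ z =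
        (@pincl _ _ z \o S \o @pcut _ _ z) \o (@pincl _ _ z \o T \o @pcut _ _ z).
      by apply/funext => h; rewrite /= pinclK.
    exact: (sta_comp sQ).
  - by exists z => // x; rewrite [RHS]projK [RHS](proj_pincl x).
  - move=> S cS; have bS := bcor _ cS; move/corP: cS => QS; apply/corP.
    have := sta_adj sQ QS; rewrite (adj_comp (bop_comp bi bS) bc) (adj_comp bi bS).
    by rewrite adj_pincl adj_pcut.
apply/corP/(vna_closed vQ)/(wclosureP _ (sta_linear sQ) bQ).
split=> [|X Y XY]; first by apply: bop_comp bc; exact: bop_comp.
have E' S : bounded_op S -> inner (famp (@pincl _ _ z \o S \o @pcut _ _ z) X) Y =
    inner (famp S (famp (@pcut _ _ z) X)) (famp (@pcut _ _ z) Y).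
  move=> bS; rewrite (famp_comp (bop_comp bi bS) bc) (famp_comp bi bS) /=.
  by rewrite (adjP (bop_famp bi)) adj_famp// adj_pincl.
rewrite E'//; apply: TP => S cS; rewrite -E'; last exact: bcor.
by apply: XY; exact/corP.
Qed.

Theorem full_delta_equiv H K (A : set (H -> H)) (B : set (K -> K)) F E
    (tau : (H -> H) -> F -> F) (sigma : (K -> K) -> E -> E) X :
  vna A -> vna B -> bimodule A B tau sigma X -> full X -> delta_equiv A B.
Proof.
move=> vA vB biX fX; have [ft fs bX lX lX1 rX1 XB XA tX] := biX.
have [sA sB] := (vna_star vA, vna_star vB).
exists F, E, tau, sigma; split; [exact: frep_wstar_ci_hom|exact: frep_wstar_ci_hom|].
have biS := bimodule_sym sA sB biX fX.
apply: (bimodule_TRO (M := adjs X)).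
- exact: frep_image_vna.
- exact: frep_image_vna.
- exact: bi_bop biS.
- exact: bi_lin biS.
- by move=> m _ Mm [a Aa <-]; exact: (bi_right biS).
- by move=> _ m [b Bb <-] Mm; exact: (bi_left biS).
- by move=> m n Mm Mn; have [a Aa aE] := bi_ipB biS Mm Mn; exists a.
- by move=> m n Mm Mn; have [a Aa aE] := bi_ipA biS Mm Mn; exists a.
- exact: full_adjs.
- exact: bi_total biS.
Qed.

(** The projection sought is the right support [z] of [X], the range projection of the products
    [adj x \o y]. Cut by [z], the bimodule becomes full and gives a TRO onto the corner. *)
Theorem embeds_in_delta H K (A : set (H -> H)) (B : set (K -> K)) :
  vna A -> vna B -> embeds_in A B -> delta_embeds A B.
Proof.
move=> vA vB [F [E [tau [sigma [X biX]]]]]; have [ft fs bX lX lX1 rX1 XB XA tX] := biX.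
have [sA sB] := (vna_star vA, vna_star vB).
have [vtA vsB] := (frep_image_vna vA ft, frep_image_vna vB fs).
have [st ss] := (fr_rep ft, fr_rep fs).
exists E, F, sigma, tau; split; [exact: frep_wstar_ci_hom|exact: frep_wstar_ci_hom|].
split; [exact: vna_unital_dual|exact: vna_unital_dual|].
pose J : set (E -> E) := [set j | exists x, exists y, [/\ X x, X y & j = adj x \o y]].
pose z := prj [set v | exists2 j, J j & exists h, v = j h].
have zJ : (sigma @` B) z.
  apply: unit_mem => //.
  - by move=> _ [x [y [Xx Xy ->]]]; have [b Bb bE] := XB _ _ Xx Xy; exists b.
  - move=> _ _ [x [y [Xx Xy ->]]] [x' [y' [Xx' Xy' ->]]].
    have [b Bb bE] := XB _ _ Xx' Xy'; exists x, (y \o sigma b); split=> //; first exact: rX1.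
    by rewrite bE.
  - move=> _ [x [y [Xx Xy ->]]]; exists y, x; split=> //.
    by rewrite (adj_comp (bop_adj (bX _ Xx)) (bX _ Xy)) adjK//; exact: bX.
have zX x l : X x -> z (adj x l) = adj x l.
  move=> Xx; have bx := bop_adj (bX _ Xx); have bz := @proj_bounded _ _ z.
  apply: (bop_span_eq (S := z \o adj x) (bop_comp bz bx) bx _ (total_adherent bX tX l)).
  move=> _ [y Xy [k ->]]; apply: prj_gen; exists (adj x \o y); last by exists k.
  by exists x, y.
have Xz x : X x -> x \o z = x.
  move=> Xx; apply/funext => k; apply: inner_extl => y.
  by rewrite !(adjP (bX _ Xx)) proj_inner zX.
have bi := @bop_pincl _ _ z; have bc := @bop_pcut _ _ z.
exists z => //; pose w (x : E -> F) := @pcut _ _ z \o adj x.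
have bw x : X x -> bounded_op (w x) by move=> Xx; exact: bop_comp bc (bop_adj (bX _ Xx)).
have adjw x : X x -> adj (w x) = x \o @pincl _ _ z.
  by move=> Xx; rewrite (adj_comp bc (bop_adj (bX _ Xx))) adj_pcut adjK//; exact: bX.
apply: (bimodule_TRO (M := w @` X)).
- by [].
- exact: vna_corner.
- by move=> _ [x Xx <-]; exact: bw.
- split; first by exists 0; [case: lX|rewrite /w adj0 comp0r].
  move=> c _ _ [x Xx <-] [y Xy <-]; exists (c^* *: x + y); first by case: lX => _; apply.
  rewrite /w adj_lin ?conjCK; [|exact: bX|exact: bX].
  by rewrite comp_linr.
- move=> _ _ [x Xx <-] [a Aa <-]; have Aa' := sta_adj sA Aa.
  exists (tau (adj a) \o x); first exact: lX1.
  rewrite /w (adj_comp (rep_bop st Aa') (bX _ Xx)) -(rep_adj st Aa') adjK//.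
  exact: (sta_bop sA).
- move=> T _ [_ [b Bb <-] TE] [x Xx <-]; have Bb' := sta_adj sB Bb.
  exists (x \o sigma (adj b)); first exact: rX1.
  rewrite /w (adj_comp (bX _ Xx) (rep_bop ss Bb')) -(rep_adj ss Bb') adjK; last exact: (sta_bop sB).
  apply/funext => l; apply: pincl_inj; apply: (etrans _ (esym (TE _))).
  exact: (congr1 (fun e => z (sigma b e)) (esym (zX _ _ Xx))).
- move=> _ _ [x Xx <-] [y Xy <-]; rewrite adjw//.
  have [a Aa aE] := XA _ _ Xx Xy; exists a => //; rewrite aE.
  by apply/funext => l; exact: (congr1 x (esym (zX _ _ Xy))).
- move=> _ _ [x Xx <-] [y Xy <-]; rewrite (adjw y)//.
  have [b Bb bE] := XB _ _ Xx Xy; exists (adj x \o y); first by exists b.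
  by move=> k.
- move=> l lX0; apply: tX => x Xx; rewrite -(zX _ _ Xx).
  have : w x l = 0 by apply: lX0; exists x.
  by move=> /(congr1 (@pincl _ _ z)).
- move=> k kX; apply: pincl_inj; rewrite (bop0 bi).
  rewrite -(proj_pincl k); apply: prj_eq0 => _ [_ [x [y [Xx Xy ->]]] [h ->]].
  rewrite /= (adjP (bop_adj (bX _ Xx))) adjK; last exact: bX.
  have := kX (w x); rewrite (adjw _ Xx) /= => ->; first by rewrite inner0r.
  by exists x.
Qed.

End DeltaEmbeddings.

(** * Direct sums cut by central projections *)

Section DirectSums.
Variable R : realType.
Implicit Types H K L M : hilbertType R.

Definition summand L1 L2 (b : bool) : hilbertType R := if b then L1 else L2.

Definition dsum L1 L2 : hilbertType R := ell2 (summand L1 L2).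

Definition pick_op L1 L2 K1 K2 (S : L1 -> K1) (T : L2 -> K2) (b : bool) :
    summand L1 L2 b -> summand K1 K2 b :=
  if b as b return summand L1 L2 b -> summand K1 K2 b then S else T.

Definition diag L1 L2 K1 K2 (S : L1 -> K1) (T : L2 -> K2) : dsum L1 L2 -> dsum K1 K2 :=
  amp (pick_op S T).

Definition fst_of L1 L2 (f : dsum L1 L2) : L1 := f true.
Definition snd_of L1 L2 (f : dsum L1 L2) : L2 := f false.

Lemma dsum_ext L1 L2 (f g : dsum L1 L2) :
  fst_of f = fst_of g -> snd_of f = snd_of g -> f = g.
Proof. by move=> fg1 fg2; apply: ell2_ext => -[]. Qed.

Section Diagonal.
Variables (L1 L2 K1 K2 : hilbertType R).
Implicit Types (S : L1 -> K1) (T : L2 -> K2).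

Lemma ubop_pick S T : bounded_op S -> bounded_op T -> ubop (pick_op S T).
Proof.
move=> bS bT; split=> [[]//|].
have [[c c0 Sc] [d d0 Td]] := (bop_bound bS, bop_bound bT).
exists (c + d) => [|[] x]; first exact: addr_ge0.
  by rewrite (le_trans (Sc x))// ler_wpM2r ?hnorm_ge0// lerDl.
by rewrite (le_trans (Td x))// ler_wpM2r ?hnorm_ge0// lerDr.
Qed.

Lemma fst_diag S T f : bounded_op S -> bounded_op T -> fst_of (diag S T f) = S (fst_of f).
Proof. by move=> bS bT; exact: (ampE f true (ubop_pick bS bT)). Qed.

Lemma snd_diag S T f : bounded_op S -> bounded_op T -> snd_of (diag S T f) = T (snd_of f).
Proof. by move=> bS bT; exact: (ampE f false (ubop_pick bS bT)). Qed.

Lemma bop_diag S T : bounded_op S -> bounded_op T -> bounded_op (diag S T).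
Proof. by move=> bS bT; exact/bop_amp/ubop_pick. Qed.

Lemma diag_lin (c : R[i]) S S' T T' : bounded_op S -> bounded_op S' ->
  bounded_op T -> bounded_op T' ->
  diag (c *: S + S') (c *: T + T') = c *: diag S T + diag S' T'.
Proof.
move=> bS bS' bT bT'; have [bSS bTT] := (bop_lin c bS bS', bop_lin c bT bT').
apply/funext => f; apply: dsum_ext.
  rewrite fst_diag// /fst_of fun_linE ell2_addE ell2_scaleE -!/(fst_of _).
  by rewrite !fst_diag.
rewrite snd_diag// /snd_of fun_linE ell2_addE ell2_scaleE -!/(snd_of _).
by rewrite !snd_diag.
Qed.

Lemma diag_inj S S' T T' : bounded_op S -> bounded_op S' ->
  bounded_op T -> bounded_op T' -> diag S T = diag S' T' -> S = S' /\ T = T'.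
Proof.
move=> bS bS' bT bT' E; split; apply/funext => h.
  pose f : dsum L1 L2 := ell2_dirac (H := summand L1 L2) (i := true) h.
  have f1 : fst_of f = h := dirac_in (H := summand L1 L2) (i := true) h.
  have := congr1 (fun D => fst_of (D f)) E.
  by rewrite /= !fst_diag// f1.
pose f : dsum L1 L2 := ell2_dirac (H := summand L1 L2) (i := false) h.
have f1 : snd_of f = h := dirac_in (H := summand L1 L2) (i := false) h.
have := congr1 (fun D => snd_of (D f)) E.
by rewrite /= !snd_diag// f1.
Qed.

End Diagonal.

Lemma diag_comp L1 L2 K1 K2 M1 M2 (S : K1 -> M1) (T : K2 -> M2) (S' : L1 -> K1)
    (T' : L2 -> K2) : bounded_op S -> bounded_op T -> bounded_op S' -> bounded_op T' ->
  diag (S \o S') (T \o T') = diag S T \o diag S' T'.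
Proof.
move=> bS bT bS' bT'; have [b1 b2] := (bop_comp bS bS', bop_comp bT bT').
apply/funext => f; apply: dsum_ext.
  by rewrite fst_diag//= !fst_diag.
by rewrite snd_diag//= !snd_diag.
Qed.

Lemma adj_diag L1 L2 K1 K2 (S : L1 -> K1) (T : L2 -> K2) : bounded_op S -> bounded_op T ->
  adj (diag S T) = diag (adj S) (adj T).
Proof.
move=> bS bT; rewrite /diag adj_amp; last exact: ubop_pick.
by congr (amp _); apply: functional_extensionality_dep => -[].
Qed.

Lemma diag_id L1 L2 : diag (idfun : L1 -> L1) (idfun : L2 -> L2) = idfun.
Proof.
have [b1 b2] := (bop_id L1, bop_id L2).
by apply/funext => f; apply: dsum_ext; rewrite ?fst_diag ?snd_diag.
Qed.

Lemma dsum_dirac L1 L2 (f : dsum L1 L2) :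
  f = ell2_dirac (H := summand L1 L2) (i := true) (f true) +
      ell2_dirac (H := summand L1 L2) (i := false) (f false).
Proof.
by apply: ell2_ext => -[]; rewrite ell2_addE !dirac_in !dirac_out// ?addr0 ?add0r.
Qed.

Section SumRepresentation.
Variables (H : hilbertType R) (A : set (H -> H)) (sA : star_algebra A).
Variables (L1 L2 : hilbertType R) (rho1 : (H -> H) -> L1 -> L1) (rho2 : (H -> H) -> L2 -> L2).
Hypotheses (f1 : frep A rho1) (f2 : frep A rho2).

Definition sum_rep (a : H -> H) : dsum L1 L2 -> dsum L1 L2 := diag (rho1 a) (rho2 a).

Let s1 := fr_rep f1.
Let s2 := fr_rep f2.

Lemma star_rep_sum : star_rep A sum_rep.
Proof.
split=> [a Aa|c a b Aa Ab|a b Aa Ab||a Aa]; rewrite /sum_rep.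
- exact: bop_diag (rep_bop s1 Aa) (rep_bop s2 Aa).
- rewrite (rep_lin s1)// (rep_lin s2)//.
  exact: diag_lin (rep_bop s1 Aa) (rep_bop s1 Ab) (rep_bop s2 Aa) (rep_bop s2 Ab).
- rewrite (rep_comp s1)// (rep_comp s2)//.
  exact: diag_comp (rep_bop s1 Aa) (rep_bop s2 Aa) (rep_bop s1 Ab) (rep_bop s2 Ab).
- by rewrite (rep_id s1) (rep_id s2) diag_id.
- rewrite (rep_adj s1)// (rep_adj s2)// -(adj_diag (rep_bop s1 Aa) (rep_bop s2 Aa)).
  by [].
Qed.

Lemma dominated_sum : dominated A id sum_rep.
Proof.
move=> f.
have h1 : domvec A id sum_rep (ell2_dirac (H := summand L1 L2) (i := true) (f true) : dsum L1 L2).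
  have [X hX] := fr_dom f1 (f true); exists X => a Aa.
  have [b1 b2] := (rep_bop s1 Aa, rep_bop s2 Aa).
  rewrite (_ : sum_rep a _ = ell2_dirac (H := summand L1 L2) (i := true) (rho1 a (f true))).
    by rewrite hnorm_dirac hX.
  apply: ell2_ext => -[]; rewrite /sum_rep /diag (ampE _ _ (ubop_pick b1 b2)) ?dirac_in//.
  by rewrite !dirac_out//; exact: (bop0 b2).
have h2 : domvec A id sum_rep (ell2_dirac (H := summand L1 L2) (i := false) (f false) : dsum L1 L2).
  have [X hX] := fr_dom f2 (f false); exists X => a Aa.
  have [b1 b2] := (rep_bop s1 Aa, rep_bop s2 Aa).
  rewrite (_ : sum_rep a _ = ell2_dirac (H := summand L1 L2) (i := false) (rho2 a (f false))).
    by rewrite hnorm_dirac hX.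
  apply: ell2_ext => -[]; rewrite /sum_rep /diag (ampE _ _ (ubop_pick b1 b2)) ?dirac_in//.
  by rewrite !dirac_out//; exact: (bop0 b1).
have := linear_setD (domvec_linear (star_rep_id sA) star_rep_sum) h1 h2.
by rewrite -dsum_dirac.
Qed.

Record central_projection (s : H -> H) : Prop := {
  cp_mem : A s ;
  cp_idem : s \o s = s ;
  cp_adj : adj s = s ;
  cp_comm : forall a, A a -> a \o s = s \o a
}.

Variables s1' s2' : H -> H.
Hypotheses (c1 : central_projection s1') (c2 : central_projection s2').
Hypotheses (s12 : s1' \o s2' = 0) (s1D2 : 1 *: s1' + s2' = idfun).

Lemma cut_exists : exists p : projection (dsum L1 L2), p = diag (rho1 s1') (rho2 s2') :> (_ -> _).
Proof.
have [b1 b2] := (rep_bop s1 (cp_mem c1), rep_bop s2 (cp_mem c2)).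
have h1 : diag (rho1 s1') (rho2 s2') \o diag (rho1 s1') (rho2 s2') = diag (rho1 s1') (rho2 s2').
  rewrite -diag_comp// -(rep_comp s1 (cp_mem c1) (cp_mem c1)) -(rep_comp s2 (cp_mem c2) (cp_mem c2)).
  by rewrite (cp_idem c1) (cp_idem c2).
have h2 : adjoint (diag (rho1 s1') (rho2 s2')) (diag (rho1 s1') (rho2 s2')).
  move=> x y; rewrite (adjP (bop_diag b1 b2)) adj_diag//.
  rewrite -(rep_adj s1 (cp_mem c1)) -(rep_adj s2 (cp_mem c2)).
  by rewrite (cp_adj c1) (cp_adj c2).
by exists (Projection (bop_diag b1 b2) h1 h2).
Qed.

Variable p : projection (dsum L1 L2).
Hypothesis pE : p = diag (rho1 s1') (rho2 s2') :> (_ -> _).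

Lemma cut_comm a1 a2 : A a1 -> A a2 -> forall f,
  p (diag (rho1 a1) (rho2 a2) (p f)) = diag (rho1 a1) (rho2 a2) (p f).
Proof.
move=> Aa1 Aa2 f; rewrite pE.
have [b1 b2] := (rep_bop s1 (cp_mem c1), rep_bop s2 (cp_mem c2)).
have [d1 d2] := (rep_bop s1 Aa1, rep_bop s2 Aa2).
suff -> : diag (rho1 a1) (rho2 a2) (diag (rho1 s1') (rho2 s2') f) =
    diag (rho1 s1') (rho2 s2') (diag (rho1 a1) (rho2 a2) f).
  by rewrite -[LHS]/((diag (rho1 s1') (rho2 s2') \o diag (rho1 s1') (rho2 s2')) _) -pE proj_idem.
rewrite -[LHS]/((diag (rho1 a1) (rho2 a2) \o diag (rho1 s1') (rho2 s2')) f).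
rewrite -[RHS]/((diag (rho1 s1') (rho2 s2') \o diag (rho1 a1) (rho2 a2)) f).
rewrite -!diag_comp// -(rep_comp s1)//; last exact: cp_mem.
rewrite -(rep_comp s2)//; last exact: cp_mem.
rewrite (cp_comm c1)// (cp_comm c2)//.
by rewrite (rep_comp s1 (cp_mem c1) Aa1) (rep_comp s2 (cp_mem c2) Aa2).
Qed.

(** Faithfulness: an element acting as [0] on the cut satisfies [a \o s1' = 0] and [a \o s2' = 0],
    and these projections add up to the identity. *)
Lemma frep_cut : frep A (compress sum_rep p).
Proof.
have pr a : A a -> forall f, p (sum_rep a (p f)) = sum_rep a (p f).
  by move=> Aa; exact: cut_comm.
split; [exact: star_rep_compress star_rep_sum pr| |exact: (dominated_compress pr dominated_sum)].
move=> a Aa a0.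
have [b1 b2] := (rep_bop s1 (cp_mem c1), rep_bop s2 (cp_mem c2)).
have [d1 d2] := (rep_bop s1 Aa, rep_bop s2 Aa).
have : diag (rho1 (a \o s1')) (rho2 (a \o s2')) = diag (0 : L1 -> L1) (0 : L2 -> L2).
  rewrite (rep_comp s1 Aa (cp_mem c1)) (rep_comp s2 Aa (cp_mem c2)).
  rewrite diag_comp// -pE; apply/funext => f.
  have -> : diag (0 : L1 -> L1) (0 : L2 -> L2) f = 0.
    by apply: dsum_ext; rewrite ?fst_diag ?snd_diag//; exact: bop_cst0.
  apply: (etrans (congr1 (sum_rep a) (pcutK p f))).
  apply: (etrans (esym (pincl_compress pr (pcut p f) Aa))).
  by rewrite a0.
have [e1 e2] := (sta_comp sA Aa (cp_mem c1), sta_comp sA Aa (cp_mem c2)).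
move=> /(diag_inj (rep_bop s1 e1) (@bop_cst0 _ _ _) (rep_bop s2 e2) (@bop_cst0 _ _ _)).
move=> [/(fr_inj f1 e1) as1 /(fr_inj f2 e2) as2].
have -> : a = a \o (1 *: s1' + s2') by rewrite s1D2.
rewrite comp_linr; last exact: (sta_bop sA).
by rewrite as1 as2 scaler0 addr0.
Qed.

(** On the cut the pair of [a1] and [a2] acts as the single element [a1 s1' + a2 s2']. This is
    needed because the summands of a direct sum of bimodules produce unrelated inner products. *)
Lemma cut_combine a1 a2 : A a1 -> A a2 -> exists2 a, A a &
  compress sum_rep p a = @pcut _ _ p \o diag (rho1 a1) (rho2 a2) \o @pincl _ _ p.
Proof.
move=> Aa1 Aa2; pose a := 1 *: (a1 \o s1') + (a2 \o s2').
have [S1 S2] := (cp_mem c1, cp_mem c2).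
have [e1 e2] := (sta_comp sA Aa1 S1, sta_comp sA Aa2 S2).
have Aa : A a := star_algebra_lin 1 sA e1 e2.
have s21 : s2' \o s1' = 0 by rewrite (cp_comm c1 S2).
have [ba1 ba2] := (sta_bop sA Aa1, sta_bop sA Aa2).
have as1 : a \o s1' = a1 \o s1'.
  rewrite /a comp_linl -[a1 \o s1' \o s1']/(a1 \o (s1' \o s1')) (cp_idem c1).
  by rewrite -[a2 \o s2' \o s1']/(a2 \o (s2' \o s1')) s21 comp0r// scale1r addr0.
have as2 : a \o s2' = a2 \o s2'.
  rewrite /a comp_linl -[a2 \o s2' \o s2']/(a2 \o (s2' \o s2')) (cp_idem c2).
  by rewrite -[a1 \o s1' \o s2']/(a1 \o (s1' \o s2')) s12 comp0r// scaler0 add0r.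
exists a => //.
suff E : sum_rep a \o p = diag (rho1 a1) (rho2 a2) \o p.
  apply/funext => k; apply: (congr1 (pcut p)).
  rewrite -(proj_pincl k); exact: (congr1 (@^~ (pincl k)) E).
have [b1 b2] := (rep_bop s1 S1, rep_bop s2 S2).
rewrite pE /sum_rep -!diag_comp; try by [|exact: (rep_bop s1)|exact: (rep_bop s2)].
rewrite -(rep_comp s1 Aa S1) -(rep_comp s2 Aa S2) as1 as2.
by rewrite (rep_comp s1 Aa1 S1) (rep_comp s2 Aa2 S2).
Qed.

End SumRepresentation.
End DirectSums.

(** * The Cantor-Bernstein argument *)

Section CantorBernstein.
Variable R : realType.
Implicit Types H K L E F : hilbertType R.

Lemma subr_mem H (A : set (H -> H)) s : star_algebra A -> A s -> A (-1 *: s + idfun).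
Proof. by move=> sA As; exact: (star_algebra_lin (-1) sA As (sta_id sA)). Qed.

Record ideal_unit H (A S : set (H -> H)) (s : H -> H) : Prop := {
  iu_cp : central_projection A s ;
  iu_mem : S s ;
  iu_mul : forall a, S a -> a \o s = a
}.

Lemma central_compl H (A : set (H -> H)) s : star_algebra A -> central_projection A s ->
  [/\ central_projection A (-1 *: s + idfun), s \o (-1 *: s + idfun) = 0 &
    (-1 *: s + idfun) \o s = 0].
Proof.
move=> sA [As ss adjs cs]; have bs := sta_bop sA As.
have h1 : s \o (-1 *: s + idfun) = 0.
  by rewrite comp_linr// ss; apply/funext => h; rewrite fun_linE scaleN1r addNr.
have h2 : (-1 *: s + idfun) \o s = 0.
  by rewrite comp_linl ss; apply/funext => h; rewrite fun_linE scaleN1r addNr.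
split=> //; split.
- exact: subr_mem.
- by rewrite comp_linl h1; apply/funext => h; rewrite fun_linE scaler0 add0r.
- by rewrite adj_lin ?adjs ?adj_id ?rmorphN ?rmorph1//; exact: bop_id.
- move=> a Aa; rewrite comp_linr ?comp_linl ?cs//; exact: (sta_bop sA).
Qed.

Definition annihilator H K (A : set (H -> H)) (B : set (K -> K)) F E
    (tau : (H -> H) -> F -> F) (sigma : (K -> K) -> E -> E) (X : set (E -> F))
    (S : set (H -> H)) : set (K -> K) :=
  [set b | B b /\ forall a x, S a -> X x -> tau a \o x \o sigma b = 0].

Section Annihilator.
Variables (H K : hilbertType R) (A : set (H -> H)) (B : set (K -> K)) (F E : hilbertType R).
Variables (tau : (H -> H) -> F -> F) (sigma : (K -> K) -> E -> E) (X : set (E -> F)).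
Hypotheses (vA : vna A) (vB : vna B) (biX : bimodule A B tau sigma X).

Let sA := vna_star vA.
Let sB := vna_star vB.
Let st := fr_rep (bi_tau biX).
Let ss := fr_rep (bi_sigma biX).
Let bX := bi_bop biX.
Let lX := bi_left biX.
Let rX := bi_right biX.
Let XB := bi_ipB biX.
Let XA := bi_ipA biX.
Let tX := bi_total biX.

Local Notation ann := (annihilator A B tau sigma X).

(** The annihilator is a self-adjoint two-sided ideal. The range projection of its image under
    [sigma] comes from an element of [B], and this element annihilates too, as may be checked on the
    ranges that span; so it is the unit of the ideal. *)
Lemma annihilator_unit (S : set (H -> H)) : S `<=` A -> exists t, ideal_unit B (ann S) t.
Proof.
move=> SA; pose T := ann S.
have TB : T `<=` B by move=> b [].
have Tl c b : B c -> T b -> T (c \o b).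
  move=> Bc [Bb Sb]; split; first exact: (sta_comp sB).
  by move=> a x Sa Xx; rewrite (rep_comp ss)//; exact: Sb Sa (rX Xx Bc).
have Tr c b : B c -> T b -> T (b \o c).
  move=> Bc [Bb Sb]; split; first exact: (sta_comp sB).
  move=> a x Sa Xx; rewrite (rep_comp ss)//.
  by rewrite -[LHS]/((tau a \o x \o sigma b) \o sigma c) Sb.
(* For [q] the operator to annihilate, [q q^*] vanishes as [T] is a left ideal. *)
have Ta b : T b -> T (adj b).
  move=> Tb; have [Bb Sb] := Tb; have Bb' := sta_adj sB Bb; split=> // a x Sa Xx.
  have Aa := SA _ Sa; have [bt bs] := (rep_bop st Aa, rep_bop ss Bb).
  have bx := bX Xx; have bs' := rep_bop ss Bb'.
  have bq := bop_comp (bop_comp bt bx) bs'.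
  apply/funext => k; set q := _ \o sigma (adj b) in bq *.
  suff adjq0 : adj q = 0 by rewrite -(adjK bq) adjq0 adj0.
  apply/funext => l; apply: innerxx_eq0.
  rewrite -(adjPr bq) (_ : q (adj q l) = 0) ?inner0r//.
  rewrite (adj_comp (bop_comp bt bx) bs') -(rep_adj ss Bb').
  rewrite adjK; last exact: (sta_bop sB).
  have [_ Sbb] := Tl _ _ Bb' Tb.
  have := congr1 (@^~ (adj (tau a \o x) l)) (Sbb a x Sa Xx).
  by rewrite (rep_comp ss Bb' Bb).
have vsB := frep_image_vna vB (bi_sigma biX).
pose e := prj [set v | exists2 j, (sigma @` T) j & exists h, v = j h].
have [t Bt tE] : (sigma @` B) e.
  apply: (unit_mem vsB).
  - by move=> _ [b Tb <-]; exists b => //; exact: TB.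
  - move=> _ _ [b Tb <-] [c Tc <-]; exists (b \o c); first exact: Tl (TB _ Tb) Tc.
    by rewrite (rep_comp ss (TB _ Tb) (TB _ Tc)).
  - move=> _ [b Tb <-]; exists (adj b); first exact: Ta.
    by rewrite (rep_adj ss)//; exact: TB.
have fs := bi_sigma biX.
have tl b : T b -> t \o b = b.
  move=> Tb; have Bb := TB _ Tb.
  apply: (frep_injE sB fs) => //; first exact: (sta_comp sB).
  rewrite (rep_comp ss Bt Bb) tE; apply/funext => h; apply: prj_gen.
  by exists (sigma b); [exists b|exists h].
have tt : adj t = t.
  apply: (frep_injE sB fs) => //; first exact: (sta_adj sB).
  by rewrite (rep_adj ss Bt) tE adj_proj.
have tr b : T b -> b \o t = b.
  move=> Tb; have bb := sta_bop sB (TB _ Tb); have bt := sta_bop sB Bt.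
  have := congr1 (@adj _ _ _) (tl _ (Ta _ Tb)).
  by rewrite (adj_comp bt (bop_adj bb)) (adjK bb) tt.
have Tt : T t.
  split=> // a x Sa Xx; have Aa := SA _ Sa; have [bt bs] := (rep_bop st Aa, rep_bop ss Bt).
  apply/funext => h; rewrite tE -[RHS]/((0 : E -> F) (e h)).
  apply: (bop_span_eq (bop_comp bt (bX Xx)) (@bop_cst0 _ _ _) _ (prj_span _ h)).
  move=> _ [_ [b Tb <-] [k ->]].
  have [_ Sb] := Tb; exact: (congr1 (@^~ k) (Sb a x Sa Xx)).
exists t; split=> //; split=> //; first exact: tl.
(* Both [b t] and [t b] are in the ideal, so both equal [t b t]. *)
by move=> b Bb; rewrite -(tl _ (Tl _ _ Bb Tt)) -[in RHS](tr _ (Tr _ _ Bb Tt)).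
Qed.

(** Let [e] be the range projection of the operators [adj x \o tau s \o y]. The complement of [e]
    comes from the annihilator of [S], hence is below [sigma t]; the hypothesis on [k] says that
    [e k = 0]. *)
Lemma annihilator_full (S : set (H -> H)) s t : S `<=` A -> ideal_unit A S s ->
  ideal_unit B (ann S) t ->
  forall k, (forall x, X x -> tau s (x k) = 0) -> sigma t k = k.
Proof.
move=> SA [[As sss adjs sc] Ss smul] [[Bt ttt adjt tc] Tt tmul] k xk.
have bts := rep_bop st As.
have adjts : adj (tau s) = tau s by rewrite -(rep_adj st As) adjs.
pose J : set (E -> E) :=
  [set j | exists x, exists y, [/\ X x, X y & j = adj x \o tau s \o y]].
pose e := prj [set v | exists2 j, J j & exists h, v = j h].
have vsB := frep_image_vna vB (bi_sigma biX).
have [b0 Bb0 b0E] : (sigma @` B) e.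
  apply: (unit_mem vsB).
  - move=> _ [x [y [Xx Xy ->]]]; have [b Bb bE] := XB Xx (lX As Xy).
    by exists b.
  - move=> _ _ [x [y [Xx Xy ->]]] [x1 [y1 [Xx1 Xy1 ->]]].
    have [a Aa aE] := XA Xy Xx1; exists x, (tau a \o tau s \o y1); split=> //.
      by rewrite -(rep_comp st Aa As); exact: lX (sta_comp sA Aa As) Xy1.
    by rewrite aE.
  - move=> _ [x [y [Xx Xy ->]]]; exists y, x; split=> //.
    have [bx bY] := (bX Xx, bX Xy).
    by rewrite (adj_comp (bop_comp (bop_adj bx) bts) bY) (adj_comp (bop_adj bx) bts) adjts adjK.
pose b1 := -1 *: b0 + idfun; have Bb1 : B b1 by exact: subr_mem.
have b1E h : sigma b1 h = h - e h.
  rewrite /b1 (rep_lin ss)//; last exact: (sta_id sB).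
  by rewrite (rep_id ss) b0E fun_linE scaleN1r addrC.
have Tb1 : ann S b1.
  split=> // a x Sa Xx; have Aa := SA _ Sa.
  rewrite -(smul a Sa) (rep_comp st Aa As); apply/funext => h /=.
  rewrite (_ : tau s (x (sigma b1 h)) = 0); first exact: (bop0 (rep_bop st Aa)).
  apply: tX => y Xy; apply: inner_extr => g; rewrite inner0r b1E.
  rewrite -(adjP (bX Xy)) (adjPr bts) adjts (adjPr (bX Xx)).
  by apply: prj_orth; exists (adj x \o tau s \o y); [exists x, y|exists g].
have ek : e k = 0.
  apply: prj_eq0 => _ [_ [x [y [Xx Xy ->]]] [h ->]] /=.
  by rewrite (adjP (bop_adj (bX Xx))) adjK ?(adjP bts) ?adjts ?xk ?inner0r//; exact: bX.
have b1k : sigma b1 k = k by rewrite b1E ek subr0.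
have tb1 : t \o b1 = b1 by rewrite -(tc _ Bb1) tmul.
rewrite -{1}b1k -[LHS]/((sigma t \o sigma b1) k) -(rep_comp ss Bt Bb1) tb1.
exact: b1k.
Qed.

End Annihilator.

Lemma annihilator_anti H K (A : set (H -> H)) (B : set (K -> K)) F E
    (tau : (H -> H) -> F -> F) (sigma : (K -> K) -> E -> E) (X : set (E -> F)) S S' :
  S `<=` S' -> annihilator A B tau sigma X S' `<=` annihilator A B tau sigma X S.
Proof. by move=> SS' b [Bb Sb]; split=> // a x /SS'; exact: Sb. Qed.

Lemma knaster_tarski (T : Type) (Phi : set T -> set T) :
  (forall S S', S `<=` S' -> Phi S `<=` Phi S') -> exists S, Phi S = S.
Proof.
move=> mono; pose S := \bigcup_(S' in [set S' | S' `<=` Phi S']) S'.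
have SP : S `<=` Phi S.
  move=> x [S' S'P S'x]; apply: (mono S'); last exact: S'P.
  by move=> y S'y; exists S'.
exists S; apply/seteqP; split=> // x PSx; exists (Phi S) => //.
exact: mono.
Qed.

Theorem cantor_bernstein H K (A : set (H -> H)) (B : set (K -> K)) :
  vna A -> vna B -> embeds_in A B -> embeds_in B A ->
  exists F E (tau : (H -> H) -> F -> F) (sigma : (K -> K) -> E -> E) X,
    bimodule A B tau sigma X /\ full X.
Proof.
move=> vA vB [L [K1 [pi [beta [X biX]]]]] [N [H2 [rho [alpha [Y biY]]]]].
have [sA sB] := (vna_star vA, vna_star vB).
pose annX := annihilator A B pi beta X; pose annY := annihilator B A rho alpha Y.
(* The fixed point splits [A] into the ideal of [s], matched by [X] with that of
   [1 - t], and the ideal of [1 - s], matched by the adjoint of [Y] with that of [t]. *)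
have [S SE] : exists S, annY (annX S) = S.
  by apply: knaster_tarski => S S' SS'; do 2 apply: annihilator_anti.
have SA : S `<=` A by rewrite -SE => a [].
pose T := annX S; have TB : T `<=` B by move=> b [].
have [t ut] := annihilator_unit vB biX SA.
have [s us] : exists s, ideal_unit A S s.
  by have := annihilator_unit vA biY TB; rewrite -/annY -/T -/(annX S) SE.
have fullX := annihilator_full vA vB biX SA us ut.
have fullY : forall h, (forall y, Y y -> rho t (y h) = 0) -> alpha s h = h.
  by apply: (annihilator_full vB vA biY TB ut); rewrite -/annY -/T SE.
have [_ annt] := iu_mem ut.
have anns : forall b y, T b -> Y y -> rho b \o y \o alpha s = 0.
  by have := iu_mem us; rewrite -SE => -[].
have Ss := iu_mem us; have Tt := iu_mem ut.
have [cs ct] := (iu_cp us, iu_cp ut).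
have [cs' ss' s's] := central_compl sA cs; have [ct' tt' t't] := central_compl sB ct.
set s' := -1 *: s + idfun in cs' ss' s's; set t' := -1 *: t + idfun in ct' tt' t't.
have s1 : 1 *: s + s' = idfun.
  by apply/funext => h; rewrite fun_linE /s' fun_linE scale1r scaleN1r addrA subrr add0r.
have t1 : 1 *: t' + t = idfun.
  by apply/funext => h; rewrite fun_linE /t' fun_linE scale1r scaleN1r addrAC addNr add0r.
have [fp fb fr fa] := And4 (bi_tau biX) (bi_sigma biX) (bi_tau biY) (bi_sigma biY).
have [sp sb sr sa] := And4 (fr_rep fp) (fr_rep fb) (fr_rep fr) (fr_rep fa).
have [P PE] := cut_exists fp fa cs cs'.
have [e eE] := cut_exists fb fr ct' ct.
have prP a : A a -> forall f, P (sum_rep pi alpha a (P f)) = sum_rep pi alpha a (P f).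
  by move=> Aa; exact: (cut_comm fp fa cs cs' PE).
have pre b : B b -> forall f, e (sum_rep beta rho b (e f)) = sum_rep beta rho b (e f).
  by move=> Bb; exact: (cut_comm fb fr ct' ct eE).
have [bX bY] := (bi_bop biX, bi_bop biY).
have [biP bcP] := (@bop_pincl _ _ P, @bop_pcut _ _ P).
have [bie bce] := (@bop_pincl _ _ e, @bop_pcut _ _ e).
(* The direct sum of [x] and the adjoint of [y], cut by [t'] and [t] on the source and by [s] and
   [s'] on the target. *)
pose w (x : K1 -> L) (y : H2 -> N) : prange e -> prange P :=
  @pcut _ _ P \o diag x (adj y) \o @pincl _ _ e.
have bd x y : X x -> Y y -> bounded_op (diag x (adj y)).
  by move=> Xx Yy; exact: bop_diag (bX _ Xx) (bop_adj (bY _ Yy)).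
have bw x y : X x -> Y y -> bounded_op (w x y).
  by move=> Xx Yy; apply: bop_comp bie; exact: bop_comp bcP (bd _ _ Xx Yy).
have adjw x y : X x -> Y y -> adj (w x y) = @pcut _ _ e \o diag (adj x) y \o @pincl _ _ P.
  move=> Xx Yy; rewrite (adj_comp (bop_comp bcP (bd _ _ Xx Yy)) bie).
  rewrite (adj_comp bcP (bd _ _ Xx Yy)) adj_pincl adj_pcut.
  by rewrite (adj_diag (bX _ Xx) (bop_adj (bY _ Yy))) adjK//; exact: bY.
pose W := [set w x y | x in X & y in Y].
exists (prange P), (prange e), (compress (sum_rep pi alpha) P),
  (compress (sum_rep beta rho) e), W.
have [X0 Y0] : X 0 /\ Y 0 by split; [case: (bi_lin biX)|case: (bi_lin biY)].
have stP := star_rep_compress sA (star_rep_sum fp fa) prP.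
split; first split.
- exact: (frep_cut sA fp fa cs cs' s1 PE).
- exact: (frep_cut sB fb fr ct' ct t1 eE).
- by move=> _ [x Xx [y Yy <-]]; exact: bw.
- split.
    exists 0 => //; exists 0 => //; apply/funext => k.
    rewrite /w adj0 /= (_ : diag _ _ _ = 0) ?(bop0 bcP)//.
    by apply: dsum_ext; rewrite ?fst_diag ?snd_diag//; exact: bop_cst0.
  move=> c _ _ [x Xx [y Yy <-]] [x' Xx' [y' Yy' <-]].
  exists (c *: x + x'); first by case: (bi_lin biX) => _; apply.
  exists (c^* *: y + y'); first by case: (bi_lin biY) => _; apply.
  have [by1 by2] := (bY _ Yy, bY _ Yy').
  rewrite /w (adj_lin _ by1 by2) conjCK.
  rewrite (diag_lin c (bX _ Xx) (bX _ Xx') (bop_adj by1) (bop_adj by2)).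
  by rewrite comp_linr.
- move=> a _ Aa [x Xx [y Yy <-]]; have Aa' := sta_adj sA Aa.
  exists (pi a \o x); first exact: (bi_left biX).
  exists (y \o alpha (adj a)); first exact: (bi_right biY).
  rewrite /w (adj_comp (bY _ Yy) (rep_bop sa Aa')) -(rep_adj sa Aa').
  rewrite adjK; last exact: (sta_bop sA).
  rewrite (diag_comp (rep_bop sp Aa) (rep_bop sa Aa) (bX _ Xx) (bop_adj (bY _ Yy))).
  apply/funext => k; exact: (esym (compress_pcut sA (star_rep_sum fp fa) prP _ Aa)).
- move=> _ b [x Xx [y Yy <-]] Bb; have Bb' := sta_adj sB Bb.
  exists (x \o beta b); first exact: (bi_right biX).
  exists (rho (adj b) \o y); first exact: (bi_left biY).
  rewrite /w (adj_comp (rep_bop sr Bb') (bY _ Yy)) -(rep_adj sr Bb').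
  rewrite adjK; last exact: (sta_bop sB).
  rewrite (diag_comp (bX _ Xx) (bop_adj (bY _ Yy)) (rep_bop sb Bb) (rep_bop sr Bb)).
  apply/funext => k; apply: (congr1 (fun f => pcut P (diag x (adj y) f))).
  exact: (esym (pincl_compress pre k Bb)).
(* The two diagonal entries of the inner product come from possibly different [b1] and [b2]; on the
   cut a single element of [B] gives both. *)
- move=> _ _ [x Xx [y Yy <-]] [x' Xx' [y' Yy' <-]].
  have [b1 Bb1 b1E] := bi_ipB biX Xx (bi_left biX (cp_mem cs) Xx').
  have [b2 Bb2 b2E] := bi_ipA biY (bi_right biY Yy (cp_mem cs')) Yy'.
  have [b Bb bE] := cut_combine sB fb fr ct' ct t't eE Bb1 Bb2.
  exists b => //; rewrite bE adjw// b1E b2E.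
  have [bx bx' by1 by2] := And4 (bop_adj (bX _ Xx)) (bX _ Xx') (bY _ Yy) (bop_adj (bY _ Yy')).
  have [bps bas] := (rep_bop sp (cp_mem cs), rep_bop sa (cp_mem cs')).
  have [c1 c2] := (bop_comp bx (bop_comp bps bx'), bop_comp (bop_comp by1 bas) by2).
  apply/funext => k; apply: (congr1 (pcut e)).
  rewrite -[RHS]/(diag (adj x) y (P (diag x' (adj y') (pincl k)))) PE.
  by apply: dsum_ext; rewrite ?fst_diag ?snd_diag.
- move=> _ _ [x Xx [y Yy <-]] [x' Xx' [y' Yy' <-]].
  have [a1 Aa1 a1E] := bi_ipA biX (bi_right biX Xx (cp_mem ct')) Xx'.
  have [a2 Aa2 a2E] := bi_ipB biY Yy (bi_left biY (cp_mem ct) Yy').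
  have [a Aa aE] := cut_combine sA fp fa cs cs' ss' PE Aa1 Aa2.
  exists a => //; rewrite aE adjw// a1E a2E.
  have [bx bx' by1 by2] := And4 (bX _ Xx) (bop_adj (bX _ Xx')) (bop_adj (bY _ Yy)) (bY _ Yy').
  have [bbt brt] := (rep_bop sb (cp_mem ct'), rep_bop sr (cp_mem ct)).
  have [c1 c2] := (bop_comp (bop_comp bx bbt) bx', bop_comp by1 (bop_comp brt by2)).
  apply/funext => k; apply: (congr1 (pcut P)).
  rewrite -[RHS]/(diag x (adj y) (e (diag (adj x') y' (pincl k)))) eE.
  by apply: dsum_ext; rewrite ?fst_diag ?snd_diag.
- have [bps bas] := (rep_bop sp (cp_mem cs), rep_bop sa (cp_mem cs')).
  have [bbt brt] := (rep_bop sb (cp_mem ct'), rep_bop sr (cp_mem ct)).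
  move=> l lX; have PlE := proj_pincl l; rewrite PE in PlE.
  have l1E : pi s (fst_of (pincl l)) = fst_of (pincl l).
    by rewrite -[in RHS]PlE fst_diag.
  have l2E : alpha s' (snd_of (pincl l)) = snd_of (pincl l).
    by rewrite -[in RHS]PlE snd_diag.
  have key x y : X x -> Y y -> beta t' (adj x (fst_of (pincl l))) = 0 /\
      rho t (y (snd_of (pincl l))) = 0.
    move=> Xx Yy; have : adj (w x y) l = 0 by apply: lX; exists x => //; exists y.
    rewrite adjw// => /(congr1 (@pincl _ _ e)).
    rewrite -[pincl _]/(e (diag (adj x) y (pincl l))) eE (bop0 bie) => h.
    have [bx by1] := (bop_adj (bX _ Xx), bY _ Yy).
    split; first by have := congr1 (@fst_of _ _ _) h; rewrite !fst_diag.
    by have := congr1 (@snd_of _ _ _) h; rewrite !snd_diag.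
  (* For the first component [l1], [beta t'] kills [adj x l1] by the choice of [l], and [beta t]
     kills it because [pi s \o x \o beta t = 0]; so [adj x l1 = 0], and [X] is total. *)
  apply: pincl_inj; rewrite (bop0 biP); apply: dsum_ext.
    apply: (bi_total biX) => x Xx; have [h _] := key _ _ Xx Y0.
    have bx := bX _ Xx.
    have : adj (pi s \o x \o beta t) (fst_of (pincl l)) = 0 by rewrite annt// adj0.
    have bt := rep_bop sb (cp_mem ct).
    rewrite (adj_comp (bop_comp bps bx) bt) (adj_comp bps bx) -(rep_adj sp (cp_mem cs)) (cp_adj cs).
    rewrite -(rep_adj sb (cp_mem ct)) (cp_adj ct) /= l1E.
    move: h; rewrite (rep_lin sb (-1) (cp_mem ct) (sta_id sB)) (rep_id sb) fun_linE => + h0.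
    by rewrite h0 scaler0 add0r.
  (* The second component is fixed by [alpha s] thanks to [fullY] and by [alpha s'] thanks to the
     cut, so it vanishes. *)
  have := l2E; rewrite (rep_lin sa (-1) (cp_mem cs) (sta_id sA)) (rep_id sa) fun_linE.
  rewrite fullY => [|y Yy]; last by have [] := key _ _ X0 Yy.
  by rewrite scaleN1r addNr => <-.
- have [bps bas] := (rep_bop sp (cp_mem cs), rep_bop sa (cp_mem cs')).
  have [bbt brt] := (rep_bop sb (cp_mem ct'), rep_bop sr (cp_mem ct)).
  move=> k kW; have ekE := proj_pincl k; rewrite eE in ekE.
  have k1E : beta t' (fst_of (pincl k)) = fst_of (pincl k).
    by rewrite -[in RHS]ekE fst_diag.
  have k2E : rho t (snd_of (pincl k)) = snd_of (pincl k).
    by rewrite -[in RHS]ekE snd_diag.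
  have key x y : X x -> Y y -> pi s (x (fst_of (pincl k))) = 0 /\
      alpha s' (adj y (snd_of (pincl k))) = 0.
    move=> Xx Yy; have : w x y k = 0 by apply: kW; exists x => //; exists y.
    move=> /(congr1 (@pincl _ _ P)).
    rewrite -[pincl _]/(P (diag x (adj y) (pincl k))) PE (bop0 biP) => h.
    have [bx by1] := (bX _ Xx, bop_adj (bY _ Yy)).
    split; first by have := congr1 (@fst_of _ _ _) h; rewrite !fst_diag.
    by have := congr1 (@snd_of _ _ _) h; rewrite !snd_diag.
  (* The same two arguments with the roles of the summands exchanged. *)
  apply: pincl_inj; rewrite (bop0 bie); apply: dsum_ext.
    have := k1E; rewrite (rep_lin sb (-1) (cp_mem ct) (sta_id sB)) (rep_id sb) fun_linE.
    rewrite fullX => [|x Xx]; last by have [] := key _ _ Xx Y0.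
    by rewrite scaleN1r addNr => <-.
  apply: (bi_total biY) => y Yy; have [_ h] := key _ _ X0 Yy.
  have by1 := bY _ Yy.
  have : adj (rho t \o y \o alpha s) (snd_of (pincl k)) = 0 by rewrite anns// adj0.
  have bs := rep_bop sa (cp_mem cs).
  rewrite (adj_comp (bop_comp brt by1) bs) (adj_comp brt by1) -(rep_adj sr (cp_mem ct)) (cp_adj ct).
  rewrite -(rep_adj sa (cp_mem cs)) (cp_adj cs) /= k2E.
  move: h; rewrite (rep_lin sa (-1) (cp_mem cs) (sta_id sA)) (rep_id sa) fun_linE => + h0.
  by rewrite h0 scaler0 add0r.
Qed.

End CantorBernstein.

(** * Rieffel's bimodule *)

Section BimoduleSpace.
Variables (R : realType) (E F : hilbertType R) (X : set (E -> F)).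

(** Carved out of [span X] so that the module structure needs no hypothesis on [X]; for a linear [X]
    the two sets coincide, which is [op_valX]. *)
Record op_space : Type := OpSpace {
  op_val :> E -> F ;
  op_valP : op_val \in [pred T : E -> F | `[< span X T >]]
}.

HB.instance Definition _ := [isSub of op_space for op_val].
HB.instance Definition _ := [Choice of op_space by <:].

Lemma op_submod : GRing.submod_closed [pred T : E -> F | `[< span X T >]].
Proof.
have [X0 lX] := span_linear X.
split=> [|c x y]; first exact/asboolP.
by move=> /asboolP Xx /asboolP Xy; apply/asboolP; exact: lX.
Qed.

HB.instance Definition _ :=
  GRing.SubChoice_isSubLmodule.Build R[i] (E -> F) _ op_space op_submod.

Lemma op_val_lin (c : R[i]) (x y : op_space) :
  op_val (c *: x + y) = c *: op_val x + op_val y.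
Proof. by rewrite -[LHS]/(val _) linearP. Qed.

Lemma op_valX (x : op_space) : linear_set X -> X (op_val x).
Proof. by move=> lX; have /asboolP Xx := op_valP x; exact: (span_sub lX (fun _ => id) Xx). Qed.

Lemma op_insubd (x : op_space) T : X T -> op_val (insubd x T) = T.
Proof. by move=> XT; apply: insubdK; apply/asboolP; exact: sub_span. Qed.

End BimoduleSpace.

Section RieffelBimodule.
Variable R : realType.
Implicit Types H K L E F : hilbertType R.

Lemma op_bound_hnorm H (a : H -> H) (c : R[i]) : op_bound a c <->
  exists2 d : R, 0 <= d & c = d%:C%C /\ forall h, hnorm (a h) <= d * hnorm h.
Proof.
split=> [[c0 ac]|[d d0 [-> ad]]].
  move: c0 ac; case: c => d i c0 ac.
  have /eqP i0 : i == 0 by move: c0; rewrite lecE => /andP[].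
  move: c0 ac; rewrite i0 -[(d +i* 0)%C]/(d%:C%C) => c0 ac; exists d; first by move: c0; rewrite ler0c.
  by split=> // h; have := ac h; rewrite !hnormE -rmorphM lecR.
by split=> [|h]; rewrite ?ler0c// !hnormE -rmorphM lecR.
Qed.

Section FullBimodule.
Variables (H K : hilbertType R) (A : set (H -> H)) (B : set (K -> K)) (F E : hilbertType R).
Variables (tau : (H -> H) -> F -> F) (sigma : (K -> K) -> E -> E) (X : set (E -> F)).
Hypotheses (vA : vna A) (vB : vna B) (biX : bimodule A B tau sigma X).

Let sA := vna_star vA.
Let sB := vna_star vB.
Let ft := bi_tau biX.
Let fs := bi_sigma biX.
Let st := fr_rep ft.
Let ss := fr_rep fs.
Let bX := bi_bop biX.
Let lX := bi_left biX.
Let rX := bi_right biX.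

(** If [a] is annihilated by this ideal, then [x \o adj y \o tau a = 0] for all [x] and [y];
    fullness removes [x] and totality removes [adj y]. *)
Lemma inner_product_dense : full X ->
  wspan [set a | A a /\ exists x y, [/\ X x, X y & tau a = x \o adj y]] = A.
Proof.
move=> fX; apply: ideal_dense => //.
- by move=> a [].
- move=> a j Aa [Aj [x [y [Xx Xy jE]]]]; split; first exact: (sta_comp sA).
  by exists (tau a \o x), y; split=> //; [exact: lX|rewrite (rep_comp st)// jE].
- move=> j [Aj [x [y [Xx Xy jE]]]]; split; first exact: (sta_adj sA).
  exists y, x; split=> //; rewrite (rep_adj st)// jE.
  by rewrite (adj_comp (bX Xx) (bop_adj (bX Xy))) adjK//; exact: bX.
- move=> a Aa a0; apply: (fr_inj ft Aa); apply/funext => h.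
  apply: (bi_total biX) => y Xy; apply: fX => x Xx.
  have [b Ab bE] := bi_ipA biX Xx Xy.
  have : tau (b \o a) = 0.
    by rewrite a0 ?(rep0 (sta_linear sA) st)//; split=> //; exists x, y.
  by rewrite (rep_comp st)// bE => /(congr1 (@^~ h)).
Qed.

(** Positivity may be read in [sigma] and the bound on [a] in [tau]; there the claim is
    [|tau a (x h)| <= d |x h|]. *)
Lemma module_action_bounded x a (c : R[i]) b1 b2 : X x -> A a -> op_bound a c -> B b1 -> B b2 ->
  sigma b1 = adj x \o x -> sigma b2 = adj (tau a \o x) \o (tau a \o x) ->
  positive_op (c ^+ 2 *: b1 - b2).
Proof.
move=> Xx Aa /op_bound_hnorm[d d0 [-> ad]] Bb1 Bb2 b1E b2E.
have Bc := star_algebraZ (d%:C%C ^+ 2) sB Bb1.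
have -> : d%:C%C ^+ 2 *: b1 - b2 = -1 *: b2 + d%:C%C ^+ 2 *: b1.
  by apply/funext => h; rewrite fun_linE scaleN1r addrC.
have Bb := star_algebra_lin (-1) sB Bb2 Bc.
apply: (frep_positive vB fs (frep_id sB) Bb) => h.
have [bx ba] := (bX Xx, rep_bop st Aa); have bax := bop_comp ba bx.
rewrite (rep_lin ss)// (repZ _ sB ss)// fun_linE -[(_ *: sigma b1) h]/(_ *: sigma b1 h).
rewrite b1E b2E innerDl !innerZl /= !(adjP (bop_adj _))// !adjK// !innerxx.
rewrite mulN1r addrC subr_ge0 -rmorphXn -rmorphM lecR.
rewrite -exprMn ler_pXn2r ?nnegrE ?mulr_ge0 ?hnorm_ge0//.
exact: (frep_norm_le vA (frep_id sA) ft Aa d0 ad).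
Qed.

(** An embedding [W] of the identity representation of [B] in an amplification of [sigma] gives [|f
    a h| <= c |bamp (tau a) (bamp y (W h))|], the bound asked for by [wcontinuous_crit]. *)
Lemma module_action_normal x y (f : (H -> H) -> K -> K) : X x -> X y ->
  (forall a, A a -> B (f a)) -> (forall a, A a -> sigma (f a) = adj x \o (tau a \o y)) ->
  wcontinuous_on A f.
Proof.
move=> Xx Xy Bf fE; have [bx by1] := (bX Xx, bX Xy).
have fi := frep_id sB.
have [W [bW iW WE]] := frep_embed vB fs (star_rep_id sB) (fr_dom fi).
have [c c0 xc] := bop_bound (bop_bamp (L := K) (bop_adj bx)).
have [d d0 yd] := bop_bound (bop_comp (bop_bamp (L := K) by1) bW).
apply: (wcontinuous_crit (rho := fun a => bamp (L := K) (tau a)) (S := bamp y \o W)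
  (c := c) (d := d) sA (star_rep_bamp K st)) => //.
- exact: (dominated_bamp sA st (fr_dom ft)).
- by move=> a Aa; exact: (sta_bop sB (Bf _ Aa)).
- move=> k a b Aa Ab; have Aab := star_algebra_lin k sA Aa Ab.
  have Bab := star_algebra_lin k sB (Bf _ Aa) (Bf _ Ab).
  apply: (frep_injE sB fs (Bf _ Aab) Bab).
  rewrite (rep_lin ss (k : R[i]) (Bf _ Aa) (Bf _ Ab)) !fE// (rep_lin st)// comp_linl.
  by rewrite comp_linr//; exact: bop_adj.
- move=> a Aa h; rewrite -iW.
  have /= -> := congr1 (@^~ h) (WE _ (Bf _ Aa)); rewrite fE//.
  have ba := rep_bop st Aa.
  rewrite (bamp_comp (bop_adj bx) (bop_comp ba by1)) (bamp_comp ba by1).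
  exact: xc.
Qed.

End FullBimodule.

Definition rep_inv H (A : set (H -> H)) F (tau : (H -> H) -> F -> F) (T : F -> F) : H -> H :=
  xget 0 [set a | A a /\ tau a = T].

Lemma rep_invP H (A : set (H -> H)) F (tau : (H -> H) -> F -> F) (T : F -> F) :
  (tau @` A) T -> A (rep_inv A tau T) /\ tau (rep_inv A tau T) = T.
Proof. by move=> [a Aa aT]; rewrite /rep_inv; case: xgetP => [b -> //|/(_ a)]; case. Qed.

(** The inner products are [x \o adj y] and [adj x \o y] pulled back along [tau] and [sigma];
    algebraic identities are checked after applying these injective maps. Statements about the right
    action come from the left action on the adjoint bimodule. *)
Theorem full_weakly_Morita_equiv H K (A : set (H -> H)) (B : set (K -> K)) F E
    (tau : (H -> H) -> F -> F) (sigma : (K -> K) -> E -> E) X :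
  vna A -> vna B -> bimodule A B tau sigma X -> full X -> weakly_Morita_equiv A B.
Proof.
move=> vA vB biX fX; have [ft fs bX lX lX1 rX1 XB XA tX] := biX.
have [sA sB] := (vna_star vA, vna_star vB).
have [st ss] := (fr_rep ft, fr_rep fs).
have biY := bimodule_sym sA sB biX fX.
have fY := full_adjs tX.
have opX (x : op_space X) : X x by exact: op_valX.
have opb (x : op_space X) : bounded_op x by exact: bX.
have Yx (x : op_space X) : adjs X (adj x) by exists (op_val x).
(* [insubd] falls back to [x] when the product leaves [span X]; for [a] in [A] this does not
   occur. *)
pose la (a : H -> H) (x : op_space X) : op_space X := insubd x (tau a \o x).
pose rb (x : op_space X) (b : K -> K) : op_space X := insubd x (x \o sigma b).
pose ipA (x y : op_space X) := rep_inv A tau (x \o adj y).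
pose ipB (x y : op_space X) := rep_inv B sigma (adj x \o y).
have laE a x : A a -> op_val (la a x) = tau a \o x.
  by move=> Aa; apply: op_insubd; exact: lX1.
have rbE b x : B b -> op_val (rb x b) = x \o sigma b.
  by move=> Bb; apply: op_insubd; exact: rX1.
have ipAP x y : A (ipA x y) /\ tau (ipA x y) = x \o adj y.
  by apply: rep_invP; have [a Aa aE] := XA _ _ (opX x) (opX y); exists a.
have ipBP x y : B (ipB x y) /\ sigma (ipB x y) = adj x \o y.
  by apply: rep_invP; have [a Aa aE] := XB _ _ (opX x) (opX y); exists a.
have ipAm x y : A (ipA x y) by case: (ipAP x y).
have ipAE x y : tau (ipA x y) = x \o adj y by case: (ipAP x y).
have ipBm x y : B (ipB x y) by case: (ipBP x y).
have ipBE x y : sigma (ipB x y) = adj x \o y by case: (ipBP x y).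
have op_inj (x y : op_space X) : op_val x = op_val y -> x = y by exact: val_inj.
have tau_inj a a' : A a -> A a' -> tau a = tau a' -> a = a' by exact: frep_injE.
have sigma_inj b b' : B b -> B b' -> sigma b = sigma b' -> b = b' by exact: frep_injE.
have lA (c : R[i]) a b : A a -> A b -> A (c *: a + b) by exact: star_algebra_lin.
have lB (c : R[i]) a b : B a -> B b -> B (c *: a + b) by exact: star_algebra_lin.
have cA := sta_comp sA; have cB := sta_comp sB.
have bA := sta_bop sA; have bB := sta_bop sB.
exists (op_space X : lmodType R[i]), la, rb, ipA, ipB; split.
- move=> a Aa c x y; apply: op_inj; rewrite op_val_lin !laE// op_val_lin comp_linr//.
  exact: (rep_bop st).
- move=> c a a' x Aa Aa'; apply: op_inj; rewrite op_val_lin.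
  by rewrite (laE _ x (lA c _ _ Aa Aa')) (laE _ x Aa) (laE _ x Aa') (rep_lin st c Aa Aa').
- move=> a a' x Aa Aa'; apply: op_inj; rewrite (laE _ x (cA _ _ Aa Aa')).
  by rewrite (laE _ (la a' x) Aa) (laE _ x Aa') (rep_comp st Aa Aa').
- by move=> x; apply: op_inj; rewrite (laE _ x (sta_id sA)) (rep_id st).
- by move=> b Bb c x y; apply: op_inj; rewrite op_val_lin !rbE// op_val_lin comp_linl.
- move=> c b b' x Bb Bb'; apply: op_inj; rewrite op_val_lin.
  rewrite (rbE _ x (lB c _ _ Bb Bb')) (rbE _ x Bb) (rbE _ x Bb') (rep_lin ss c Bb Bb').
  by rewrite (comp_linr _ _ _ (opb x)).
- move=> b b' x Bb Bb'; apply: op_inj; rewrite (rbE _ x (cB _ _ Bb Bb')).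
  by rewrite (rbE _ (rb x b) Bb') (rbE _ x Bb) (rep_comp ss Bb Bb').
- by move=> x; apply: op_inj; rewrite (rbE _ x (sta_id sB)) (rep_id ss).
- move=> a b x Aa Bb; apply: op_inj.
  by rewrite (laE _ _ Aa) (rbE _ x Bb) (rbE _ (la a x) Bb) (laE _ x Aa).
- exact: ipAm.
- move=> y c x x'; apply: tau_inj => //; first exact: lA.
  by rewrite ipAE op_val_lin comp_linl (rep_lin st)// !ipAE.
- move=> a x y Aa; apply: tau_inj => //; first exact: cA.
  by rewrite ipAE laE// (rep_comp st)// ipAE.
- move=> x y; suff -> : ipA y x = adj (ipA x y) by exact: adjP (bA _ (ipAm _ _)).
  apply: tau_inj => //; first exact: (sta_adj sA).
  by rewrite (rep_adj st)// !ipAE (adj_comp (opb x) (bop_adj (opb y))) adjK.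
- move=> x; apply: (frep_positive vA ft (frep_id sA) (ipAm x x)) => h.
  by rewrite ipAE /= (adjP (opb x)) innerxx ler0c sqr_ge0.
- move=> x x0; have := ipAE x x; rewrite x0 (rep0 (sta_linear sA) st) => xx.
  apply: op_inj; rewrite -[op_val x](adjK (opb x)) -[RHS]/(0 : E -> F).
  suff -> : adj x = 0 by rewrite adj0.
  apply/funext => l; apply: innerxx_eq0; rewrite -(adjP (opb x)).
  by rewrite -[op_val x _]/((x \o adj x) l) -xx inner0l.
- rewrite -[RHS](inner_product_dense vA biX fX); congr wspan.
  apply/seteqP; split=> [_ [x [y ->]]|a [Aa [x [y [Xx Xy aE]]]]].
    by split=> //; exists x, y.
  have [zx zxE] : exists z : op_space X, op_val z = x by exists (insubd 0 x); exact: op_insubd.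
  have [zy zyE] : exists z : op_space X, op_val z = y by exists (insubd 0 y); exact: op_insubd.
  by exists zx, zy; apply: tau_inj => //; rewrite ipAE zxE zyE.
- exact: ipBm.
- move=> x c y y'; apply: sigma_inj => //; first exact: lB.
  by rewrite ipBE op_val_lin comp_linr ?(rep_lin ss) ?ipBE//; exact: bop_adj.
- move=> b x y Bb; apply: sigma_inj => //; first exact: cB.
  by rewrite ipBE rbE// (rep_comp ss)// ipBE.
- move=> x y; suff -> : ipB y x = adj (ipB x y) by exact: adjP (bB _ (ipBm _ _)).
  apply: sigma_inj => //; first exact: (sta_adj sB).
  by rewrite (rep_adj ss)// !ipBE (adj_comp (bop_adj (opb x)) (opb y)) adjK.
- move=> x; apply: (frep_positive vB fs (frep_id sB) (ipBm x x)) => h.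
  by rewrite ipBE /= -(adjPr (opb x)) innerxx ler0c sqr_ge0.
- move=> x x0; have := ipBE x x; rewrite x0 (rep0 (sta_linear sB) ss) => xx.
  apply: op_inj; rewrite -[RHS]/(0 : E -> F).
  apply/funext => l; apply: innerxx_eq0; rewrite (adjP (opb x)).
  by rewrite -[adj x _]/((adj x \o x) l) -xx inner0r.
- rewrite -[RHS](inner_product_dense vB biY fY); congr wspan.
  apply/seteqP; split=> [_ [x [y ->]]|b [Bb [_ [_ [[x Xx <-] [y Xy <-] bE]]]]].
    by split=> //; exists (adj x), (adj y); split=> //; rewrite ipBE adjK.
  have [zx zxE] : exists z : op_space X, op_val z = x by exists (insubd 0 x); exact: op_insubd.
  have [zy zyE] : exists z : op_space X, op_val z = y by exists (insubd 0 y); exact: op_insubd.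
  exists zx, zy; apply: sigma_inj => //; rewrite ipBE zxE zyE bE adjK//; exact: bX.
- by move=> x y z; apply: op_inj; rewrite laE// rbE// ipAE ipBE.
- move=> a a' x y Aa aa'; have Eq := adj_uniq (bA _ Aa) aa'.
  have Aa' : A a' by rewrite Eq; exact: (sta_adj sA).
  apply: sigma_inj => //; rewrite !ipBE !laE//.
  by rewrite (adj_comp (rep_bop st Aa) (opb x)) -(rep_adj st Aa) -Eq.
- move=> a c x Aa ac.
  apply: (module_action_bounded vA vB biX (opX x) Aa ac) => //; rewrite ipBE//.
  by rewrite laE.
- move=> x y; apply: (module_action_normal vA vB biX (opX x) (opX y)) => // a Aa.
  by rewrite ipBE laE.
- move=> b b' x y Bb bb'; have Eq := adj_uniq (bB _ Bb) bb'.
  have Bb' : B b' by rewrite Eq; exact: (sta_adj sB).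
  apply: tau_inj => //; rewrite !ipAE !rbE//.
  rewrite (adj_comp (opb y) (rep_bop ss Bb')) -(rep_adj ss Bb') Eq adjK//.
  exact: bB.
(* Acting by [b] on the right of [x] is acting by [adj b] on the left of [adj x], and [adj b] has
   the same bound as [b]. *)
- move=> b c x Bb bc; have Bb' := sta_adj sB Bb.
  have bc' : op_bound (adj b) c.
    move/op_bound_hnorm: bc => [d d0 [cd bd]]; apply/op_bound_hnorm; exists d => //.
    by split=> //; exact: hnorm_adj_le (bB _ Bb) bd d0.
  apply: (module_action_bounded vB vA biY (Yx x) Bb' bc') => //; rewrite ipAE ?adjK//.
  rewrite rbE// (adj_comp (opb x) (rep_bop ss Bb)) -(rep_adj ss Bb).
  rewrite (adj_comp (rep_bop ss Bb') (bop_adj (opb x))) -(rep_adj ss Bb') !adjK//.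
  exact: bB.
- move=> x y; apply: (module_action_normal vB vA biY (Yx x) (Yx y)) => // b Bb.
  by rewrite ipAE rbE// adjK.
Qed.

End RieffelBimodule.

Theorem theorem2p16 (R : realType) :
  [/\ forall A : vnAlgebra R, delta_embeds A A,
      forall A B C : vnAlgebra R,
        delta_embeds A B -> delta_embeds B C -> delta_embeds A C &
      forall A B : vnAlgebra R,
        delta_embeds A B -> delta_embeds B A ->
        weakly_Morita_equiv A B /\ delta_equiv A B].
Proof.
have vP (A : vnAlgebra R) : vna A := vna_of (vn_axiom A).
split=> [A|A B C AB BC|A B AB BA].
- apply: embeds_in_delta => //.
  by exists (vn_space A), (vn_space A), id, id, (vn_set A); exact: bimodule_refl.
- apply: embeds_in_delta => //; apply: (embeds_in_trans (vP A) (vP B) (vP C)).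
    exact: delta_embeds_bimodule.
  exact: delta_embeds_bimodule.
- have [F [E [tau [sigma [X [biX fX]]]]]] := cantor_bernstein (vP A) (vP B)
    (delta_embeds_bimodule (vP A) (vP B) AB) (delta_embeds_bimodule (vP B) (vP A) BA).
  split; first exact: full_weakly_Morita_equiv biX fX.
  exact: full_delta_equiv biX fX.
Qed.
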